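(* Let $p,q,r\in[0,1]$ with $p+q+r=1$ and $0<r<1$, let $s\in[0,1]$, and let $(S_n)$ be the elephant random walk with stops (ERWS) with parameters $p,q,r,s$, with number of ones $\Sigma_n=\sum_{k=1}^nX_k^2$. Assume the diffusive regime $\frac{p}{1-r}<\frac34$ and set $$\sigma_r^2=\frac{1-r}{3(1-r)-4p},\qquad \sigma_r>0.$$ Then $$\limsup_{n\to\infty}\frac{S_n}{\sqrt{2\Sigma_n\log\log\Sigma_n}}=-\liminf_{n\to\infty}\frac{S_n}{\sqrt{2\Sigma_n\log\log\Sigma_n}}=\sigma_r\qquad\text{almost surely},$$ leading to $$\limsup_{n\to\infty}\frac{S_n^2}{2\Sigma_n\log\log\Sigma_n}=\sigma_r^2\qquad\text{almost surely}.$$ Moreover, $$\limsup_{n\to\infty}\frac{S_n}{\sqrt{2n^{1-r}\log\log n}}=-\liminf_{n\to\infty}\frac{S_n}{\sqrt{2n^{1-r}\log\log n}}=\sigma_r\sqrt{\Sigma}\qquad\text{almost surely},$$ implying that $$\limsup_{n\to\infty}\frac{S_n^2}{2n^{1-r}\log\log n}=\sigma_r^2\,\Sigma\qquad\text{almost surely},$$ where $\Sigma$ is the almost sure limit $\Sigma=\lim_{n\to\infty}n^{-(1-r)}\Sigma_n$.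
   Context: The elephant random walk with stops (ERWS) is defined as follows. The parameters are $p,q,r\in[0,1]$ with $p+q+r=1$, where $0<r<1$ is assumed throughout, and $s\in[0,1]$. The first step $X_1$ equals $+1$ with probability $s$ and $-1$ with probability $1-s$. For each $n\ge 1$, given $X_1,\dots,X_n$, an integer $k$ is chosen uniformly at random in $\{1,\dots,n\}$ and, independently of this choice and of the past, $X_{n+1}=X_k$ with probability $p$, $X_{n+1}=-X_k$ with probability $q$, and $X_{n+1}=0$ with probability $r$. The position of the ERWS is $S_0=0$ and $S_n=\sum_{k=1}^n X_k$ for $n\ge1$. The number of ones up to time $n$ is $\Sigma_n=\sum_{k=1}^n X_k^2$. The sequence $n^{-(1-r)}\Sigma_n$ converges almost surely to a random variable $\Sigma$ which is positive with probability one and has a Mittag-Leffler distribution with parameter $1-r$, i.e. $\mathbb{E}[\Sigma^m]=\frac{m!}{\Gamma(1+m(1-r))}$ for all integers $m\ge1$ (these moments characterize the distribution). In particular $\Sigma_n\to\infty$ almost surely, so the iterated logarithms are well defined and positive for all $n$ large enough. *)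

(* Defs.v *)
From HB Require Import structures.
From mathcomp Require Import all_boot all_order all_algebra.
From mathcomp Require Import all_classical all_reals all_analysis.

Set Implicit Arguments.
Unset Strict Implicit.
Unset Printing Implicit Defensive.

Import Order.TTheory GRing.Theory Num.Theory.
Import numFieldNormedType.Exports.

Local Open Scope classical_set_scope.
Local Open Scope ring_scope.

(* Steps are numbered from 1; the values at index 0 of the three sequences are
   irrelevant.  [erws_memory n] and [erws_sign n] drive step n.+1.  Summing
   [erws_choice] over the 3n pairs (k, a) shows that they take no other values,
   up to a null set. *)
Record erws (d : measure_display) (T : measurableType d) (R : realType)
    (P : probability T R) (p q r s : R) := Erws {
  erws_step : nat -> {RV P >-> R} ;
  erws_memory : nat -> {RV P >-> nat} ;
  erws_sign : nat -> {RV P >-> R} ;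
  erws_first_pos : P [set w | erws_step 1 w = 1] = s%:E ;
  erws_first_neg : P [set w | erws_step 1 w = -1] = (1 - s)%:E ;
  erws_next : forall n w, (1 <= n)%N ->
    erws_step n.+1 w = erws_sign n w * erws_step (erws_memory n w) w ;
  (* Given the first n steps, the remembered time is uniform on {1, ..., n} and
     the sign is independent of it and of these steps; steps being discrete,
     conditioning is expressed on the events [X_1 = x_1, ..., X_n = x_n]. *)
  erws_choice : forall (n k : nat) (x : nat -> R) (a b : R),
    (1 <= k <= n)%N -> (a, b) \in [:: (1, p); (-1, q); (0, r)] ->
    let past := [set w | forall j, (1 <= j <= n)%N -> erws_step j w = x j] in
    P (past `&` [set w | erws_memory n w = k] `&` [set w | erws_sign n w = a])
    = (P past * (n%:R^-1)%:E * b%:E)%E }.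

Section walk.
Context (d : measure_display) (T : measurableType d) (R : realType)
  (P : probability T R) (p q r s : R).
Variable W : erws P p q r s.

Definition position (n : nat) (w : T) : R :=
  \sum_(1 <= k < n.+1) erws_step W k w.

Definition num_ones (n : nat) (w : T) : R :=
  \sum_(1 <= k < n.+1) erws_step W k w ^+ 2.

End walk.

(* Main.v *)
Require Import Defs.
From HB Require Import structures.
From mathcomp Require Import all_boot all_order all_algebra.
From mathcomp Require Import all_classical all_reals all_analysis.
From mathcomp Require Import ring lra.

Set Implicit Arguments.
Unset Strict Implicit.
Unset Printing Implicit Defensive.

Import Order.TTheory GRing.Theory Num.Theory.
Import numFieldNormedType.Exports.

Local Open Scope classical_set_scope.
Local Open Scope ring_scope.

(** Stops are invisible to the direction of the walk.  Whenever the walk with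
    stops moves after $m \ge 1$ moves of signed sum $S$, the new sign is $e = \pm 1$
    with probability $(1 + e a S / m) / 2$, where $a = (p - q) / (p + q)$,
    whatever the time and the stops so far ([pr_leave]).  Hence the successive
    moves form an elephant random walk without stops of memory $a$
    ([embedded_has_kernel]), and the position at time $n$ is that walk read at
    the clock $\Sigma_n$, the number of moves made by time $n$.  The clock grows
    by at most one unit at a time and tends almost surely to infinity
    ([ae_moves_unbounded]), so upper limits along $n$ are upper limits along the
    number of moves ([is_limsup_time_change]).  Since the diffusive condition
    says $2 a < 1$ and $\sigma_r^2 = 1 / (1 - 2 a)$, the statement normalised by
    $\Sigma_n$ is the law of the iterated logarithm for the elephant random walk
    ([erw_lil]).  The statement normalised by $n^{1-r}$ follows because the
    ratio of the two normalisations converges to $\sqrt{\Sigma}$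
    ([clock_ratio_cvg]).

    For the elephant random walk itself, weights $b_n$ with
    $b_{n+1} (1 + a / (n + 1)) = b_n$ turn the walk into a martingale
    $L_n = \sum_{k<n} b_k (\epsilon_k - \mu_k)$, with $\mu_k$ the conditional
    mean of the sign $\epsilon_k$.  With $V_n = \sum_{k<n} b_k^2$ one has
    $n b_n^2 / V_n \to 1 - 2 a$ ([erw_scale_var_ratio]), and
    $\log\log V_n \sim \log\log n$ ([erw_lnln_ratio]), so it suffices that
    $\limsup L_n / \sqrt{2 V_n \log\log V_n} = 1$, and the same for $-L$.

    Upper half ([lil_upper]).  A sign of mean $\mu$ satisfies
    $E \exp(t (\epsilon - \mu)) \le \exp(t^2 / 2)$, so
    $\exp(\lambda L_n - \lambda^2 V_n / 2)$ is a supermartingale.  Its maximal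
    inequality over each block $c^k \le V_n < c^{k+1}$ and the Borel-Cantelli
    lemma give $\limsup \le 1$.  Applied to $L$ and $-L$ it shows in particular
    that the drift $\mu_n$ tends to $0$ ([erw_kernel_cvg0]).

    Lower half ([lil_lower]).  When the drifts and the weighted steps are small,
    the exponential moments of $L$ are also bounded below by nearly the same
    Gaussian expression; comparing the moments of orders $1$ and $1 \pm \gamma$
    then bounds from below the probability that $L$ gains nearly
    $\sqrt{2 V_n \log\log V_n}$ over the $k$-th block, by $1/k$, whatever the
    past ([mart_tail_ge]).  As $\prod_k (1 - 1/k) = 0$, infinitely many blocks
    succeed; the blocks grow so fast that what $L$ may have lost before a block,
    which the upper half for $-L$ controls, is negligible ([lil_block_arith]).
    *)

(** * Elementary inequalities *)

Section two_point.
Context {R : realType}.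
Implicit Types t m : R.

Lemma ge0_derive_ge (f df : R -> R) t :
  (forall x, is_derive x (1:R) f (df x)) ->
  (forall x, 0 <= x -> 0 <= df x) -> 0 <= t -> f 0 <= f t.
Proof.
move=> fd df0 t0.
have [|c cI fE] := @MVT_segment R f df 0 t t0 (fun x _ => fd x).
  by apply: derivable_within_continuous => x _; exact: ex_derive.
rewrite -subr_ge0 fE mulr_ge0 ?subr0//.
by apply: df0; rewrite (itvP cI).
Qed.

(** With [C] the left-hand side as a function of [t], [D / C] solves
    $u' = 1 - u^2 \le 1$ with $u(0) = m$, so $(\log C)' = D / C \le t + m$. *)
Lemma two_point_mgf_le_pos m t : -1 <= m <= 1 -> 0 <= t ->
  (1 + m) / 2 * expR t + (1 - m) / 2 * expR (- t) <= expR (t ^+ 2 / 2 + m * t).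
Proof.
move=> /andP[m1 m2] t0.
pose C x := (1 + m) / 2 * expR x + (1 - m) / 2 * expR (- x).
pose D x := (1 + m) / 2 * expR x - (1 - m) / 2 * expR (- x).
have C0 x : 0 < C x.
  have [m0|m0] := leP 0 m; rewrite /C.
    by apply: ltr_wpDr; [rewrite mulr_ge0 ?expR_ge0//; lra|
      rewrite mulr_gt0 ?expR_gt0//; lra].
  by apply: ltr_wpDl; [rewrite mulr_ge0 ?expR_ge0//; lra|
      rewrite mulr_gt0 ?expR_gt0//; lra].
have dC (x : R) : is_derive x (1:R) C (D x).
  by rewrite /C /D; apply: is_derive_eq; rewrite /GRing.scale/=; ring.
have dD (x : R) : is_derive x (1:R) D (C x).
  by rewrite /C /D; apply: is_derive_eq; rewrite /GRing.scale/=; ring.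
have drift (x : R) : 0 <= x -> 0 <= (x + m) * C x - D x.
  move=> x0.
  pose K y := y + m - D y / C y.
  (* The derivative of D / C is 1 - (D / C) ^ 2. *)
  pose dK y := (D y / C y) ^+ 2.
  have Kd (y : R) : is_derive y (1:R) K (dK y).
    have ? : C y != 0 by rewrite gt_eqF.
    have dV : is_derive y (1:R) (fun z => (C z)^-1) (- (C y) ^- 2 *: D y).
      exact: is_deriveV.
    rewrite /K /dK; apply: is_derive_eq; rewrite /GRing.scale/=.
    by field.
  have dK0 (y : R) : 0 <= y -> 0 <= dK y by move=> _; exact: sqr_ge0.
  have := ge0_derive_ge Kd dK0 x0.
  have -> : K 0 = 0.
    have C01 : C 0 = 1 by rewrite /C oppr0 expR0; field.
    have D0m : D 0 = m by rewrite /D oppr0 expR0; field.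
    by rewrite /K C01 D0m divr1 add0r subrr.
  rewrite /K subr_ge0 ler_pdivrMr // => ?; lra.
pose h x := - (C x * expR (- (x ^+ 2 / 2 + m * x))).
pose dh x := ((x + m) * C x - D x) * expR (- (x ^+ 2 / 2 + m * x)).
have hd (x : R) : is_derive x (1:R) h (dh x).
  rewrite /h /dh; apply: is_derive_eq; rewrite /GRing.scale/= !mulr0 !add0r.
  by field.
have dh0 (x : R) : 0 <= x -> 0 <= dh x.
  by move=> x0; rewrite mulr_ge0 ?expR_ge0// drift.
have := ge0_derive_ge hd dh0 t0.
have -> : h 0 = -1.
  rewrite /h expr0n/= mul0r mulr0 addr0 oppr0 expR0 /C oppr0 expR0; by field.
rewrite /h lerN2 expRN ler_pdivrMr ?expR_gt0// mul1r; exact.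
Qed.

(** Hoeffding's inequality; the constant 1/2 is attained at order [t ^ 2] when
    [m = 0], and so the limit law gets its exact constant.  Negative [t] reduces to
    positive [t] by exchanging the two signs. *)
Lemma two_point_mgf_le m t : -1 <= m <= 1 ->
  (1 + m) / 2 * expR (t * (1 - m)) + (1 - m) / 2 * expR (t * (-1 - m))
   <= expR (t ^+ 2 / 2).
Proof.
move=> m1.
have key : (1 + m) / 2 * expR t + (1 - m) / 2 * expR (- t)
    <= expR (t ^+ 2 / 2 + m * t).
  have [t0|t0] := leP 0 t; first exact: two_point_mgf_le_pos.
  have := @two_point_mgf_le_pos (- m) (- t).
  by rewrite !opprK sqrrN mulrNN => H; rewrite addrC; apply: H; lra.
rewrite -(ler_pM2r (expR_gt0 (m * t))) -expRD.
apply: le_trans key; rewrite le_eqVlt; apply/orP; left; apply/eqP.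
rewrite mulrDl -!mulrA -!expRD; congr (_ * (_ * expR _) + _ * (_ * expR _)); ring.
Qed.

Lemma expRN_ge_cubic t : 0 <= t -> 1 - t + t ^+ 2 / 2 - t ^+ 3 / 6 <= expR (- t).
Proof.
move=> t0.
have e2 (x : R) : 0 <= x -> expR (- x) <= 1 - x + x ^+ 2 / 2.
  move=> x0.
  pose h x : R := 1 - x + x ^+ 2 / 2 - expR (- x).
  pose dh x : R := -1 + x + expR (- x).
  have hd (y : R) : is_derive y (1:R) h (dh y).
    rewrite /h /dh; apply: is_derive_eq; rewrite /GRing.scale/= !mulr0 !add0r.
    by field.
  have dh0 (y : R) : 0 <= y -> 0 <= dh y.
    by move=> _; have := expR_ge1Dx (- y); rewrite /dh; lra.
  have := ge0_derive_ge hd dh0 x0.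
  by rewrite /h expr0n/= mul0r oppr0 expR0; lra.
pose h x : R := expR (- x) - (1 - x + x ^+ 2 / 2 - x ^+ 3 / 6).
pose dh x : R := 1 - x + x ^+ 2 / 2 - expR (- x).
have hd (y : R) : is_derive y (1:R) h (dh y).
  rewrite /h /dh; apply: is_derive_eq; rewrite /GRing.scale/= !mulr0 !add0r.
  by field.
have dh0 (y : R) : 0 <= y -> 0 <= dh y by move=> /e2; rewrite /dh; lra.
have := ge0_derive_ge hd dh0 t0.
by rewrite /h !expr0n/= !mul0r oppr0 expR0; lra.
Qed.

Lemma expR_ge_quadratic t : 1 + t + t ^+ 2 / 2 * (1 - `|t| / 3) <= expR t.
Proof.
have [t0|t0] := leP 0 t; last first.
  have nt0 : 0 <= - t by lra.
  have := expRN_ge_cubic nt0; rewrite !opprK ltr0_norm//; lra.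
pose h x : R := expR x - (1 + x + x ^+ 2 / 2).
pose dh x : R := expR x - (1 + x).
have hd (y : R) : is_derive y (1:R) h (dh y).
  rewrite /h /dh; apply: is_derive_eq; rewrite /GRing.scale/= !mulr0 !add0r.
  by field.
have dh0 (y : R) : 0 <= y -> 0 <= dh y by move=> _; rewrite subr_ge0 expR_ge1Dx.
have := ge0_derive_ge hd dh0 t0.
rewrite /h !expr0n/= !mul0r expR0 !addr0 subrr subr_ge0 ger0_norm//.
apply: le_trans; rewrite lerD2l; have := sqr_ge0 t; nra.
Qed.

Lemma expR_div1D_le (y : R) : 0 <= y -> expR (y / (1 + y)) <= 1 + y.
Proof.
move=> y0; have y1 : 0 < 1 + y by lra.
have := expR_ge1Dx (- (y / (1 + y))).
have -> : 1 - y / (1 + y) = (1 + y)^-1 by field; rewrite gt_eqF.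
by rewrite expRN lef_pV2// ?posrE ?expR_gt0.
Qed.

(** A sign of mean [m] has variance [1 - m ^ 2], and its centred values are
    bounded by 2: the exponentials are replaced by second order expansions, whose
    linear terms cancel, and the result is put back into exponential form.  The
    factor in the exponent tends to 1 when [eta] and [theta] tend to 0, matching
    [two_point_mgf_le]. *)
Lemma two_point_mgf_ge m t (eta theta : R) :
  0 <= eta <= 1 -> 0 <= theta <= 1 -> `|m| <= eta -> `|t| <= theta ->
  expR (t ^+ 2 / 2 * ((1 - eta ^+ 2) * (1 - theta) / (1 + theta ^+ 2))) <=
  (1 + m) / 2 * expR (t * (1 - m)) + (1 - m) / 2 * expR (t * (-1 - m)).
Proof.
move=> /andP[eta0 eta1] /andP[th0 th1] meta tth.
have m1 : -1 <= m <= 1 by rewrite -ler_norml (le_trans meta).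
have /andP[m1l m1r] := m1.
have m2 : m ^+ 2 <= eta ^+ 2.
  by rewrite -(real_normK (num_real m)) ler_sqr ?nnegrE.
have t2 : t ^+ 2 <= theta ^+ 2.
  by rewrite -(real_normK (num_real t)) ler_sqr ?nnegrE.
have eta2 : eta ^+ 2 <= 1 by rewrite expr_le1.
have t20 := sqr_ge0 t; have m20 := sqr_ge0 m.
pose y := t ^+ 2 / 2 * ((1 - m ^+ 2) * (1 - theta)).
have c0 : 0 <= (1 - m ^+ 2) * (1 - theta) by apply: mulr_ge0; lra.
have c1 : (1 - m ^+ 2) * (1 - theta) <= 1 by rewrite mulr_ile1//; lra.
have y0 : 0 <= y by apply: mulr_ge0 => //; lra.
have y1 : y <= theta ^+ 2.
  by rewrite (le_trans (ler_wpM2l _ c1))// ?divr_ge0// mulr1; lra.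
apply: (@le_trans _ _ (expR (y / (1 + y)))).
  rewrite ler_expR mulrA ler_pM//; first 3 last.
  - rewrite lef_pV2 ?posrE; lra.
  - by apply: mulr_ge0; [rewrite divr_ge0|apply: mulr_ge0; lra].
  - by rewrite invr_ge0; lra.
  - by rewrite ler_wpM2l ?divr_ge0// ler_wpM2r//; lra.
apply: (le_trans (expR_div1D_le y0)).
have step (u : R) : `|u| <= 2 ->
    1 + t * u + (t * u) ^+ 2 / 2 * (1 - theta) <= expR (t * u).
  move=> u2; apply: le_trans (expR_ge_quadratic (t * u)).
  rewrite lerD2l ler_wpM2l ?divr_ge0 ?sqr_ge0// lerD2l lerN2 normrM.
  have : `|t| * `|u| <= theta * 2 by rewrite ler_pM.
  lra.
have e1 : 1 + t * (1 - m) + (t * (1 - m)) ^+ 2 / 2 * (1 - theta) <= expR (t * (1 - m)).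
  by apply: step; rewrite ler_norml; lra.
have e2 : 1 + t * (-1 - m) + (t * (-1 - m)) ^+ 2 / 2 * (1 - theta) <= expR (t * (-1 - m)).
  by apply: step; rewrite ler_norml; lra.
apply: (@le_trans _ _ ((1 + m) / 2 * (1 + t * (1 - m) + (t * (1 - m)) ^+ 2 / 2 * (1 - theta))
  + (1 - m) / 2 * (1 + t * (-1 - m) + (t * (-1 - m)) ^+ 2 / 2 * (1 - theta)))).
  by rewrite le_eqVlt; apply/orP; left; apply/eqP; rewrite /y; field.
by apply: lerD; apply: ler_wpM2l => //; lra.
Qed.

Lemma expR1_le3 : expR 1 <= 3 :> R.
Proof.
have := @expRN_ge_cubic 1 ler01; rewrite expRN !expr1n => h.
have : 3^-1 <= (expR 1)^-1 :> R by lra.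
by rewrite lef_pV2 ?posrE ?expR_gt0.
Qed.

Lemma ln_ge1 (v : R) : expR 1 <= v -> 1 <= ln v.
Proof.
move=> ev; rewrite -(@expRK R 1) ler_ln// posrE ?expR_gt0//.
by rewrite (lt_le_trans _ ev)// expR_gt0.
Qed.

Lemma lnS_sub_bounds (n : nat) :
  (n.+2%:R^-1 : R) <= ln (n.+2%:R : R) - ln n.+1%:R <= n.+1%:R^-1.
Proof.
have n1 : 0 < n.+1%:R :> R by []; have n2 : 0 < n.+2%:R :> R by [].
have nS : n.+2%:R = n.+1%:R + 1 :> R by rewrite natr1.
apply/andP; split.
  have -> : ln n.+2%:R - ln n.+1%:R = - ln (1 - n.+2%:R^-1) :> R.
    have -> : 1 - n.+2%:R^-1 = n.+1%:R / n.+2%:R :> R.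
      apply: (mulIf (lt0r_neq0 n2)); rewrite mulrBl mul1r mulVf ?divfK ?gt_eqF//.
      by rewrite nS addrK.
    by rewrite ln_div ?posrE// opprB.
  rewrite lerNr; apply: le_ln1Dx; rewrite ltrN2 invf_lt1//.
  by rewrite ltr1n.
rewrite -ln_div ?posrE// (_ : _ / _ = 1 + n.+1%:R^-1); last first.
  by rewrite nS mulrDl divff ?gt_eqF// mul1r.
by apply: le_ln1Dx; rewrite (lt_trans (ltrN10 R))// invr_gt0.
Qed.
End two_point.

(** * Finite-horizon expectations along a tree of signs *)

Section tree.
Context {R : realType}.
Implicit Types (mu : seq bool -> R) (b : nat -> R) (f : seq bool -> R)
  (h s : seq bool) (A : pred (seq bool)).

Definition sgb (e : bool) : R := if e then 1 else -1.

(** Conditional expectations over [n] further signs, as a backward recursion, so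
    that conditioning on the past needs no measure theory.  The latest sign is the
    head of a history, and [mu h] is the conditional mean of the next sign given
    [h]. *)
Fixpoint treeE mu n f h : R :=
  if n is n'.+1 then
    (1 + mu h) / 2 * treeE mu n' f (true :: h) +
    (1 - mu h) / 2 * treeE mu n' f (false :: h)
  else f h.

Fixpoint mart b mu h : R :=
  if h is e :: h' then mart b mu h' + b (size h') * (sgb e - mu h') else 0.

(** An upper bound for the conditional variance
    $\sum_k b_k^2 (1 - \mu_k^2)$ of [mart], of the same order when the drift vanishes, and
    deterministic, so that it factors out of conditional expectations. *)
Definition var b n : R := \sum_(k < n) b k ^+ 2.

Fixpoint past_has A h : bool :=
  A h || (if h is e :: h' then past_has A h' else false).

(** Only the initial segments of length at least [j] are constrained: the
    properties of interest hold from some time on. *)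
Fixpoint past_all A j h : bool :=
  (size h < j)%N ||
  (A h && (if h is e :: h' then past_all A j h' else true)).

Definition is_kernel mu := forall h, -1 <= mu h <= 1.

Lemma le_treeE mu n f g h : is_kernel mu ->
  (forall s, size s = n -> f (s ++ h) <= g (s ++ h)) ->
  treeE mu n f h <= treeE mu n g h.
Proof.
move=> mu1; elim: n h => [|n IH] h fg /=; first exact: (fg [::]).
have := mu1 h => muh.
apply: lerD; apply: ler_wpM2l; try lra; apply: IH => s sn;
  rewrite -cat_rcons; apply: fg; by rewrite size_rcons sn.
Qed.

Lemma eq_treeE mu n f g h :
  (forall s, size s = n -> f (s ++ h) = g (s ++ h)) ->
  treeE mu n f h = treeE mu n g h.
Proof.
elim: n h => [|n IH] h fg /=; first exact: (fg [::]).
by congr (_ * _ + _ * _); apply: IH => s sn;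
  rewrite -cat_rcons; apply: fg; rewrite size_rcons sn.
Qed.

Lemma treeE_cst mu n c h : treeE mu n (fun=> c) h = c.
Proof. by elim: n h => //= n IH h; rewrite !IH; field. Qed.

Lemma treeED mu n f g h :
  treeE mu n (fun s => f s + g s) h = treeE mu n f h + treeE mu n g h.
Proof. by elim: n h => //= n IH h; rewrite !IH; ring. Qed.

Lemma treeEZ mu n c f h : treeE mu n (fun s => c * f s) h = c * treeE mu n f h.
Proof. by elim: n h => //= n IH h; rewrite !IH; ring. Qed.

Lemma treeE_comp mu m n f h :
  treeE mu (m + n) f h = treeE mu m (treeE mu n f) h.
Proof. by elim: m h => //= m IH h; rewrite !IH. Qed.

(** Doob's maximal inequality for nonnegative supermartingales: freezing [Z] at the
    value 1 from the first passage in [A] on keeps it a supermartingale, which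
    dominates the indicator of a passage. *)
Lemma maximal_treeE mu A (Z : seq bool -> R) : is_kernel mu ->
  (forall h, 0 <= Z h) -> (forall h, A h -> 1 <= Z h) ->
  (forall h, (1 + mu h) / 2 * Z (true :: h) + (1 - mu h) / 2 * Z (false :: h)
             <= Z h) ->
  forall n, treeE mu n (fun g => (past_has A g)%:R) [::] <= Z [::].
Proof.
move=> mu1 Z0 AZ Zsup n.
suff key h : treeE mu n (fun g => (past_has A g)%:R) h <=
    (if past_has A h then 1 else Z h).
  by have := key [::]; rewrite /= orbF; case: ifP => // /AZ /(le_trans _); apply.
elim: n h => [|n IH] h /=.
  by case: (past_has A h).
have muh := mu1 h.
case: ifPn => hA.
  rewrite (@le_trans _ _ ((1 + mu h) / 2 * 1 + (1 - mu h) / 2 * 1))//; last lra.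
  apply: lerD; apply: ler_wpM2l; try lra; apply: (le_trans (IH _)) => /=;
  by rewrite hA orbT.
apply: le_trans (Zsup h).
have child e : treeE mu n (fun g => (past_has A g)%:R) (e :: h) <= Z (e :: h).
  apply: (le_trans (IH _)) => /=; rewrite (negbTE hA) orbF.
  by case: ifP => // /AZ.
by apply: lerD; apply: ler_wpM2l; try lra; exact: child.
Qed.

Lemma past_all_cat A j s h : (j <= size h)%N ->
  past_all A j (s ++ h) -> past_all A j h.
Proof.
move=> jh; elim: s => //= e s IH.
rewrite ltnNge size_cat (leq_trans jh) ?(leq_trans (leq_addl _ _) (leqnSn _))//=.
by case/andP => _ /IH.
Qed.

(** On the paths that stay in [A] the two kernels make the same choices.  This is
    what allows a drift that is only eventually small to be replaced by one that is
    small along every path. *)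
Lemma treeE_kernel_congr mu mu' A f j n h : (j <= size h)%N ->
  (forall g, A g -> mu g = mu' g) ->
  treeE mu n (fun g => (past_all A j g)%:R * f g) h =
  treeE mu' n (fun g => (past_all A j g)%:R * f g) h.
Proof.
move=> + Amu; elim: n h => //= n IH h jh.
have jSh e : (j <= size (e :: h))%N by rewrite (leq_trans jh)/=.
have [Ah|nAh] := boolP (A h); first by rewrite Amu// !IH.
suff E nu e : treeE nu n (fun g => (past_all A j g)%:R * f g) (e :: h) = 0.
  by rewrite !E !mulr0.
rewrite (@eq_treeE _ _ _ (fun=> 0)) ?treeE_cst// => s sn.
case: (boolP (past_all _ _ _)); rewrite ?mul0r// -cat_rcons => /(past_all_cat jh).
by case: h jh {jSh nAh} (negbTE nAh) => [|? ?] jh /= ->; rewrite ltnNge jh.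
Qed.

(** The [i]-th block ends at length [nn i.+1], where its success [S i] is read;
    [drop] cuts a history back to the end of the previous block. *)
Fixpoint no_success (S : nat -> pred (seq bool)) (nn : nat -> nat) m h : bool :=
  if m is m'.+1 then
    ~~ S m' h && no_success S nn m' (drop (nn m - nn m') h) else true.

(** Each block succeeds with conditional probability at least [p i] whatever the
    past, so the probabilities of failure multiply even though the blocks are
    dependent. *)
Lemma treeE_no_success mu (S : nat -> pred (seq bool)) (nn : nat -> nat) (p : nat -> R) m h :
  is_kernel mu -> {homo nn : i j / (i <= j)%N} -> size h = nn 0 ->
  (forall i, (i < m)%N -> 0 <= p i) ->
  (forall i g, (i < m)%N -> size g = nn i ->
     p i <= treeE mu (nn i.+1 - nn i) (fun g => (S i g)%:R) g) ->
  treeE mu (nn m - nn 0) (fun g => (no_success S nn m g)%:R) h <=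
  \prod_(i < m) (1 - p i).
Proof.
move=> mu1 nnh hn; elim: m => [|m IH] p0 pS.
  by rewrite subnn big_ord0.
have -> : (nn m.+1 - nn 0 = (nn m - nn 0) + (nn m.+1 - nn m))%N.
  by rewrite addnC addnBA ?subnK ?nnh.
rewrite treeE_comp big_ord_recr/= mulrC.
have p1 i (g : seq bool) : (i < m.+1)%N -> size g = nn i -> p i <= 1.
  move=> im gi; apply: (le_trans (pS _ _ im gi)).
  rewrite -[leRHS](treeE_cst mu (nn i.+1 - nn i) 1 g).
  by apply: le_treeE => // s _; case: (S _ _).
apply: (@le_trans _ _ ((1 - p m) * treeE mu (nn m - nn 0)
    (fun g => (no_success S nn m g)%:R) h)); last first.
  apply: ler_wpM2l.
    rewrite subr_ge0; apply: (p1 m (nseq (nn m) true)) => //; by rewrite size_nseq.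
  by apply: IH => [i im|i g im]; [apply: p0|apply: pS]; rewrite ltnS ltnW.
rewrite -treeEZ; apply: le_treeE => // s sn.
set g := s ++ h.
have gn : size g = nn m by rewrite size_cat sn hn subnK// nnh.
rewrite (@eq_treeE _ _ _ (fun g' => (no_success S nn m g)%:R * (1 + -1 * (S m g')%:R))).
  rewrite treeEZ treeED treeE_cst treeEZ mulrC ler_wpM2r// mulN1r lerD2l lerN2.
  exact: pS.
move=> s' s'n /=; rewrite drop_size_cat//.
by case: (S m _); case: (no_success _ _ _ _) => /=; ring.
Qed.

Lemma varS b n : var b n.+1 = var b n + b n ^+ 2.
Proof. by rewrite /var big_ord_recr. Qed.

Lemma var_homo b : {homo var b : m n / (m <= n)%N >-> m <= n}.
Proof.
apply: homo_leq; [exact: lexx|by move=> x y z; exact: le_trans|].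
by move=> n; rewrite varS lerDl sqr_ge0.
Qed.

Lemma martN b mu h : mart (fun n => - b n) mu h = - mart b mu h.
Proof. by elim: h => /= [|e h ->]; [rewrite oppr0|ring]. Qed.

Lemma varN b n : var (fun n => - b n) n = var b n.
Proof. by apply: eq_bigr => i _; rewrite sqrrN. Qed.

Lemma mart_step_mgf b mu l h :
  (1 + mu h) / 2 * expR (l * mart b mu (true :: h)) +
  (1 - mu h) / 2 * expR (l * mart b mu (false :: h)) =
  expR (l * mart b mu h) *
  ((1 + mu h) / 2 * expR (l * b (size h) * (1 - mu h)) +
   (1 - mu h) / 2 * expR (l * b (size h) * (-1 - mu h))).
Proof. by rewrite /= !mulrDr !expRD !mulrA; ring. Qed.

Lemma mart_mgf_le b mu l n h : is_kernel mu ->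
  treeE mu n (fun s => expR (l * mart b mu s)) h <=
  expR (l * mart b mu h + l ^+ 2 / 2 * (var b (size h + n) - var b (size h))).
Proof.
move=> mu1; elim: n h => [|n IH] h; first by rewrite addn0 subrr mulr0 addr0.
have muh := mu1 h.
apply: (@le_trans _ _ (expR (l ^+ 2 / 2 * (var b (size h + n.+1) - var b (size h).+1)) *
  ((1 + mu h) / 2 * expR (l * mart b mu (true :: h)) +
  (1 - mu h) / 2 * expR (l * mart b mu (false :: h))))).
  have child e : treeE mu n (fun s => expR (l * mart b mu s)) (e :: h) <=
      expR (l ^+ 2 / 2 * (var b (size h + n.+1) - var b (size h).+1)) *
      expR (l * mart b mu (e :: h)).
    by apply: (le_trans (IH _)); rewrite -expRD ler_expR addrC addnS.
  rewrite [leRHS]mulrDr !(mulrCA (expR _) (_ / 2)).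
  by apply: lerD; apply: ler_wpM2l; [lra|exact: child|lra|exact: child].
rewrite mart_step_mgf.
have := @two_point_mgf_le R (mu h) (l * b (size h)) muh.
move=> /(ler_wpM2l (expR_ge0 (l * mart b mu h))).
move=> /(ler_wpM2l (expR_ge0 (l ^+ 2 / 2 * (var b (size h + n.+1) - var b (size h).+1)))).
move=> /le_trans; apply.
by rewrite -!expRD ler_expR le_eqVlt varS; apply/orP; left; apply/eqP; field.
Qed.

Lemma mart_mgf_ge b mu l n h (eta theta : R) :
  0 <= eta <= 1 -> 0 <= theta <= 1 -> (forall s, `|mu s| <= eta) ->
  (forall k, (size h <= k < size h + n)%N -> `|l * b k| <= theta) ->
  expR (l * mart b mu h +
    l ^+ 2 / 2 * ((1 - eta ^+ 2) * (1 - theta) / (1 + theta ^+ 2)) *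
    (var b (size h + n) - var b (size h))) <=
  treeE mu n (fun s => expR (l * mart b mu s)) h.
Proof.
set kappa := (1 - eta ^+ 2) * _ / _; move=> eta1 th1 mueta; elim: n h => [|n IH] h lb.
  by rewrite addn0 subrr mulr0 addr0.
have muh : -1 <= mu h <= 1 by rewrite -ler_norml (le_trans (mueta h))//; case/andP: eta1.
apply: (@le_trans _ _ (expR (l ^+ 2 / 2 * kappa * (var b (size h + n.+1) - var b (size h).+1)) *
  ((1 + mu h) / 2 * expR (l * mart b mu (true :: h)) +
  (1 - mu h) / 2 * expR (l * mart b mu (false :: h))))); last first.
  have child e : expR (l ^+ 2 / 2 * kappa * (var b (size h + n.+1) - var b (size h).+1)) *
      expR (l * mart b mu (e :: h)) <=
      treeE mu n (fun s => expR (l * mart b mu s)) (e :: h).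
    refine (le_trans _ (IH _ _)); first by rewrite -expRD ler_expR addrC addnS.
    by move=> k /andP[k1 k2]; apply: lb; rewrite addnS (ltnW k1) k2.
  rewrite [leLHS]mulrDr !(mulrCA (expR _) (_ / 2)).
  by apply: lerD; apply: ler_wpM2l; [lra|exact: child|lra|exact: child].
rewrite mart_step_mgf.
have lbh : `|l * b (size h)| <= theta by apply: lb; rewrite leqnn/= -addSnnS leq_addr.
have := two_point_mgf_ge eta1 th1 (mueta h) lbh.
move=> /(ler_wpM2l (expR_ge0 (l * mart b mu h))).
move=> /(ler_wpM2l (expR_ge0 (l ^+ 2 / 2 * kappa * (var b (size h + n.+1) - var b (size h).+1)))).
apply: le_trans.
rewrite -!expRD ler_expR le_eqVlt varS -/kappa.
by apply/orP; left; apply/eqP; ring.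
Qed.

(** A lower bound on a probability from upper and lower bounds on exponential
    moments only.  With [X] the weighted increment, $E e^X$ is nearly $e^{W/2}$.
    The values of [X] outside $[(1 - \gamma) W, (1 + \gamma) W]$ contribute less,
    by the upper bounds on the moments of order $1 \pm \gamma$, and the values
    inside contribute at most $e^{(1 + \gamma) W}$ times their probability. *)
Lemma mart_tail_ge b mu l n h (eta theta gam : R) :
  0 <= eta <= 1 -> 0 <= theta <= 1 -> 0 < gam < 1 ->
  (forall s, `|mu s| <= eta) ->
  (forall k, (size h <= k < size h + n)%N -> `|l * b k| <= theta) ->
  1 - gam ^+ 2 / 2 <= (1 - eta ^+ 2) * (1 - theta) / (1 + theta ^+ 2) ->
  let W := l ^+ 2 * (var b (size h + n) - var b (size h)) in
  3 <= expR (gam ^+ 2 * W / 4) ->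
  expR (- ((1 + gam) ^+ 2 * W / 2)) <=
  treeE mu n (fun s => ((1 - gam) * W <= l * (mart b mu s - mart b mu h))%R%:R) h.
Proof.
move=> eta1 th1 /andP[gam0 gam1] mueta lb kap W W3.
have mu1 : is_kernel mu.
  by move=> s; rewrite -ler_norml (le_trans (mueta s))//; case/andP: eta1.
have W0 : 0 <= W by rewrite mulr_ge0 ?sqr_ge0// subr_ge0 var_homo// leq_addr.
set p := treeE _ _ _ _.
pose X s := l * (mart b mu s - mart b mu h).
have XE (u c : R) s : expR (u * X s + c) = expR (c - u * l * mart b mu h) * expR (u * l * mart b mu s).
  by rewrite -expRD /X; congr expR; ring.
have up (u c : R) : treeE mu n (fun s => expR (u * X s + c)) h <= expR (c + u ^+ 2 / 2 * W).
  rewrite (@eq_treeE _ _ _ (fun s => expR (c - u * l * mart b mu h) * expR (u * l * mart b mu s))); last first.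
    by move=> s _; exact: XE.
  rewrite treeEZ; apply: le_trans (ler_wpM2l (expR_ge0 _) (mart_mgf_le b _ _ _ mu1)) _.
  rewrite -expRD ler_expR le_eqVlt /W.
  by apply/orP; left; apply/eqP; ring.
have low : expR ((1 - gam ^+ 2 / 2) / 2 * W) <= treeE mu n (fun s => expR (X s)) h.
  rewrite (@eq_treeE _ _ _ (fun s => expR (- (l * mart b mu h)) * expR (l * mart b mu s))); last first.
    by move=> s _; rewrite -expRD /X; congr expR; ring.
  rewrite treeEZ; refine (le_trans _ (ler_wpM2l (expR_ge0 _) (mart_mgf_ge eta1 th1 mueta lb))).
  rewrite -expRD addKr ler_expR.
  have -> : forall k V : R, l ^+ 2 / 2 * k * V = k / 2 * (l ^+ 2 * V) by move=> k V; ring.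
  by rewrite ler_wpM2r// ler_wpM2r// invr_ge0.
(* Each of the last two exponents equals X s at one end of the interval and exceeds
   it beyond that end. *)
have split s : expR (X s) <= expR ((1 + gam) * W) * ((1 - gam) * W <= X s)%R%:R +
   (expR ((1 + gam) * X s + - (gam * (1 + gam) * W)) +
    expR ((1 - gam) * X s + gam * (1 - gam) * W)).
  have [X1|X1] := leP ((1 - gam) * W) (X s); last first.
    rewrite mulr0 add0r ler_wpDl ?expR_ge0// ler_expR.
    have : gam * X s <= gam * ((1 - gam) * W) by rewrite ler_wpM2l// ltW.
    lra.
  rewrite mulr1; have [X2|X2] := leP (X s) ((1 + gam) * W).
    by rewrite ler_wpDr ?addr_ge0 ?expR_ge0// ler_expR.
  rewrite ler_wpDl ?expR_ge0// ler_wpDr ?expR_ge0// ler_expR.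
  have : gam * ((1 + gam) * W) <= gam * X s by rewrite ler_wpM2l// ltW.
  lra.
have tot : expR ((1 - gam ^+ 2 / 2) / 2 * W) <=
    expR ((1 + gam) * W) * p + (expR ((1 - gam ^+ 2) * W / 2) + expR ((1 - gam ^+ 2) * W / 2)).
  apply: (le_trans low).
  apply: (@le_trans _ _ (treeE mu n (fun s =>
      expR ((1 + gam) * W) * ((1 - gam) * W <= X s)%R%:R +
      (expR ((1 + gam) * X s + - (gam * (1 + gam) * W)) +
       expR ((1 - gam) * X s + gam * (1 - gam) * W))) h)).
    by apply: le_treeE => // s _; exact: split.
  rewrite treeED treeEZ treeED lerD2l; apply: lerD; apply: (le_trans (up _ _)); rewrite ler_expR; lra.
set E := expR ((1 - gam ^+ 2) * W / 2) in tot.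
have E0 : 0 < E := expR_gt0 _.
have E3 : expR ((1 - gam ^+ 2 / 2) / 2 * W) = expR (gam ^+ 2 * W / 4) * E.
  by rewrite /E -expRD; congr expR; field.
rewrite E3 in tot.
(* Of the total mass, at least 3 E by W3, the two tails take at most E each. *)
have : E <= expR ((1 + gam) * W) * p.
  have : 3 * E <= expR (gam ^+ 2 * W / 4) * E by rewrite ler_wpM2r// ltW.
  lra.
move=> /(ler_wpM2l (expR_ge0 (- ((1 + gam) * W)))).
rewrite (mulrA _ _ p) -expRD addNr expR0 mul1r; apply: le_trans.
by rewrite /E -expRD ler_expR; lra.
Qed.
End tree.

(** * Sign processes with a prescribed kernel *)

Section process.
Context (d : measure_display) (T : measurableType d) (R : realType)
  (P : probability T R).
Implicit Types (x : nat -> T -> bool) (mu : seq bool -> R) (A : pred (seq bool)).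

Fixpoint hist x n w : seq bool :=
  if n is n'.+1 then x n' w :: hist x n' w else [::].

(** The probability of the sign [false] is determined by complementation, see
    [prob_hist_cons]. *)
Definition has_kernel x mu :=
  (forall n, measurable [set w | x n w]) /\
  (forall h, P [set w | hist x (size h).+1 w = true :: h] =
    (P [set w | hist x (size h) w = h] * ((1 + mu h) / 2)%:E)%E).

Lemma size_hist x n w : size (hist x n w) = n.
Proof. by elim: n => //= n ->. Qed.

Lemma measurable_hist x A n : (forall n, measurable [set w | x n w]) ->
  measurable [set w | A (hist x n w)].
Proof.
move=> mx; elim: n A => [|n IH] A /=.
  have [->|->] : [set _ : T | A [::]] = setT \/ [set _ : T | A [::]] = set0.
  - by case: (A [::]); [left|right]; apply/seteqP; split.
  - exact: measurableT.
  - exact: measurable0.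
rewrite (_ : [set w | A (x n w :: hist x n w)] =
  ([set w | x n w] `&` [set w | A (true :: hist x n w)]) `|`
  (~` [set w | x n w] `&` [set w | A (false :: hist x n w)])).
  by apply: measurableU; apply: measurableI => //;
   [exact: (IH (fun h => A (true :: h)))| exact: measurableC |
    exact: (IH (fun h => A (false :: h)))].
apply/seteqP; split => w /=; first by case: (x n w); [left|right].
by case: (x n w) => -[] [].
Qed.

Lemma measurable_hist_eq x h n : (forall n, measurable [set w | x n w]) ->
  measurable [set w | hist x n w = h].
Proof.
move=> mx; rewrite (_ : [set _ | _] = [set w | hist x n w == h]).
  exact: (@measurable_hist x (pred1 h)).
by apply/seteqP; split => w /= /eqP.
Qed.

Lemma prob_hist_cons x mu h e : has_kernel x mu ->
  P [set w | hist x (size h).+1 w = e :: h] =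
    (P [set w | hist x (size h) w = h] * ((1 + sgb e * mu h) / 2)%:E)%E.
Proof.
move=> [mx kx].
case: e; rewrite /sgb ?mul1r ?kx// mulN1r.
have mh n (g : seq bool) := measurable_hist_eq g n mx.
have : P [set w | hist x (size h) w = h] =
  (P [set w | hist x (size h).+1 w = true :: h] +
   P [set w | hist x (size h).+1 w = false :: h])%E.
  rewrite -measureU//.
    congr (P _); apply/seteqP; split => w /=; first by move=> ->; case: (x _ w); [left|right].
    by case=> -[].
  by apply/seteqP; split => w //= -[] [-> _] [].
rewrite kx -(@fineK _ (P [set w | hist x (size h) w = h])) ?fin_num_measure//.
rewrite -(@fineK _ (P [set w | hist x (size h).+1 w = false :: h])) ?fin_num_measure//.
set a := fine _; set b := fine _.
by rewrite -EFinM -EFinD -EFinM => -[H]; congr (_%:E); move: H; lra.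
Qed.

Lemma prob_hist_treeE x mu A h n : has_kernel x mu ->
  P [set w | hist x (size h) w = h /\ A (hist x (size h + n) w)] =
  (P [set w | hist x (size h) w = h] * (treeE mu n (fun s => (A s)%:R) h)%:E)%E.
Proof.
move=> kx; have [mx _] := kx; elim: n h => [|n IH] h.
  rewrite addn0 /=; case Ah: (A h).
    by rewrite mule1; congr (P _); apply/seteqP; split => w /=; [case|move=> ->].
  rewrite mule0 -(measure0 P); congr (P _); apply/seteqP; split => w //= -[->].
  by rewrite Ah.
pose E e := [set w | hist x (size h).+1 w = e :: h /\ A (hist x ((size h).+1 + n) w)].
have -> : [set w | hist x (size h) w = h /\ A (hist x (size h + n.+1) w)] =
    E true `|` E false.
  rewrite /E addnS addSn.
  apply/seteqP; split => w /=.
    by move=> [-> ?]; case: (x _ w); [left|right].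
  by case=> -[[_ ->]].
have mE e : measurable (E e).
  by apply: measurableI; [exact: measurable_hist_eq|exact: measurable_hist].
have -> : P (E true `|` E false) = (P (E true) + P (E false))%E.
  by rewrite measureU//; apply/seteqP; split => w //; rewrite /E/= => -[] [[-> _] _] [[]].
have IHe e : P (E e) =
    (P [set w | hist x (size h).+1 w = e :: h] *
     (treeE mu n (fun s => (A s)%:R) (e :: h))%:E)%E := IH (e :: h).
rewrite !IHe !(prob_hist_cons _ _ kx) /sgb mul1r mulN1r.
rewrite -(@fineK _ (P [set w | hist x (size h) w = h])); last first.
  by rewrite fin_num_measure//; exact: measurable_hist_eq.
by rewrite -!EFinM -EFinD /=; congr (_%:E); ring.
Qed.

Lemma prob_treeE x mu A n : has_kernel x mu ->
  P [set w | A (hist x n w)] = (treeE mu n (fun s => (A s)%:R) [::])%:E.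
Proof.
move=> kx; have := prob_hist_treeE A [::] n kx.
rewrite (_ : [set w | _ = _] = setT); last by apply/seteqP; split.
rewrite probability_setT mul1e => <-.
by congr (P _); apply/seteqP; split => w //= -[].
Qed.

Lemma past_has_hist x A n w :
  past_has A (hist x n w) <-> exists2 m, (m <= n)%N & A (hist x m w).
Proof.
elim: n => [|n IH] /=.
  rewrite orbF; split => [?|[m]]; first by exists 0%N.
  by rewrite leqn0 => /eqP ->.
split => [/orP[?|/IH[m mn ?]]|[m]]; first by exists n.+1.
  by exists m => //; rewrite leqW.
rewrite leq_eqVlt => /orP[/eqP ->/= ->//|mn Am].
by apply/orP; right; apply/IH; exists m.
Qed.

Lemma prob_maximal x mu A (Z : seq bool -> R) : has_kernel x mu ->
  is_kernel mu ->
  (forall h, 0 <= Z h) -> (forall h, A h -> 1 <= Z h) ->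
  (forall h, (1 + mu h) / 2 * Z (true :: h) + (1 - mu h) / 2 * Z (false :: h)
             <= Z h) ->
  (P [set w | exists n, A (hist x n w)] <= (Z [::])%:E)%E.
Proof.
move=> kx mu1 Z0 AZ Zsup; have [mx _] := kx.
pose F n := [set w | past_has A (hist x n w)].
have mF n : measurable (F n) by exact: (measurable_hist (past_has A)).
have -> : [set w | exists n, A (hist x n w)] = \bigcup_n F n.
  apply/seteqP; split => w /=.
    by move=> [n An]; exists n => //; apply/past_has_hist; exists n.
  by move=> [n _ /past_has_hist[m _ ?]]; exists m.
have ndF : nondecreasing_seq F.
  move=> m n mn; apply/subsetPset => w /past_has_hist[k km ?].
  by apply/past_has_hist; exists k => //; rewrite (leq_trans km).
have := nondecreasing_cvg_mu (mu := P) mF (bigcupT_measurable _ mF) ndF.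
apply: cvge_le; near=> n; rewrite /= (prob_treeE _ _ kx) lee_fin.
exact: maximal_treeE.
Unshelve. all: by end_near. Qed.

End process.

(** * Upper half of the law of the iterated logarithm *)

Section upper.
Context (d : measure_display) (T : measurableType d) (R : realType)
  (P : probability T R).
Implicit Types (x : nat -> T -> bool) (mu : seq bool -> R) (b : nat -> R).

(** A bound by the increments of a nonnegative sequence makes the series of
    probabilities summable at once. *)
Lemma borel_cantelli_telescope (F : (set T)^nat) (a : nat -> R) :
  (forall k, measurable (F k)) -> (forall k, 0 <= a k) ->
  (forall k, (P (F k) <= (a k - a k.+1)%:E)%E) ->
  {ae P, forall w, \forall k \near \oo, ~ F k w}.
Proof.
move=> mF a0 Fa.
have F0 : P (lim_sup_set F) = 0%E.
  apply: lim_sup_set_cvg0 => //.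
  apply: (@le_lt_trans _ _ (a 0%N)%:E); last by rewrite ltry.
  apply: lime_le; first exact: is_cvg_nneseries.
  apply: nearW => n.
  apply: (@le_trans _ _ (\sum_(0 <= k < n) (a k - a k.+1)%:E)%E).
    by apply: lee_sum => k _; exact: Fa.
  rewrite sumEFin lee_fin.
  rewrite (_ : \sum_(0 <= k < n) _ = - \sum_(0 <= k < n) (a k.+1 - a k)).
    by rewrite telescope_sumr// opprB lerBlDr lerDl.
  by rewrite -sumrN; apply: eq_bigr => i _; rewrite opprB.
exists (lim_sup_set F); split => //.
  apply: bigcap_measurable => // k _.
  by apply: bigcup_measurable => j _; exact: mF.
move=> w /= nFw n _ /=; apply: contrapT => nex; apply: nFw.
exists n => // k /= nk Fk; apply: nex; by exists k.
Qed.

Definition lil_norm (v : R) : R := Num.sqrt (2 * v * ln (ln v)).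

Lemma lil_arg_homo (u v : R) : expR 1 <= u -> u <= v ->
  2 * u * ln (ln u) <= 2 * v * ln (ln v).
Proof.
move=> eu uv; have u0 : 0 < u by rewrite (lt_le_trans _ eu)// expR_gt0.
have v0 := lt_le_trans u0 uv; have lu := ln_ge1 eu.
have luv : ln u <= ln v by rewrite ler_ln.
apply: ler_pM; rewrite ?mulr_ge0 ?ln_ge0 ?(ltW u0)//.
  by rewrite ler_wpM2l.
by rewrite ler_ln// posrE (lt_le_trans ltr01)// (le_trans lu).
Qed.

Lemma lil_norm_homo (u v : R) : expR 1 <= u -> u <= v -> lil_norm u <= lil_norm v.
Proof. by move=> eu uv; rewrite ler_wsqrtr// lil_arg_homo. Qed.

(** By [two_point_mgf_le] the exponential of the expression compared with [y] is a
    nonnegative supermartingale, of initial value 1. *)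
Lemma mart_prob_exp_le x mu b (l y : R) : has_kernel P x mu -> is_kernel mu ->
  (P [set w | exists n,
    (y <= l * mart b mu (hist x n w) - l ^+ 2 / 2 * var b n)%R] <= (expR (- y))%:E)%E.
Proof.
move=> kx mu1.
pose Y (h : seq bool) := l * mart b mu h - l ^+ 2 / 2 * var b (size h).
have := @prob_maximal _ _ _ P x mu (fun h => y <= Y h) (fun h => expR (Y h - y)) kx mu1.
have -> : Y [::] - y = - y by rewrite /Y /= mulr0 /var big_ord0 mulr0 subr0 add0r.
have -> : [set w | exists n, y <= Y (hist x n w)] = [set w | exists n,
    y <= l * mart b mu (hist x n w) - l ^+ 2 / 2 * var b n].
  have YE n w : Y (hist x n w) = l * mart b mu (hist x n w) - l ^+ 2 / 2 * var b n.
    by rewrite /Y size_hist.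
  by apply/seteqP; split => w /= -[n]; rewrite ?YE => yn; exists n; rewrite ?YE.
apply => [h|h yY|h]; first exact: expR_ge0.
  by rewrite -expR0 ler_expR subr_ge0.
have YE e : expR (Y (e :: h) - y) = expR (l * mart b mu (e :: h)) *
    expR (- (l ^+ 2 / 2 * var b (size h).+1) - y).
  by rewrite -expRD /Y addrA.
rewrite !YE !mulrA -mulrDl mart_step_mgf.
apply: (@le_trans _ _ (expR (l * mart b mu h) * expR ((l * b (size h)) ^+ 2 / 2) *
   expR (- (l ^+ 2 / 2 * var b (size h).+1) - y))).
  apply: ler_wpM2r; first exact: expR_ge0.
  apply: ler_wpM2l; first exact: expR_ge0.
  exact: two_point_mgf_le.
rewrite -!expRD ler_expR varS /Y.
by rewrite le_eqVlt; apply/orP; left; apply/eqP; field.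
Qed.

(** Comparison of the term $(k+2)^{-(1+\delta)}$ with the integral of
    $x^{-(1+\delta)}$ over $[k+1, k+2]$. *)
Lemma powR_telescope (dl : R) (k : nat) : 0 < dl ->
  expR (- ((1 + dl) * ln k.+2%:R)) <=
  expR (- (dl * ln k.+1%:R)) / dl - expR (- (dl * ln k.+2%:R)) / dl.
Proof.
move=> dl0; have k1 : (0 : R) < k.+1%:R by rewrite ltr0n.
have k2 : (0 : R) < k.+2%:R by rewrite ltr0n.
have /andP[lnk _] := @lnS_sub_bounds R k.
rewrite -mulrBl ler_pdivlMr//.
have -> : expR (- ((1 + dl) * ln k.+2%:R)) = expR (- (dl * ln k.+2%:R)) * k.+2%:R^-1 :> R.
  by rewrite mulrDl opprD mul1r expRD mulrC (expRN (ln _)) lnK ?posrE.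
have -> : expR (- (dl * ln k.+1%:R)) =
    expR (- (dl * ln k.+2%:R)) * expR (dl * (ln k.+2%:R - ln k.+1%:R)) :> R.
  by rewrite -expRD; congr expR; ring.
rewrite -[X in _ - X]mulr1 -mulrBr -mulrA ler_wpM2l ?expR_ge0//.
rewrite lerBrDl mulrC; apply: le_trans (expR_ge1Dx _).
by rewrite lerD2l ler_wpM2l// ltW.
Qed.

(** With [c = 1 + dl], exceeding [c * lil_norm (var b n)] while
    $c^k \le V_n < c^{k+1}$ has probability at most $(k \log c)^{-(1 + \delta)}$,
    the general term of a convergent series. *)
Lemma lil_upper_fixed x mu b (dl : R) : has_kernel P x mu -> is_kernel mu ->
  var b n @[n --> \oo] --> +oo -> 0 < dl ->
  {ae P, forall w, \forall n \near \oo,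
    mart b mu (hist x n w) <= (1 + dl) * lil_norm (var b n)}.
Proof.
move=> kx mu1 /cvgryPge Voo dl0; have [mx _] := kx.
pose c : R := 1 + dl.
have c1 : 1 < c by rewrite /c ltrDl.
have c0 : 0 < c by rewrite (lt_trans ltr01).
have be0 : 0 < ln c by rewrite ln_gt0.
(* Blocks are numbered from k0 on: c ^ k0 >= e, and lil_norm increases beyond e. *)
pose k0 := (Num.truncn (ln c)^-1).+2.
have ck_e k : expR 1 <= c ^+ (k + k0).
  rewrite -(lnK (x := c ^+ _)) ?posrE ?exprn_gt0// ler_expR lnXn// -mulr_natl.
  rewrite -ler_pdivrMr// mul1r (@le_trans _ _ k0%:R)// ?ler_nat ?leq_addl//.
  have ilc : 0 <= (ln c)^-1 by rewrite invr_ge0 ltW.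
  have /andP[_ /ltW/le_trans] := truncn_itv ilc; apply.
  by rewrite ler_nat.
pose F k := [set w | exists n, [&& c ^+ (k + k0) <= var b n, var b n < c ^+ (k + k0).+1
  & (1 + dl) * lil_norm (var b n) < mart b mu (hist x n w)]].
have mF k : measurable (F k).
  rewrite (_ : F k = \bigcup_n [set w | (fun h =>
   [&& c ^+ (k + k0) <= var b n, var b n < c ^+ (k + k0).+1
  & (1 + dl) * lil_norm (var b n) < mart b mu h]) (hist x n w)]).
    apply: bigcup_measurable => n _.
    exact: (@measurable_hist _ _ x (fun h =>
   [&& c ^+ (k + k0) <= var b n, var b n < c ^+ (k + k0).+1
  & (1 + dl) * lil_norm (var b n) < mart b mu h])).
  by apply/seteqP; split => w /= [n]; [exists n|exists n].
have PF k : (P (F k) <= (expR (- (c * ln ((k + k0)%:R * ln c))))%:E)%E.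
  pose ck := c ^+ (k + k0).
  have ck0 : 0 < ck by rewrite exprn_gt0.
  (* The best exponent for the level c * lil_norm ck and the variance c * ck. *)
  pose l := c * lil_norm ck / (c * ck).
  apply: le_trans (@mart_prob_exp_le x mu b l _ kx mu1).
  rewrite le_measure ?inE//.
    rewrite (_ : [set w | _] = \bigcup_n [set w | (fun h =>
      c * ln ((k + k0)%:R * ln c) <= l * mart b mu h - l ^+ 2 / 2 * var b n) (hist x n w)]).
      apply: bigcup_measurable => n _.
      exact: (@measurable_hist _ _ x (fun h =>
      c * ln ((k + k0)%:R * ln c) <= l * mart b mu h - l ^+ 2 / 2 * var b n)).
    by apply/seteqP; split => w /= [n]; [exists n|exists n].
  move=> w [n /and3P[n1 n2 n3]]; exists n.
  have l0 : 0 <= l by rewrite divr_ge0 ?mulr_ge0 ?sqrtr_ge0 ?ltW.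
  have lm : l * (c * lil_norm ck) <= l * mart b mu (hist x n w).
    rewrite ler_wpM2l// (le_trans _ (ltW n3))// ler_wpM2l// ?(ltW c0)//.
    by rewrite lil_norm_homo// ck_e.
  have lv : l ^+ 2 / 2 * var b n <= l ^+ 2 / 2 * (c * ck).
    by rewrite ler_wpM2l ?divr_ge0 ?sqr_ge0// -exprS ltW.
  apply: le_trans (lerB lm lv).
  have sq : lil_norm ck ^+ 2 = 2 * ck * ln ((k + k0)%:R * ln c).
    rewrite sqr_sqrtr; last first.
      by rewrite !mulr_ge0 ?(ltW ck0)// ln_ge0// ln_ge1// ck_e.
    have -> : ln ck = (k + k0)%:R * ln c by rewrite /ck lnXn// mulr_natl.
    by [].
  rewrite le_eqVlt; apply/orP; left; apply/eqP.
  transitivity (c * (lil_norm ck ^+ 2) / (2 * ck)).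
    by rewrite sq; field; rewrite gt_eqF.
  by rewrite /l; field; rewrite !gt_eqF.
pose a k : R := expR (- (c * ln (ln c))) *
  (expR (- (dl * ln (k + k0.-2).+1%:R)) / dl).
have kE k : (k + k0 = (k + k0.-2).+2)%N by rewrite -addn2 -addnA addn2.
have key k : (P (F k) <= (a k - a k.+1)%:E)%E.
  apply: (le_trans (PF k)); rewrite lee_fin kE.
  have -> : c * ln ((k + k0.-2).+2%:R * ln c) =
     c * ln (ln c) + (1 + dl) * ln (k + k0.-2).+2%:R.
    rewrite lnM ?posrE ?ltr0n// /c; ring.
  rewrite opprD expRD /a -mulrBr ler_wpM2l ?expR_ge0//.
  exact: powR_telescope.
have a0 k : 0 <= a k by rewrite mulr_ge0 ?divr_ge0 ?expR_ge0// ltW.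
have := borel_cantelli_telescope mF a0 key.
apply: filterS => w [K _ FK].
near=> n.
have Vn : c ^+ (K + k0) <= var b n.
  by near: n; exact: Voo.
pose j := Num.truncn (ln (var b n) / ln c).
have V0 : 0 < var b n by rewrite (lt_le_trans _ Vn)// exprn_gt0.
have /andP[j1 j2] : c ^+ j <= var b n < c ^+ j.+1.
  have /andP[] : j%:R <= ln (var b n) / ln c < j.+1%:R.
    apply: truncn_itv; rewrite divr_ge0 ?(ltW be0)// ln_ge0//.
    by rewrite (le_trans _ Vn)// exprn_ege1// ltW.
  rewrite ler_pdivlMr// ltr_pdivrMr// !mulr_natl -!lnXn//.
  by rewrite ler_ln ?ltr_ln ?posrE ?exprn_gt0// => -> ->.
have Kj : (K + k0 <= j)%N.
  rewrite -ltnS -(ltr_eXn2l c1).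
  exact: le_lt_trans j2.
rewrite leNgt; apply/negP => nj.
apply: (FK (j - k0)%N) => /=.
  by rewrite leq_subRL ?(leq_trans _ Kj) ?leq_addl// addnC.
exists n; rewrite subnK ?(leq_trans _ Kj) ?leq_addl//.
by apply/and3P.
Unshelve. all: by end_near. Qed.

Lemma lil_upper x mu b : has_kernel P x mu -> is_kernel mu ->
  var b n @[n --> \oo] --> +oo ->
  {ae P, forall w, forall dl, 0 < dl -> \forall n \near \oo,
    mart b mu (hist x n w) <= (1 + dl) * lil_norm (var b n)}.
Proof.
move=> kx mu1 Voo.
have : \forall w \ae P, forall m, \forall n \near \oo,
    mart b mu (hist x n w) <= (1 + m.+1%:R^-1) * lil_norm (var b n).
  by apply: ae_foralln => m; apply: lil_upper_fixed.
apply: filterS => w H dl dl0.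
have [m mdl] : exists m : nat, m.+1%:R^-1 < dl.
  exists (Num.truncn dl^-1); rewrite invf_plt ?posrE//.
  have idl : 0 <= dl^-1 by rewrite invr_ge0 ltW.
  by have /andP[] := truncn_itv idl.
apply: filterS (H m) => n /le_trans; apply.
by rewrite ler_wpM2r ?sqrtr_ge0// lerD2l ltW.
Qed.
End upper.

(** * Blocks without success *)

Section conditional.
Context (d : measure_display) (T : measurableType d) (R : realType)
  (P : probability T R).
Implicit Types (x : nat -> T -> bool) (mu : seq bool -> R) (b : nat -> R)
  (A : pred (seq bool)).

Lemma drop_hist x n j w : (j <= n)%N -> drop (n - j) (hist x n w) = hist x j w.
Proof.
elim: n => [|n IH]; first by rewrite leqn0 => /eqP ->.
rewrite leq_eqVlt => /orP[/eqP ->|]; first by rewrite subnn drop0.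
by rewrite ltnS => jn; rewrite subSn//= IH.
Qed.

Lemma past_all_hist x A j n w : (forall i, (j <= i)%N -> A (hist x i w)) ->
  past_all A j (hist x n w).
Proof.
move=> Aw; elim: n => [|n IH] /=.
  by case: ltnP => //=; rewrite leqn0 => /eqP j0; rewrite (Aw 0%N) ?j0.
rewrite size_hist IH; case: ltnP => //= jn.
by rewrite (Aw n.+1).
Qed.

Lemma no_success_hist x (S : nat -> pred (seq bool)) nn m w :
  {homo nn : i j / (i <= j)%N} ->
  (forall i, ~~ S i (hist x (nn i.+1) w)) ->
  no_success S nn m (hist x (nn m) w).
Proof.
move=> nnh nS; elim: m => //= m IH.
by rewrite nS drop_hist// nnh.
Qed.

(** The success probabilities are only assumed for the kernel [mu']; restricting
    to the paths that stay in [A] from the first block on transfers them to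
    [mu]. *)
Lemma prob_no_success_le x mu mu' A (S : nat -> pred (seq bool)) (nn : nat -> nat) (p : nat -> R) m :
  has_kernel P x mu -> is_kernel mu -> is_kernel mu' ->
  (forall h, A h -> mu h = mu' h) ->
  {homo nn : i j / (i <= j)%N} ->
  (forall i, (i < m)%N -> 0 <= p i) ->
  (forall i (g : seq bool), (i < m)%N -> size g = nn i ->
     p i <= treeE mu' (nn i.+1 - nn i) (fun g => (S i g)%:R) g) ->
  (P [set w | past_all A (nn 0%N) (hist x (nn m) w) &&
      no_success S nn m (hist x (nn m) w)] <= (\prod_(i < m) (1 - p i))%:E)%E.
Proof.
move=> kx mu1 mu1' Amu nnh p0 pS.
rewrite (prob_treeE (fun h => past_all A (nn 0) h && no_success S nn m h) _ kx) lee_fin.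
have nn0m : (nn 0 <= nn m)%N by apply: nnh.
rewrite -(subnKC nn0m) treeE_comp.
rewrite -[leRHS](treeE_cst mu (nn 0) _ [::]); apply: le_treeE => // s sn.
rewrite cats0.
rewrite (@eq_treeE _ _ _ _ (fun s => (past_all A (nn 0) s)%:R * (no_success S nn m s)%:R)); last first.
  by move=> s' _; rewrite -natrM mulnb.
rewrite (@treeE_kernel_congr _ _ mu' A _ _ _ _ _ Amu) ?sn//.
apply: (@le_trans _ _ (treeE mu' (nn m - nn 0) (fun s => (no_success S nn m s)%:R) s)).
  by apply: le_treeE => // s' _; case: (past_all _ _ _); rewrite ?mul1r ?mul0r.
exact: treeE_no_success.
Qed.

Lemma mart_diff_congr x mu mu' b j n w : (j <= n)%N ->
  (forall i, (j <= i)%N -> mu (hist x i w) = mu' (hist x i w)) ->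
  mart b mu (hist x n w) - mart b mu (hist x j w) =
  mart b mu' (hist x n w) - mart b mu' (hist x j w).
Proof.
move=> + Amu; elim: n => [|n IH].
  by rewrite leqn0 => /eqP ->; rewrite !subrr.
rewrite leq_eqVlt => /orP[/eqP ->|]; first by rewrite !subrr.
rewrite ltnS => jn /=; rewrite Amu//; have := IH jn; lra.
Qed.

End conditional.

(** * Geometric blocks of variance *)

Section blocks.
Context {R : realType}.
Implicit Types (b : nat -> R) (c : R).

Lemma ln_near_ge (u : nat -> R) (A : R) : u n @[n --> \oo] --> +oo ->
  \forall n \near \oo, A <= ln (u n).
Proof.
move=> /cvgryPge /(_ (expR A)); apply: filterS => n Au.
by rewrite -(@expRK R A) ler_ln// posrE ?expR_gt0// (lt_le_trans _ Au)// expR_gt0.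
Qed.

Lemma natr_cvgy : (n%:R : R) @[n --> \oo] --> +oo.
Proof. exact: cvgr_idn. Qed.

Lemma block_times b c : 1 < c -> var b n @[n --> \oo] --> +oo ->
  exists tau : nat -> nat, (forall k, c ^+ k <= var b (tau k)) /\
   (forall k n, (n < tau k)%N -> var b n < c ^+ k).
Proof.
move=> c1 /cvgryPge Voo.
have ex k : exists n, c ^+ k <= var b n.
  by have [N _ HN] := Voo (c ^+ k); exists N; exact: HN (leqnn N).
exists (fun k => ex_minn (ex k)); split => k; first by case: ex_minnP.
move=> n; case: ex_minnP => m _ mmin nm; rewrite ltNge; apply/negP => /mmin.
by rewrite leqNgt nm.
Qed.

(** $\log\log c^k = \log k + \log\log c$, and constants are absorbed by
    $\gamma \log k$. *)
Lemma lil_block_index_le c (gam : R) : 1 < c -> 0 < gam ->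
  \forall k \near \oo, ln (ln (2 * c ^+ k.+1)) <= (1 + gam) * ln k%:R.
Proof.
move=> c1 gam0; have c0 : 0 < c by rewrite (lt_trans ltr01).
have lc : 0 < ln c by rewrite ln_gt0.
pose M := ln 2 + 2 * ln c.
have l2 : 0 < ln 2 :> R by rewrite ln_gt0// ltr1n.
have M0 : 0 < M by rewrite addr_gt0// mulr_gt0.
near=> k.
have k1 : (1 <= k)%N by near: k; exact: nbhs_infty_ge.
have k0 : 0 < k%:R :> R by rewrite ltr0n.
have k1R : 1 <= k%:R :> R by rewrite ler1n.
have lnMg : ln M / gam <= ln k%:R by near: k; apply: ln_near_ge; exact: natr_cvgy.
rewrite lnM ?posrE// ?exprn_gt0// lnXn//.
apply: (@le_trans _ _ (ln (k%:R * M))).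
  rewrite ler_ln ?posrE ?mulr_gt0//.
    rewrite /M mulrDr -[ln c *+ _]mulr_natl -[k.+1%:R]natr1.
    have := ler_peMl (ltW l2) k1R.
    have := ler_peMl (ltW lc) k1R.
    lra.
  by rewrite addr_gt0// pmulrn_lgt0.
rewrite lnM ?posrE// mulrDl mul1r lerD2l.
by move: lnMg; rewrite ler_pdivrMr// mulrC.
Unshelve. all: by end_near. Qed.

(** Kolmogorov's condition $b_n = o(\sqrt{V_{n+1} / \log\log V_{n+1}})$: no single step is
    visible at the scale of the iterated logarithm. *)
Definition kolmogorov_cond b := forall e : R, 0 < e ->
  \forall n \near \oo, b n ^+ 2 * ln (ln (var b n.+1)) <= e * var b n.+1.

(** The [k]-th block starts at the first time [tau k] when the variance reaches
    [c ^ k]; [kolmogorov_cond] bounds the overshoot, and makes each single step small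
    relative to the block.  The ratio [c] is large enough for the previous blocks to
    be negligible, and [W k] is the size for which the bound
    $\exp(- (1 + \gamma)^2 W_k / 2)$ of [mart_tail_ge] is exactly [1 / k]. *)
Lemma lil_blocks b (gam : R) : 0 < gam < 1 ->
  var b n @[n --> \oo] --> +oo -> kolmogorov_cond b ->
  let c := 8 / gam ^+ 2 in
  let W k := 2 * ln k%:R / (1 + gam) ^+ 2 in
  exists tau : nat -> nat,
    [/\ {homo tau : i j / (i <= j)%N},
        (forall N, \forall k \near \oo, (N <= tau k)%N) &
        \forall k \near \oo,
          [/\ c ^+ k <= var b (tau k) <= 2 * c ^+ k,
              ln (ln (2 * c ^+ k.+1)) <= (1 + gam) * ln k%:R,
              3 <= expR (gam ^+ 2 * W k / 4) &
              forall n, (tau k <= n < tau k.+1)%N ->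
                W k * b n ^+ 2 <=
                (gam ^+ 2 / 8) ^+ 2 * (var b (tau k.+1) - var b (tau k))]].
Proof.
move=> /andP[g0 g1] Voo Kol c W.
have g20 : 0 < gam ^+ 2 by rewrite exprn_gt0.
have g21 : gam ^+ 2 < 1 by rewrite exprn_ilt1// ltW.
have c8 : 8 < c by rewrite /c ltr_pdivlMr//; lra.
have c1 : 1 < c by lra.
have c0 : 0 < c by lra.
have lc1 : 1 <= ln c.
  by apply: ln_ge1; rewrite (le_trans _ (ltW c8))// (le_trans expR1_le3)//; lra.
have [tau [tau1 tau2]] := block_times c1 Voo.
have tauh : {homo tau : i j / (i <= j)%N}.
  move=> i j ij; rewrite leqNgt; apply/negP => /tau2.
  by rewrite ltNge (le_trans _ (tau1 j))// ler_eXn2l.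
(* Bernoulli's inequality: c ^ k >= 1 + k as ln c >= 1. *)
have tauoo N : \forall k \near \oo, (N <= tau k)%N.
  move/cvgryPge : natr_cvgy => /(_ (var b N)); apply: filterS => k Nk.
  rewrite leqNgt; apply/negP => kN.
  have ck : 1 + k%:R * ln c <= c ^+ k.
    by rewrite mulr_natl -lnXn// -[leRHS]lnK ?posrE ?exprn_gt0// expR_ge1Dx.
  have : k%:R <= k%:R * ln c by rewrite ler_peMr.
  have := le_trans (tau1 k) (var_homo b (ltnW kN)); lra.
have Kol' e : 0 < e -> \forall k \near \oo, forall n, ((tau k).-1 <= n)%N ->
    b n ^+ 2 * ln (ln (var b n.+1)) <= e * var b n.+1.
  move=> e0; have [N _ HN] := Kol e e0.
  apply: filterS (tauoo N.+1) => k kN n kn; apply: HN => /=.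
  by rewrite (leq_trans _ kn)// -ltnS (leq_trans kN)// leqSpred.
have lnlnck k : (1 <= k)%N -> ln k%:R <= ln (ln (c ^+ k)).
  move=> k1; have k0 : 0 < k%:R :> R by rewrite ltr0n.
  rewrite lnXn// ler_ln ?posrE ?pmulrn_lgt0//; last by lra.
  by rewrite -[X in X <= _]mul1r mulr_natr lerMn2r lc1 orbT.
have lnlnV k v : (1 <= k)%N -> c ^+ k <= v -> ln k%:R <= ln (ln v).
  move=> k1 ckv; apply: (le_trans (lnlnck _ k1)).
  have ck0 : 0 < ln (c ^+ k) by rewrite lnXn// pmulrn_lgt0//; lra.
  have lV : ln (c ^+ k) <= ln v.
    by rewrite ler_ln ?posrE ?exprn_gt0 ?(lt_le_trans _ ckv) ?exprn_gt0.
  by rewrite ler_ln ?posrE// (lt_le_trans ck0).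
have lnoo A : \forall k \near \oo, A <= ln k%:R :> R.
  by apply: ln_near_ge; exact: natr_cvgy.
have bound : \forall k \near \oo, c ^+ k <= var b (tau k) <= 2 * c ^+ k.
  near=> k; rewrite tau1/=.
  have k1 : (1 <= k)%N by near: k; exact: nbhs_infty_ge.
  have t1 : (1 <= tau k)%N by near: k; exact: tauoo.
  have lk : 2 <= ln k%:R :> R by near: k; exact: lnoo.
  have Kk : forall n, ((tau k).-1 <= n)%N ->
      b n ^+ 2 * ln (ln (var b n.+1)) <= 1 * var b n.+1.
    by near: k; exact: Kol'.
  have := Kk _ (leqnn _); rewrite prednK// mul1r => {}Kk.
  have Vk : var b (tau k) = var b (tau k).-1 + b (tau k).-1 ^+ 2.
    by rewrite -varS prednK.
  have Vk' : var b (tau k).-1 < c ^+ k by apply: tau2; rewrite prednK.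
  have lnV : ln k%:R <= ln (ln (var b (tau k))).
    exact: lnlnV (tau1 k).
  have : b (tau k).-1 ^+ 2 * 2 <= var b (tau k).
    apply: le_trans Kk.
    by rewrite ler_wpM2l ?sqr_ge0// (le_trans lk).
  lra.
have [K _ HK] := bound.
pose e0 := (gam ^+ 2 / 8) ^+ 2 / 8.
have e00 : 0 < e0 by rewrite divr_gt0// exprn_gt0// divr_gt0.
exists tau; split => //; near=> k.
have k1 : (1 <= k)%N by near: k; exact: nbhs_infty_ge.
have k0 : 0 < k%:R :> R by rewrite ltr0n.
split.
- by near: k.
- by near: k; exact: lil_block_index_le.
- have lk : 2 * (1 + gam) ^+ 2 * ln 3 / gam ^+ 2 <= ln k%:R by near: k; exact: lnoo.
  rewrite -[leLHS]lnK ?posrE// ler_expR /W.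
  move: lk; rewrite ler_pdivrMr// => lk.
  rewrite -(ler_pM2r (x := 2 * (1 + gam) ^+ 2)) ?mulr_gt0 ?exprn_gt0 ?addr_gt0//.
  have -> : gam ^+ 2 * (2 * ln k%:R / (1 + gam) ^+ 2) / 4 * (2 * (1 + gam) ^+ 2) = ln k%:R * gam ^+ 2.
    by field; apply/eqP; lra.
  lra.
- move=> n /andP[n1 n2].
  have lk : 1 <= ln k%:R :> R by near: k; exact: lnoo.
  have /andP[V1 V2] : c ^+ k <= var b (tau k) <= 2 * c ^+ k by near: k.
  have V3 : var b (tau k.+1) <= 2 * c ^+ k.+1.
    have Kk : (K <= k)%N by near: k; exact: nbhs_infty_ge.
    by have /andP[] := HK k.+1 (leqW Kk).
  have V4 := tau1 k.+1.
  have Kk : forall n, ((tau k).-1 <= n)%N ->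
      b n ^+ 2 * ln (ln (var b n.+1)) <= e0 * var b n.+1.
    by near: k; exact: Kol'.
  have {}Kk := Kk n (leq_trans (leq_pred _) n1).
  have Vn1 : c ^+ k <= var b n.+1.
    by rewrite (le_trans V1)// var_homo// leqW.
  have Vn2 : var b n.+1 <= var b (tau k.+1) by rewrite var_homo.
  have lnV : ln k%:R <= ln (ln (var b n.+1)) by apply: lnlnV Vn1.
  have h1 : b n ^+ 2 * ln k%:R <= e0 * (2 * c ^+ k.+1).
    apply: (@le_trans _ _ (b n ^+ 2 * ln (ln (var b n.+1)))).
      by rewrite ler_wpM2l ?sqr_ge0.
    apply: (le_trans Kk); rewrite ler_wpM2l ?(ltW e00)//.
    exact: le_trans Vn2 V3.
  have h2 : W k <= 2 * ln k%:R.
    rewrite /W ler_pdivrMr ?exprn_gt0 ?addr_gt0//.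
    by rewrite ler_peMr ?mulr_ge0 ?ln_ge0 ?ler1n// exprn_ege1//; lra.
  apply: (@le_trans _ _ (2 * ln k%:R * b n ^+ 2)).
    by rewrite ler_wpM2r ?sqr_ge0.
  apply: (@le_trans _ _ ((gam ^+ 2 / 8) ^+ 2 * (c / 2 * c ^+ k))).
    have -> : (gam ^+ 2 / 8) ^+ 2 * (c / 2 * c ^+ k) = 2 * (e0 * (2 * c ^+ k.+1)).
      by rewrite /e0 (exprS c); move: ((gam ^+ 2 / 8) ^+ 2) (c ^+ k) => u v; field.
    by rewrite -mulrA ler_pM2l// mulrC.
  rewrite ler_wpM2l ?sqr_ge0//.
  have ck0 : 0 < c ^+ k by rewrite exprn_gt0.
  have : 4 * c ^+ k <= c * c ^+ k by rewrite ler_wpM2r ?(ltW ck0)//; lra.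
  by move: V4; rewrite exprS; lra.
Unshelve. all: by end_near. Qed.
End blocks.

(** * Lower half of the law of the iterated logarithm *)

Section lower_tools.
Context (d : measure_display) (T : measurableType d) (R : realType)
  (P : probability T R).
Implicit Types (x : nat -> T -> bool) (mu : seq bool -> R) (b : nat -> R)
  (A : pred (seq bool)).

Lemma prod_harmonic K m :
  \prod_(i < m) (1 - (K.+2 + i)%:R^-1) = K.+1%:R / (K.+1 + m)%:R :> R.
Proof.
elim: m => [|m IH]; first by rewrite big_ord0 addn0 divff// pnatr_eq0.
rewrite big_ord_recr IH /= addnS addSn.
have : (K.+1 + m)%:R != 0 :> R by rewrite pnatr_eq0 addSn.
have : (K.+1 + m).+1%:R != 0 :> R by rewrite pnatr_eq0.
rewrite -[(K.+1 + m).+1%:R]natr1; move: ((K.+1 + m)%:R : R) (K.+1%:R : R) => u v u1 u0.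
by field; rewrite u0 u1.
Qed.

Lemma negligible_small (B : set T) (C : (set T)^nat) (a : nat -> R) :
  (forall m, measurable (C m)) -> (forall m, B `<=` C m) ->
  (forall m, (P (C m) <= (a m)%:E)%E) ->
  (forall e : R, 0 < e -> exists m, a m <= e) ->
  P.-negligible B.
Proof.
move=> mC BC Ca a0.
have mI : measurable (\bigcap_m C m) by apply: bigcap_measurable => // k _.
exists (\bigcap_m C m); split => //; last by move=> w Bw m _; exact: BC.
apply/eqP; rewrite eq_le measure_ge0 andbT.
apply/lee_addgt0Pr => e /a0[m am]; rewrite add0e.
apply: (@le_trans _ _ (P (C m))).
  by apply: le_measure; rewrite ?inE//; exact: bigcap_inf.
by apply: (le_trans (Ca m)); rewrite lee_fin.
Qed.

(** Here [V0] and [V1] are the variances at the two ends of a block and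
    [(1 - gam) * (l * (V1 - V0))] is the gain on a successful block.  As
    $V_0 \le \gamma^2 V_1 / 4$, the possible debt [2 * lil_norm V0] at the start of
    the block is at most [gam * lil_norm V1]. *)
Lemma lil_block_arith (gam c ck lk V0 V1 l : R) :
  0 < gam < 1 -> c = 8 / gam ^+ 2 -> expR 1 <= ck ->
  ck <= V0 <= 2 * ck -> c * ck <= V1 <= 2 * (c * ck) ->
  ln (ln (2 * (c * ck))) <= (1 + gam) * lk -> 0 < lk -> 0 <= l ->
  l ^+ 2 * (V1 - V0) = 2 * lk / (1 + gam) ^+ 2 ->
  (1 - 4 * gam) * lil_norm V1 <= (1 - gam) * (l * (V1 - V0)) - 2 * lil_norm V0.
Proof.
move=> /andP[g0 g1] cE eck /andP[V0l V0u] /andP[V1l V1u] llck lk0 l0 lE.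
have g2 : 0 < gam ^+ 2 by rewrite exprn_gt0.
have g21 : gam ^+ 2 < gam by rewrite expr2 -[ltRHS]mulr1 ltr_pM2l.
have ck0 : 0 < ck by rewrite (lt_le_trans _ eck)// expR_gt0.
have V00 : 0 < V0 by rewrite (lt_le_trans ck0).
have eV0 : expR 1 <= V0 by rewrite (le_trans eck).
have V0V1 : V0 <= gam ^+ 2 / 4 * V1.
  apply: (le_trans V0u).
  have -> : 2 * ck = gam ^+ 2 / 4 * (c * ck) by rewrite cE; field; rewrite gt_eqF.
  by rewrite ler_wpM2l// divr_ge0// ltW.
have V10 : 0 < V1.
  by move: V0V1; rewrite leNgt; apply: contraNT; rewrite -leNgt => V10;
    rewrite (le_lt_trans _ V00)// mulr_ge0_le0// divr_ge0// ltW.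
have V0V1' : V0 <= V1.
  by apply: (le_trans V0V1); rewrite ler_piMl ?(ltW V10)//; lra.
have eV1 := le_trans eV0 V0V1'.
have ll0 := ln_ge1 eV0; have ll1 := ln_ge1 eV1.
have lV : ln (ln V1) <= (1 + gam) * lk.
  apply: le_trans llck.
  have lV1 : ln V1 <= ln (2 * (c * ck)).
    by rewrite ler_ln ?posrE// (lt_le_trans V10).
  by rewrite ler_ln ?posrE//; apply: lt_le_trans ltr01 _ => //; apply: (le_trans ll1).
have lnV1 : 0 <= ln (ln V1) by rewrite ln_ge0.
have lnV0 : 0 <= ln (ln V0) by rewrite ln_ge0.
have n1 : 2 * lil_norm V0 <= gam * lil_norm V1.
  rewrite -ler_sqr ?nnegrE ?mulr_ge0 ?sqrtr_ge0 ?(ltW g0)//.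
  rewrite !exprMn !sqr_sqrtr ?mulr_ge0 ?(ltW V00) ?(ltW V10)//.
  have : V0 * ln (ln V0) <= gam ^+ 2 / 4 * V1 * ln (ln V1).
    apply: ler_pM => //; first exact: ltW.
    rewrite ler_ln ?posrE ?(lt_le_trans ltr01)//.
    by rewrite ler_ln ?posrE.
  lra.
have g10 : 0 <= 1 - gam by lra.
have n2 : (1 - gam) ^+ 2 * lil_norm V1 <= l * (V1 - V0).
  have V10' : 0 <= V1 - V0 by lra.
  rewrite -ler_sqr ?nnegrE ?mulr_ge0 ?sqrtr_ge0 ?exprn_ge0//.
  rewrite !exprMn sqr_sqrtr ?mulr_ge0 ?(ltW V10)//.
  have -> : l ^+ 2 * (V1 - V0) ^+ 2 = 2 * lk / (1 + gam) ^+ 2 * (V1 - V0).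
    by rewrite -lE -mulrA -expr2.
  apply: (@le_trans _ _ (((1 - gam) ^+ 2) ^+ 2 * (2 * V1 * ((1 + gam) * lk)))).
    rewrite ler_wpM2l ?sqr_ge0// ler_wpM2l// mulr_ge0// ltW//.
  apply: (@le_trans _ _ (2 * lk / (1 + gam) ^+ 2 * ((1 - gam) * V1))); last first.
    rewrite ler_wpM2l//; first by rewrite divr_ge0 ?sqr_ge0// mulr_ge0// ltW.
    have : gam ^+ 2 / 4 * V1 <= gam * V1 by rewrite ler_wpM2r ?(ltW V10)//; lra.
    lra.
  have -> : ((1 - gam) ^+ 2) ^+ 2 * (2 * V1 * ((1 + gam) * lk)) =
      2 * lk / (1 + gam) ^+ 2 * ((1 - gam) * V1) * (1 - gam ^+ 2) ^+ 3.
    by field; apply/eqP; lra.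
  rewrite ler_piMr//; last by rewrite exprn_ile1//; lra.
  by rewrite mulr_ge0 ?divr_ge0 ?sqr_ge0 ?mulr_ge0 ?(ltW V10) ?(ltW lk0).
have n0 : 0 <= lil_norm V1 by exact: sqrtr_ge0.
have n3 : (1 - gam) * ((1 - gam) ^+ 2 * lil_norm V1) <= (1 - gam) * (l * (V1 - V0)).
  by rewrite ler_wpM2l.
have n4 : (1 - 3 * gam) * lil_norm V1 <= (1 - gam) * ((1 - gam) ^+ 2 * lil_norm V1).
  rewrite mulrA ler_wpM2r//.
  have : 0 <= gam ^+ 2 * (3 - gam) by rewrite mulr_ge0 ?(ltW g2)//; lra.
  lra.
lra.
Qed.

End lower_tools.

Section lower.
Context (d : measure_display) (T : measurableType d) (R : realType)
  (P : probability T R).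
Implicit Types (x : nat -> T -> bool) (mu : seq bool -> R) (b : nat -> R)
  (A : pred (seq bool)).

(** The blocks of [lil_blocks] succeed with conditional probability at least [1 / k],
    so almost surely infinitely many of them do; [lil_upper] for the weights [- b]
    bounds below the value at the start of a successful block. *)
Lemma lil_lower_fixed x mu b (dl : R) : has_kernel P x mu -> is_kernel mu ->
  var b n @[n --> \oo] --> +oo -> kolmogorov_cond b ->
  {ae P, forall w, mu (hist x n w) @[n --> \oo] --> 0} -> 0 < dl ->
  {ae P, forall w, forall N, exists2 n, (N <= n)%N &
    (1 - dl) * lil_norm (var b n) <= mart b mu (hist x n w)}.
Proof.
move=> kx mu1 Voo Kol mu0 dl0; have [mx _] := kx.
pose gam := Num.min dl 1 / 8.
have min0 : 0 < Num.min dl 1 by rewrite lt_min dl0 ltr01.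
have gam01 : 0 < gam < 1.
  by rewrite divr_gt0//= ltr_pdivrMr// mul1r gt_min [1 < 8]ltr1n orbT.
have gamdl : 4 * gam <= dl.
  have : Num.min dl 1 <= dl by rewrite ge_min lexx.
  by rewrite /gam; lra.
have /andP[g0 g1] := gam01.
have [tau [tauh tauoo [K0 _ HK0]]] := lil_blocks gam01 Voo Kol.
set c := 8 / gam ^+ 2 in HK0.
pose W k : R := 2 * ln k%:R / (1 + gam) ^+ 2.
have c8 : 8 < c.
  by rewrite /c ltr_pdivlMr ?exprn_gt0// gtr_pMr// exprn_ilt1// ltW.
pose u := gam ^+ 2 / 8.
have g20 : 0 < gam ^+ 2 by rewrite exprn_gt0.
have g21 : gam ^+ 2 < 1 by rewrite exprn_ilt1// ltW.
have u01 : 0 <= u <= 1 by rewrite /u; lra.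
(* mu' truncates mu to make the block estimates uniform in the past; almost every
   path eventually sees no difference. *)
pose A h := `|mu h| <= u.
pose mu' h := if A h then mu h else 0.
have Amu h : A h -> mu h = mu' h by rewrite /mu' => ->.
have mu'u h : `|mu' h| <= u.
  by rewrite /mu'; case: ifP => //; rewrite normr0; case/andP: u01.
have mu1' : is_kernel mu'.
  by move=> h; rewrite -ler_norml (le_trans (mu'u h))//; case/andP: u01.
pose V' k := var b (tau k.+1) - var b (tau k).
pose l k := Num.sqrt (W k / V' k).
have W0 k : (2 <= k)%N -> 0 < W k.
  move=> k2; rewrite divr_gt0 ?exprn_gt0 ?addr_gt0// mulr_gt0// ln_gt0// ltr1n//.
have V'0 k : (K0 <= k)%N -> 0 < V' k.
  move=> kK; have [/andP[_ V1] _ _ _] := HK0 _ kK.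
  have [/andP[V2 _] _ _ _] := HK0 _ (leqW kK).
  rewrite subr_gt0 (le_lt_trans V1)// (lt_le_trans _ V2)// exprS ltr_pM2r; first by lra.
  by rewrite exprn_gt0//; lra.
have lW k : (K0 <= k)%N -> (2 <= k)%N -> l k ^+ 2 * V' k = W k.
  move=> kK k2; rewrite sqr_sqrtr ?divfK ?gt_eqF ?V'0//.
  by rewrite divr_ge0 ?(ltW (W0 _ k2)) ?(ltW (V'0 _ kK)).
pose S0 k : pred (seq bool) := fun g => (1 - gam) * W k <=
   l k * (mart b mu' g - mart b mu' (drop (tau k.+1 - tau k) g)).
pose nn K i := tau (K.+2 + i)%N.
pose S K i := S0 (K.+2 + i)%N.
have nnh K : {homo nn K : i j / (i <= j)%N}.
  by move=> i j ij; apply: tauh; rewrite leq_add2l.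
pose C K m := [set w | past_all A (nn K 0%N) (hist x (nn K m) w) &&
      no_success (S K) (nn K) m (hist x (nn K m) w)].
have PC K m : (K0 <= K)%N -> (P (C K m) <= (K.+1%:R / (K.+1 + m)%:R)%:E)%E.
  move=> KK; rewrite -prod_harmonic.
  apply: (@prob_no_success_le _ _ _ P x mu mu' A (S K) (nn K) (fun i => (K.+2 + i)%:R^-1) m kx mu1 mu1' Amu (nnh K)) => [i _|i g im gi].
    by rewrite invr_ge0.
  set k := (K.+2 + i)%N.
  have k2 : (2 <= k)%N by rewrite /k !addSn.
  have kK : (K0 <= k)%N by rewrite /k (leq_trans KK)// !addSn -!addnS leq_addr.
  have [_ _ H3 H4] := HK0 _ kK.
  have gE : (size g + (nn K i.+1 - nn K i) = tau k.+1)%N.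
    by rewrite gi subnKC ?nnh// /nn addnS.
  have := @mart_tail_ge R b mu' (l k) (nn K i.+1 - nn K i) g u u gam u01 u01 gam01 mu'u.
  rewrite gE gi -/k -/(nn K i) -/(V' k) lW// => tail.
  have -> : k%:R^-1 = expR (- ((1 + gam) ^+ 2 * W k / 2)) :> R.
    rewrite (_ : _ / 2 = ln k%:R); last first.
      by rewrite /W; field; apply/eqP; lra.
    by rewrite expRN lnK// posrE ltr0n (leq_trans _ k2).
  apply: (le_trans (tail _ _ _)).
  - move=> n nk; rewrite -ler_sqr ?nnegrE//; last by case/andP: u01.
    rewrite real_normK ?num_real// exprMn sqr_sqrtr; last first.
      by rewrite divr_ge0 ?(ltW (W0 _ k2)) ?(ltW (V'0 _ kK)).
    rewrite mulrAC ler_pdivrMr ?V'0//; exact: H4.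
  - have uE : gam ^+ 2 / 2 = 4 * u by rewrite /u; field.
    rewrite uE ler_pdivlMr ?ltr_wpDr ?sqr_ge0//.
    have u0 : 0 <= u by case/andP: u01.
    have : 0 <= u * (1 + 4 * u ^+ 2 - u) .
      rewrite mulr_ge0// -addrA; have := sqr_ge0 u; case/andP: u01; lra.
    have : 0 <= u ^+ 3 by rewrite exprn_ge0.
    rewrite /u; case/andP: u01; nra.
  - exact: H3.
  rewrite le_eqVlt; apply/orP; left; apply/eqP.
  apply: eq_treeE => s sn; congr ((_ : bool)%:R).
  by rewrite /S /S0 -/k -(addnS K.+2 i) -/k drop_size_cat.
pose B K := [set w | (forall n, (nn K 0 <= n)%N -> A (hist x n w)) /\
   forall i, ~~ S K i (hist x (nn K i.+1) w)].
have aeB : {ae P, forall w, forall K, (K0 <= K)%N -> ~ B K w}.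
  apply: ae_foralln => K; have [KK|KK] := leqP K0 K; last first.
    by apply: aeW => w.
  have negB : P.-negligible (B K).
    apply: (@negligible_small _ _ _ P (B K) (C K) (fun m => K.+1%:R / (K.+1 + m)%:R)).
    - move=> m; exact: (@measurable_hist _ _ x (fun h => past_all A (nn K 0%N) h &&
        no_success (S K) (nn K) m h)).
    - move=> m w [wA wS]; apply/andP; split; first exact: past_all_hist.
      exact: no_success_hist.
    - by move=> m; exact: PC.
    - move=> e e0; exists (Num.truncn (K.+1%:R / e)).+1.
      have Ke : 0 <= K.+1%:R / e by rewrite divr_ge0// ltW.
      have /andP[_ /ltW] := truncn_itv Ke.
      rewrite ler_pdivrMr// => h; rewrite ler_pdivrMr ?ltr0n ?addSn// mulrC.
      by apply: (le_trans h); rewrite ler_wpM2r ?(ltW e0)// ler_nat leqW// leq_addl.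
  by apply: negligibleS negB => w /= /not_implyP[_ /contrapT].
have up : {ae P, forall w, forall dl, 0 < dl -> \forall n \near \oo,
    - mart b mu (hist x n w) <= (1 + dl) * lil_norm (var b n)}.
  have := lil_upper (b := fun n => - b n) kx mu1.
  have vE n : var (fun n => - b n) n = var b n := varN b n.
  under eq_fun do rewrite vE.
  move=> /(_ Voo); apply: filterS => w H e /H; apply: filterS => n.
  by rewrite martN vE.
move: aeB up mu0; apply: filterS3 => w wB wup wmu N.
have [N1 _ HN1] : \forall n \near \oo, A (hist x n w).
  have u0 : 0 < u by rewrite divr_gt0.
  by move/cvgr0Pnorm_le : wmu => /(_ u u0).
have [N2 _ HN2] := wup 1 ltr01.
have [K1 _ HK1] := tauoo (maxn N (maxn N1 N2)).
pose K := maxn K0 K1.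
have kN k : (K.+2 <= k)%N -> (N <= tau k)%N /\ (N1 <= tau k)%N /\ (N2 <= tau k)%N.
  move=> Kk; have /HK1 /= : (K1 <= k)%N.
    by rewrite (leq_trans _ Kk)// (leq_trans (leq_maxr K0 K1))// leqW.
  by rewrite !geq_max => /and3P[].
have : exists i, S K i (hist x (nn K i.+1) w).
  apply: contrapT => nex; apply: (wB K (leq_maxl _ _)); split.
    move=> n nn0; apply: HN1 => /=; apply: leq_trans nn0.
    by have [_ []] := kN (K.+2 + 0)%N (leq_addr _ _).
  by move=> i; apply/negP => Si; apply: nex; exists i.
move=> [i]; rewrite /S /S0 /nn addnS; set k := (K.+2 + i)%N.
have Kk : (K.+2 <= k)%N by rewrite leq_addr.
have k2 : (2 <= k)%N by rewrite (leq_trans _ Kk).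
have kK0 : (K0 <= k)%N by rewrite (leq_trans _ Kk)// leqW// leqW// leq_maxl.
have [tN [tN1 tN2]] := kN k Kk.
have tk : (tau k <= tau k.+1)%N by rewrite tauh.
rewrite drop_hist// -(@mart_diff_congr _ _ _ x mu)//; last first.
  by move=> j kj; apply: Amu; apply: HN1; rewrite /= (leq_trans tN1).
set dL := mart b mu _ - _ => succ.
exists (tau k.+1); first by rewrite (leq_trans tN).
have [V1 H2 _ _] := HK0 _ kK0.
have [V2 _ _ _] := HK0 _ (leqW kK0).
have l0 : 0 < l k by rewrite sqrtr_gt0 divr_gt0 ?W0 ?V'0.
have dLge : (1 - gam) * (l k * V' k) <= dL.
  rewrite -(ler_pM2l l0); apply: le_trans succ.
  rewrite -lW// le_eqVlt; apply/orP; left; apply/eqP; ring.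
have mk := HN2 _ tN2.
have eck : expR 1 <= c ^+ k.
  rewrite (le_trans expR1_le3)// (@le_trans _ _ c)//; first by lra.
  have c1 : 1 <= c by lra.
  by rewrite -[leLHS]expr1 ler_weXn2l// ltnW.
have lk0 : 0 < ln k%:R :> R by rewrite ln_gt0// ltr1n.
rewrite exprS in V2; rewrite exprS in H2.
have := lil_block_arith gam01 (erefl c) eck V1 V2 H2 lk0 (ltW l0) (lW _ kK0 k2).
have n0 : 0 <= lil_norm (var b (tau k.+1)) by exact: sqrtr_ge0.
have : (1 - dl) * lil_norm (var b (tau k.+1)) <= (1 - 4 * gam) * lil_norm (var b (tau k.+1)).
  by rewrite ler_wpM2r//; lra.
by move: mk dLge; rewrite /dL /V' /=; lra.
Qed.

Lemma lil_lower x mu b : has_kernel P x mu -> is_kernel mu ->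
  var b n @[n --> \oo] --> +oo -> kolmogorov_cond b ->
  {ae P, forall w, mu (hist x n w) @[n --> \oo] --> 0} ->
  {ae P, forall w, forall dl, 0 < dl -> forall N, exists2 n, (N <= n)%N &
    (1 - dl) * lil_norm (var b n) <= mart b mu (hist x n w)}.
Proof.
move=> kx mu1 Voo Kol mu0.
have : \forall w \ae P, forall m, forall N, exists2 n, (N <= n)%N &
    (1 - m.+1%:R^-1) * lil_norm (var b n) <= mart b mu (hist x n w).
  by apply: ae_foralln => m; apply: lil_lower_fixed.
apply: filterS => w H dl dl0 N.
have [m mdl] : exists m : nat, m.+1%:R^-1 < dl.
  exists (Num.truncn dl^-1); rewrite invf_plt ?posrE//.
  have idl : 0 <= dl^-1 by rewrite invr_ge0 ltW.
  by have /andP[] := truncn_itv idl.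
have [n Nn nL] := H m N; exists n => //; apply: le_trans nL.
by rewrite ler_wpM2r ?sqrtr_ge0// lerD2l lerN2 ltW.
Qed.

End lower.

(** * Upper limits of real sequences *)

Section limsup.
Context {R : realType}.
Implicit Types (u v rho : nat -> R) (l r : R).

Definition is_limsup u l :=
  (forall e : R, 0 < e -> \forall n \near \oo, u n <= l + e) /\
  (forall e : R, 0 < e -> forall N, exists2 n, (N <= n)%N & l - e <= u n).

Lemma is_limsup_near u v l : (\forall n \near \oo, u n = v n) ->
  is_limsup u l -> is_limsup v l.
Proof.
move=> uv [up lo]; split => e e0.
  by move: uv (up e e0); apply: filterS2 => n <-.
move=> N; have [M _ HM] := uv; have [n Nn nu] := lo e e0 (maxn M N).
move: Nn; rewrite geq_max => /andP[Mn Nn]; exists n => //.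
by rewrite -HM.
Qed.

Lemma is_limsupM u rho l r : is_limsup u l -> rho n @[n --> \oo] --> r ->
  (forall n, 0 <= rho n) -> is_limsup (fun n => u n * rho n) (l * r).
Proof.
move=> [up lo] rhor rho0.
have r0 : 0 <= r.
  rewrite -(cvg_lim _ rhor)//; apply: limr_ge; last exact: nearW.
  exact: cvgP rhor.
have key (e : R) : 0 < e -> exists2 dl, 0 < dl &
    \forall n \near \oo, (l + dl) * rho n <= l * r + e /\ l * r - e <= (l - dl) * rho n.
  move=> e0; pose dl := e / (2 * (r + 1)).
  have r1 : 0 < 2 * (r + 1) by rewrite mulr_gt0// ltr_wpDl.
  have dl0 : 0 < dl by rewrite divr_gt0.
  pose et := Num.min 1 (e / (2 * (`|l| + 1))).
  have l1 : 0 < 2 * (`|l| + 1) by rewrite mulr_gt0// ltr_wpDl.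
  have et0 : 0 < et by rewrite lt_min ltr01 divr_gt0.
  exists dl => //; move/cvgrPdist_le : rhor => /(_ et et0); apply: filterS => n.
  rewrite le_min => /andP[rn1 rn2].
  have h1 : `|l * (r - rho n)| <= e / 2.
    rewrite normrM; apply: (@le_trans _ _ ((`|l| + 1) * (e / (2 * (`|l| + 1))))).
      by rewrite ler_pM ?addr_ge0// lerDl.
    rewrite le_eqVlt; apply/orP; left; apply/eqP; field.
    by rewrite gt_eqF// ltr_wpDl.
  have h2 : dl * rho n <= e / 2.
    apply: (@le_trans _ _ (dl * (r + 1))).
      by rewrite ler_pM2l//; move: rn1; rewrite ler_norml; lra.
    rewrite le_eqVlt; apply/orP; left; apply/eqP; rewrite /dl; field.
    by rewrite gt_eqF// ltr_wpDl.
  by move: h1 h2; rewrite ler_norml; lra.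
split => e e0; have [dl dl0 H] := key e e0.
  move: (up dl dl0) H; apply: filterS2 => n un [h _].
  by apply: le_trans h; rewrite ler_wpM2r.
move=> N; have [M _ HM] := H; have [n Nn nu] := lo dl dl0 (maxn M N).
move: Nn; rewrite geq_max => /andP[Mn Nn]; exists n => //.
have [_ h] := HM n Mn.
by apply: le_trans h _; rewrite ler_wpM2r.
Qed.

Lemma is_limsupD u v l : is_limsup u l -> v n @[n --> \oo] --> 0 ->
  is_limsup (fun n => u n + v n) l.
Proof.
move=> [up lo] v0.
have H e : 0 < e -> \forall n \near \oo, `|v n| <= e.
  by move/cvgr0Pnorm_le : v0; apply.
split => e e0; have e2 : 0 < e / 2 by rewrite divr_gt0.
  by move: (up _ e2) (H _ e2); apply: filterS2 => n; rewrite ler_norml; lra.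
move=> N; have [M _ HM] := H _ e2; have [n Nn nu] := lo _ e2 (maxn M N).
move: Nn; rewrite geq_max => /andP[Mn Nn]; exists n => //.
by have := HM n Mn; rewrite ler_norml; lra.
Qed.

Lemma is_limsup_sqr u l : 0 <= l -> is_limsup u l -> is_limsup (\- u) l ->
  is_limsup (fun n => u n ^+ 2) (l ^+ 2).
Proof.
move=> l0 [up lo] [upN _].
have key e : 0 < e -> exists2 dl, 0 < dl & dl <= 1 /\ dl * (2 * l + 1) <= e.
  move=> e0; exists (Num.min 1 (e / (2 * l + 1))).
    by rewrite lt_min ltr01 divr_gt0// ltr_wpDl// mulr_ge0.
  split; first by rewrite ge_min lexx.
  by rewrite -ler_pdivlMr ?ge_min ?lexx ?orbT// ltr_wpDl// mulr_ge0.
split => e e0; have [dl dl0 [dl1 dle]] := key e e0.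
  move: (up _ dl0) (upN _ dl0); apply: filterS2 => n /= h1 h2.
  have : `|u n| <= l + dl by rewrite ler_norml; lra.
  rewrite -(@ler_pXn2r _ 2)// ?nnegrE ?addr_ge0// ?(ltW dl0)//.
  rewrite real_normK ?num_real// => /le_trans; apply.
  have := ler_wpM2l (ltW dl0) dl1; rewrite sqrrD; lra.
move=> N; have [n Nn nu] := lo _ dl0 N; exists n => //.
have [ldl|ldl] := leP 0 (l - dl).
  have : (l - dl) ^+ 2 <= u n ^+ 2.
    by rewrite ler_pXn2r// nnegrE// (le_trans ldl).
  apply: le_trans; rewrite sqrrB; have := sqr_ge0 dl; lra.
apply: le_trans (sqr_ge0 _).
have : l * l <= l * dl by rewrite ler_wpM2l//; lra.
rewrite expr2; lra.
Qed.

(** A clock that advances by at most one unit visits every integer beyond its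
    initial value. *)
Lemma is_limsup_time_change u l (N : nat -> nat) : is_limsup u l ->
  (forall n, N n.+1 = N n \/ N n.+1 = (N n).+1) ->
  (forall m, exists n, (m <= N n)%N) ->
  is_limsup (u \o N) l.
Proof.
move=> [up lo] N1 Noo.
have Nh : {homo N : i j / (i <= j)%N}.
  apply: homo_leq => //; first exact: leq_trans.
  by move=> n; case: (N1 n) => ->.
have Nsurj m : (N 0 <= m)%N -> exists n, N n = m.
  move=> m0; have [n] := Noo m; elim: n => [|n IH mn].
    by exists 0%N; apply/eqP; rewrite eqn_leq m0.
  have [/IH//|nm] := leqP m (N n); exists n.+1.
  by move: mn; case: (N1 n) => -> mn; apply/eqP; rewrite eqn_leq mn ?(ltnW nm) ?nm.
split => e e0.
  have [M _ HM] := up e e0; have [n0 Mn0] := Noo M.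
  by exists n0 => // n n0n; apply: HM => /=; rewrite (leq_trans Mn0)// Nh.
move=> M; have [m Mm mu] := lo e e0 (N M).
have [n nm] := Nsurj m (leq_trans (Nh _ _ (leq0n M)) Mm).
have [Mn|nM] := leqP M n; first by exists n => //=; rewrite nm.
exists M => //=; suff -> : N M = m by [].
by apply/eqP; rewrite eqn_leq Mm -nm Nh// ltnW.
Qed.

Lemma is_limsup_esup u l : is_limsup u l ->
  limn_esup (fun n => (u n)%:E) = l%:E.
Proof.
move=> [up lo]; rewrite limn_esup_lim.
have /cvg_lim -> // := @cvg_esups_inf _ (fun n => (u n)%:E).
apply/eqP; rewrite eq_le; apply/andP; split.
  apply/lee_addgt0Pr => e e0; have [M _ HM] := up e e0.
  apply: (@le_trans _ _ (esups (fun n => (u n)%:E) M)).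
    by apply: ereal_inf_lbound; exists M.
  by apply: ge_ereal_sup => _ [n /= Mn <-]; rewrite lee_fin HM.
apply: le_ereal_inf_tmp => _ [N _ <-].
apply/lee_subgt0Pr => e e0; have [n Nn nu] := lo e e0 N.
apply: (@le_trans _ _ (u n)%:E); first by rewrite -EFinB lee_fin.
by apply: ereal_sup_ubound; exists n.
Qed.

Lemma is_limsup_einf (u : nat -> R) l : is_limsup (\- u) l ->
  (- limn_einf (fun n => (u n)%:E) = l%:E)%E.
Proof.
move=> H; rewrite /limn_einf oppeK -(is_limsup_esup H).
by congr limn_esup; apply/funext => n; rewrite EFinN.
Qed.

Lemma is_limsup_shiftS (u : nat -> R) l :
  is_limsup (fun n => u n.+1) l -> is_limsup u l.
Proof.
move=> [up lo]; split => e e0.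
  by have [N _ HN] := up e e0; exists N.+1 => // -[|n] //= Nn; exact: HN.
by move=> N; have [n Nn nu] := lo e e0 N; exists n.+1 => //; exact: leqW.
Qed.

Lemma is_limsup_ratio (u v : nat -> R) : (\forall n \near \oo, 0 < v n) ->
  (forall dl, 0 < dl -> \forall n \near \oo, u n <= (1 + dl) * v n) ->
  (forall dl, 0 < dl -> forall N, exists2 n, (N <= n)%N & (1 - dl) * v n <= u n) ->
  is_limsup (fun n => u n / v n) 1.
Proof.
move=> v0 up lo; split => e e0.
  by move: v0 (up e e0); apply: filterS2 => n vn; rewrite ler_pdivrMr.
move=> N; have [M _ HM] := v0; have [n] := lo e e0 (maxn M N).
rewrite geq_max => /andP[Mn Nn] h; exists n => //.
by rewrite ler_pdivlMr//; exact: HM.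
Qed.

End limsup.

(** * Weighted means and logarithms of equivalent sequences *)

Section asymptotics.
Context {R : realType}.
Implicit Types (u v : nat -> R).

(** The terms before [t] gets small contribute a constant, negligible compared with
    the total weight. *)
Lemma weighted_cesaro (w t : nat -> R) : (forall n, 0 <= w n) ->
  \sum_(k < n) w k @[n --> \oo] --> +oo -> t n @[n --> \oo] --> 0 ->
  (\sum_(k < n) w k * t k) / (\sum_(k < n) w k) @[n --> \oo] --> 0.
Proof.
move=> w0 woo t0.
pose Wn n := \sum_(k < n) w k.
apply/cvgr0Pnorm_le => e e0; have e2 : 0 < e / 2 by rewrite divr_gt0.
have [M _ HM] : \forall n \near \oo, `|t n| <= e / 2 by move/cvgr0Pnorm_le : t0; apply.
pose A := \sum_(k < M) `|w k * t k|.
have bound n : (M <= n)%N -> `|\sum_(k < n) w k * t k| <= A + e / 2 * Wn n.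
  elim: n => [|n IH].
    rewrite leqn0 => /eqP M0; rewrite /A M0 /Wn !big_ord0 mulr0 addr0 normr0//.
  rewrite leq_eqVlt => /orP[/eqP <-|].
    apply: (le_trans (ler_norm_sum _ _ _)); rewrite lerDl mulr_ge0 ?(ltW e2)//.
    by apply: sumr_ge0.
  rewrite ltnS => Mn; rewrite /Wn !big_ord_recr/= mulrDr addrA.
  apply: (le_trans (ler_normD _ _)); apply: lerD; first exact: IH.
  by rewrite normrM ger0_norm// mulrC ler_wpM2r// HM.
move/cvgryPge : woo => woo.
near=> n.
have Mn : (M <= n)%N by near: n; exact: nbhs_infty_ge.
have W1 : 1 <= Wn n by near: n; exact: woo.
have WA : 2 * A / e <= Wn n by near: n; exact: woo.
have W0 : 0 < Wn n by rewrite (lt_le_trans ltr01).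
rewrite normrM normfV [`|Wn n|]gtr0_norm// ler_pdivrMr//.
apply: (le_trans (bound n Mn)).
move: WA; rewrite ler_pdivrMr//; lra.
Unshelve. all: by end_near. Qed.

(** A multiplicative error becomes additive after one logarithm. *)
Lemma ln_ratio_cvg1 u v (c C : R) : 0 < c -> v n @[n --> \oo] --> +oo ->
  (\forall n \near \oo, c * v n <= u n <= C * v n) ->
  ln (u n) / ln (v n) @[n --> \oo] --> (1 : R).
Proof.
move=> c0 voo cuC.
apply/cvgrPdist_le => e e0.
near=> n.
have v1 : 1 <= v n by near: n; move/cvgryPge : voo; apply.
have v0 : 0 < v n by rewrite (lt_le_trans ltr01).
have /andP[un1 un2] : c * v n <= u n <= C * v n by near: n.
have l1 : 1 <= ln (v n) by near: n; exact: ln_near_ge.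
have l2 : (`|ln c| + `|ln C|) / e <= ln (v n) by near: n; exact: ln_near_ge.
have l0 : 0 < ln (v n) by rewrite (lt_le_trans ltr01).
have u0 : 0 < u n by rewrite (lt_le_trans _ un1)// mulr_gt0.
have C0 : 0 < C by rewrite -(pmulr_lgt0 _ v0) (lt_le_trans u0).
have h1 : ln c + ln (v n) <= ln (u n).
  by rewrite -lnM ?posrE// ler_ln ?posrE// mulr_gt0.
have h2 : ln (u n) <= ln C + ln (v n).
  by rewrite -lnM ?posrE// ler_ln ?posrE// mulr_gt0.
have -> : 1 - ln (u n) / ln (v n) = (ln (v n) - ln (u n)) / ln (v n).
  by rewrite mulrBl divff// gt_eqF.
rewrite normrM normfV [`|ln (v n)|]gtr0_norm// ler_pdivrMr//.
move: l2; rewrite ler_pdivrMr// mulrC => l2; apply: le_trans l2.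
rewrite ler_norml.
have := ler_norm (ln C); have := ler_norm (- ln c); rewrite normrN.
have := normr_ge0 (ln c); have := normr_ge0 (ln C); lra.
Unshelve. all: by end_near. Qed.

Lemma lil_norm_near_gt0 (v : nat -> R) : v n @[n --> \oo] --> +oo ->
  \forall n \near \oo, 0 < lil_norm (v n).
Proof.
move=> /cvgryPge /(_ (expR (expR 1))); apply: filterS => n vn.
have v0 : 0 < v n by rewrite (lt_le_trans _ vn)// expR_gt0.
have e1 : expR 1 <= ln (v n).
  by rewrite -(@expRK R (expR 1)) ler_ln// posrE expR_gt0.
by rewrite sqrtr_gt0 mulr_gt0 ?mulr_gt0// (lt_le_trans ltr01)// ln_ge1.
Qed.

End asymptotics.

(** * The martingale of an elephant random walk and its variance *)

Section erw_weights.
Context {R : realType}.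
Variables (a s : R).
Hypotheses (a_ge : -1 <= a) (a_lt : 2 * a < 1) (s01 : 0 <= s <= 1).

Definition walk (h : seq bool) : R := \sum_(e <- h) sgb e.

Definition erw_kernel (h : seq bool) : R :=
  if h is [::] then 2 * s - 1 else a * walk h / (size h)%:R.

(** Inverse products of the factors [1 + a / k].  The factor of [k = 1] vanishes
    when [a = -1], so the product is normalised to be 1 at index 1, not 0. *)
Fixpoint erw_weight (n : nat) : R :=
  if n is n'.+1 then
    if n' is _.+1 then erw_weight n' / (1 + a / n'.+1%:R) else 1
  else 1 + a.

Local Notation b := erw_weight.
Local Notation g := (1 - 2 * a).

Lemma erw_ratio_gt0 n : 0 < 1 + a / n.+2%:R.
Proof.
have : - 2^-1 <= a / n.+2%:R.
  have n2 : n.+2%:R^-1 <= 2^-1 :> R by rewrite lef_pV2 ?posrE// ler_nat.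
  have n0 : 0 <= n.+2%:R^-1 :> R by [].
  have [a0|a0] := leP 0 a; first by rewrite (@le_trans _ _ 0)// ?mulr_ge0//; lra.
  apply: (@le_trans _ _ (- n.+2%:R^-1)); first by rewrite lerN2.
  by rewrite -mulN1r ler_wpM2r.
move: (a / _) => z; lra.
Qed.

Lemma erw_weight_gt0 n : 0 < b n.+1.
Proof. by elim: n => //= n IH; rewrite divr_gt0// erw_ratio_gt0. Qed.

Lemma erw_weight_ge0 n : 0 <= b n.
Proof. by case: n => [|n]; [rewrite /= -lerBlDl sub0r|rewrite ltW// erw_weight_gt0]. Qed.

Lemma erw_weight_rec n : b n.+1 * (1 + a / n.+1%:R) = b n.
Proof.
case: n => [|n]; first by rewrite /= divr1 mul1r.
by rewrite [b n.+2]/= -/(b n.+1) divfK// gt_eqF// erw_ratio_gt0.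
Qed.

Lemma walk_cons e h : walk (e :: h) = sgb e + walk h.
Proof. by rewrite /walk big_cons. Qed.

Lemma walk_norm_le h : `|walk h| <= (size h)%:R.
Proof.
elim: h => [|e h IH]; first by rewrite /walk big_nil normr0.
rewrite walk_cons; apply: (le_trans (ler_normD _ _)).
rewrite -[(size _)%:R]/((size h).+1%:R) -natr1 addrC lerD//.
by case: e; rewrite /sgb ?normrN normr1.
Qed.

Lemma erw_is_kernel : is_kernel erw_kernel.
Proof.
have ha := a_ge; have ha' := a_lt; have hs := s01.
move=> [|e h]; first by rewrite /erw_kernel; lra.
rewrite -ler_norml /erw_kernel normrM normfV normr_nat ler_pdivrMr ?ltr0n// mul1r.
rewrite normrM -[leRHS]mul1r ler_pM ?walk_norm_le// ler_norml; lra.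
Qed.

(** The drift [a * walk / n] of the walk is absorbed in the ratio of two consecutive
    weights. *)
Lemma mart_erw e h :
  mart b erw_kernel (e :: h) = b (size h) * walk (e :: h) - b 0%N * (2 * s - 1).
Proof.
elim: h e => [|e' h IH] e.
  by rewrite /= walk_cons /walk big_nil; ring.
rewrite -[mart _ _ _]/(mart b erw_kernel (e' :: h) +
  b (size h).+1 * (sgb e - a * walk (e' :: h) / (size h).+1%:R)) IH.
rewrite (walk_cons e) -[size (e' :: h)]/((size h).+1).
rewrite -(erw_weight_rec (size h)); ring.
Qed.

Lemma g_gt0 : 0 < g. Proof. by rewrite subr_gt0. Qed.

(** This sequence is asymptotic to [(1 - 2 * a) * var b n.+1], the two having almost
    proportional increments by [erw_scaleS]. *)
Definition erw_scale n : R := n.+1%:R * b n ^+ 2.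
Local Notation Y := erw_scale.

Lemma erw_scale_gt0 n : 0 < Y n.+1.
Proof. by rewrite mulr_gt0// exprn_gt0// erw_weight_gt0. Qed.

Lemma erw_scaleS n : Y n.+1 = Y n + b n.+1 ^+ 2 * (g - a ^+ 2 / n.+1%:R).
Proof.
rewrite /Y -(erw_weight_rec n) -[n.+2%:R]natr1.
have : n.+1%:R != 0 :> R by rewrite pnatr_eq0.
by move: (n.+1%:R : R) (b n.+1) => u v u0; field.
Qed.

Lemma erw_scale_var n :
  Y n = Y 0%N - g * b 0%N ^+ 2 + g * var b n.+1 +
    \sum_(k < n.+1) b k ^+ 2 * (if k == 0 :> nat then 0 else - a ^+ 2 / k%:R).
Proof.
elim: n => [|n IH].
  by rewrite varS /var big_ord0 big_ord_recl big_ord0 /=; ring.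
by rewrite erw_scaleS IH [var _ n.+2]varS [in RHS]big_ord_recr /=; ring.
Qed.

Lemma ln1B_bounds (t : R) : 0 <= t <= 2^-1 -> t <= - ln (1 - t) <= 2 * t.
Proof.
move=> /andP[t0 t1]; have t2 : 0 < 1 - t by lra.
apply/andP; split; first by rewrite lerNr; apply: le_ln1Dx; lra.
rewrite -lnV ?posrE// (_ : (1 - t)^-1 = 1 + t / (1 - t)); last first.
  by field; rewrite gt_eqF.
apply: (le_trans (le_ln1Dx _)).
  by rewrite (lt_le_trans (ltrN10 R))// divr_ge0// ltW.
rewrite ler_pdivrMr//; nra.
Qed.

Lemma near_natr_ge (A : R) : \forall n \near \oo, A <= n.+1%:R.
Proof.
have /cvgryPge /(_ A) := @natr_cvgy R; apply: filterS => n /le_trans; apply.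
by rewrite ler_nat.
Qed.

(** So the logarithm of [erw_scale] lies between multiples of [ln n].  This rough
    order of growth suffices for iterated logarithms, where exponents disappear. *)
Lemma erw_scale_ln_step : \forall n \near \oo,
  g / 4 * (ln n.+2%:R - ln n.+1%:R) <= ln (Y n.+1) - ln (Y n) <=
  2 * g * (ln n.+2%:R - ln n.+1%:R).
Proof.
have g0 := g_gt0.
near=> n.
have n1 : 0 < n.+1%:R :> R by []; have n2 : 0 < n.+2%:R :> R by [].
have nS : n.+2%:R = n.+1%:R + 1 :> R by rewrite natr1.
have na : 2 * a ^+ 2 / g <= n.+1%:R by near: n; exact: near_natr_ge.
have ng : 2 * g <= n.+1%:R by near: n; exact: near_natr_ge.
have npos : (0 < n)%N by near: n; exact: nbhs_infty_gt.
have Y1 : 0 < Y n by rewrite -(prednK npos) erw_scale_gt0.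
have Y2 := erw_scale_gt0 n.
have n11 : 1 <= n.+1%:R :> R by rewrite ler1n.
pose t := (g - a ^+ 2 / n.+1%:R) / n.+2%:R.
have tE : Y n = Y n.+1 * (1 - t).
  have -> : Y n.+1 * (1 - t) = Y n.+1 - b n.+1 ^+ 2 * (g - a ^+ 2 / n.+1%:R).
    rewrite /t /Y; move: (g - _) (b n.+1) (lt0r_neq0 n2) => u v.
    by move: (n.+2%:R : R) => z z0; field.
  by rewrite [X in X - _]erw_scaleS addrK.
have ga : g / 2 <= g - a ^+ 2 / n.+1%:R <= g.
  have : 0 <= a ^+ 2 / n.+1%:R by rewrite divr_ge0 ?sqr_ge0.
  have : a ^+ 2 / n.+1%:R <= g / 2.
    by rewrite ler_pdivrMr//; move: na; rewrite ler_pdivrMr// mulrC; move: (n.+1%:R : R) => z; lra.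
  by move: (a ^+ 2 / _) => z; lra.
have /andP[t1 t2] : g / 2 / n.+2%:R <= t <= g / n.+2%:R.
  by rewrite /t !ler_pM2r ?invr_gt0.
have t3 : g / n.+2%:R <= 2^-1.
  by rewrite ler_pdivrMr// nS; move: ng n11; move: (n.+1%:R : R) => z; lra.
have t0 : 0 <= t by rewrite (le_trans _ t1)// !divr_ge0// ltW.
have t01 : 0 <= t <= 2^-1 by rewrite t0 (le_trans t2).
have /andP[l1 l2] := ln1B_bounds t01.
have -> : ln (Y n.+1) - ln (Y n) = - ln (1 - t).
  rewrite tE lnM ?posrE//; first by rewrite opprD addrA subrr sub0r.
  by rewrite subr_gt0 (le_lt_trans (le_trans t2 t3))// invf_lt1// ltr1n.
have /andP[d1 d2] := @lnS_sub_bounds R n.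
have i2 : n.+1%:R^-1 <= 2 * n.+2%:R^-1 :> R.
  by rewrite -[2]invrK -invfM lef_pV2 ?posrE ?mulr_gt0// nS; move: (n.+1%:R : R) n11 => z; lra.
move: l1 l2 t1 t2 d1 d2 i2; move: (n.+1%:R^-1 : R) (n.+2%:R^-1 : R) (ln _ - ln _) => u v D.
move: (- ln (1 - t)) => E l1 l2 t1 t2 d1 d2 uv; apply/andP; split.
  apply: (@le_trans _ _ (g / 2 * v)); last by rewrite (le_trans t1).
  have : g / 4 * D <= g / 4 * (2 * v).
    by rewrite ler_wpM2l ?divr_ge0 ?(ltW g0)//; lra.
  lra.
apply: (le_trans l2); rewrite -mulrA ler_wpM2l//; apply: (le_trans t2).
by rewrite ler_wpM2l// ltW.
Unshelve. all: by end_near. Qed.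

Lemma invr_cvg0 (u : nat -> R) : u n @[n --> \oo] --> +oo ->
  (u n)^-1 @[n --> \oo] --> 0.
Proof.
move=> uoo; apply/gtr0_cvgV0 => //.
by have /cvgryPgt := uoo; apply.
Qed.

Lemma step_bounds (u w : nat -> R) N c C :
  (forall n, (N <= n)%N ->
    c * (w n.+1 - w n) <= u n.+1 - u n <= C * (w n.+1 - w n)) ->
  forall n, (N <= n)%N -> c * (w n - w N) <= u n - u N <= C * (w n - w N).
Proof.
move=> H; elim => [|n IH].
  by rewrite leqn0 => /eqP ->; rewrite !subrr !mulr0 lexx.
rewrite leq_eqVlt => /orP[/eqP <-|]; first by rewrite !subrr !mulr0 lexx.
by rewrite ltnS => Nn; have := H n Nn; have := IH Nn; lra.
Qed.

Lemma natS_cvgy : n.+1%:R @[n --> \oo] --> (+oo : set_system R).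
Proof. by apply/cvgryPge => A; exact: near_natr_ge. Qed.

Lemma lnS_cvgy : ln (n.+1%:R : R) @[n --> \oo] --> +oo.
Proof. by apply/cvgryPge => A; apply: ln_near_ge; exact: natS_cvgy. Qed.

Lemma erw_scale_ln : exists2 c, 0 < c & exists C, \forall n \near \oo,
  c * ln n.+1%:R <= ln (Y n) <= C * ln n.+1%:R.
Proof.
have g0 := g_gt0.
have [N _ HN] := erw_scale_ln_step.
exists (g / 8); first by rewrite divr_gt0.
exists (2 * g + 1); near=> n.
have Nn : (N <= n)%N by near: n; exact: nbhs_infty_ge.
have := @step_bounds (fun n => ln (Y n)) (fun n => ln n.+1%:R) N _ _ HN n Nn.
have : (g / 4 * ln N.+1%:R - ln (Y N)) / (g / 8) <= ln n.+1%:R.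
  by near: n; have /cvgryPge := lnS_cvgy; apply.
have : ln (Y N) - 2 * g * ln N.+1%:R <= ln n.+1%:R.
  by near: n; have /cvgryPge := lnS_cvgy; apply.
rewrite ler_pdivrMr ?divr_gt0//.
move: (ln n.+1%:R) (ln (Y n)) (ln (Y N)) (ln N.+1%:R) => *; lra.
Unshelve. all: by end_near. Qed.

Lemma erw_scale_cvgy : Y n @[n --> \oo] --> +oo.
Proof.
have [c c0 [C H]] := erw_scale_ln.
apply/cvgryPge => A; near=> n.
have npos : (0 < n)%N by near: n; exact: nbhs_infty_gt.
have Y1 : 0 < Y n by rewrite -(prednK npos) erw_scale_gt0.
have h1 : A / c <= ln n.+1%:R by near: n; have /cvgryPge := lnS_cvgy; apply.
have /andP[h2 _] : c * ln n.+1%:R <= ln (Y n) <= C * ln n.+1%:R by near: n.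
apply: (@le_trans _ _ (ln (Y n))); last by rewrite ltW// ln_sublinear.
by apply: le_trans h2; move: h1; rewrite ler_pdivrMr// mulrC.
Unshelve. all: by end_near. Qed.

Lemma erw_var_cvgy_shift : var b n.+1 @[n --> \oo] --> +oo.
Proof.
have g0 := g_gt0.
apply/cvgryPge => A; near=> n.
have h : g * A + (Y 0%N - g * b 0%N ^+ 2) <= Y n.
  by near: n; have /cvgryPge := erw_scale_cvgy; apply.
rewrite -(ler_pM2l g0).
have : \sum_(k < n.+1) b k ^+ 2 * (if k == 0 :> nat then 0 else - a ^+ 2 / k%:R) <= 0.
  apply: sumr_le0 => k _; apply: mulr_ge0_le0; first exact: sqr_ge0.
  by case: ifP => // _; rewrite mulNr oppr_le0 divr_ge0// sqr_ge0.
move: h; rewrite (erw_scale_var n).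
move: (\sum_(k < _) _) => z; lra.
Unshelve. all: by end_near. Qed.

Lemma erw_var_cvgy : var b n @[n --> \oo] --> +oo.
Proof.
apply/cvgryPge => A; have /cvgryPge /(_ A) [N _ HN] := erw_var_cvgy_shift.
by exists N.+1 => // -[|n] //= Nn; exact: HN.
Qed.

(** Summing [erw_scaleS], the correction terms [- a ^ 2 / k] are averaged with the
    weights [b k ^ 2], and vanish by [weighted_cesaro]. *)
Lemma erw_scale_var_ratio : Y n / var b n.+1 @[n --> \oo] --> g.
Proof.
pose t k : R := if k == 0%N then 0 else - a ^+ 2 / k%:R.
have t0 : t n @[n --> \oo] --> 0.
  apply/cvgr0Pnorm_le => e e0; near=> n.
  have n0 : (0 < n)%N by near: n; exact: nbhs_infty_gt.
  have h : a ^+ 2 / e <= n%:R by near: n; have /cvgryPge := @natr_cvgy R; apply.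
  rewrite /t gtn_eqF// normrM normrN normfV normr_nat ger0_norm ?sqr_ge0//.
  by rewrite ler_pdivrMr ?ltr0n//; move: h; rewrite ler_pdivrMr// mulrC.
pose D := Y 0%N - g * b 0%N ^+ 2.
have ces := weighted_cesaro (fun n => sqr_ge0 (b n)) erw_var_cvgy t0.
have Vinv := invr_cvg0 erw_var_cvgy_shift.
have : D * (var b n.+1)^-1 + g +
   (\sum_(k < n.+1) b k ^+ 2 * t k) / (\sum_(k < n.+1) b k ^+ 2) @[n --> \oo] --> D * 0 + g + 0.
  apply: cvgD; last first.
    by move: ces; rewrite -cvg_shiftS.
  apply: cvgD; last exact: cvg_cst.
  by apply: cvgM => //; exact: cvg_cst.
rewrite mulr0 add0r addr0.
apply: cvg_trans; apply: near_eq_cvg; near=> n.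
have V0 : 0 < var b n.+1.
  by near: n; have /cvgryPgt := erw_var_cvgy_shift; apply.
rewrite (erw_scale_var n) -/D -/(var b n.+1) -/(t _).
rewrite -[X in _ = (_ + X) / _]/(\sum_(k < n.+1) b k ^+ 2 * t k).
move: (\sum_(k < _) _) (var b n.+1) (lt0r_neq0 V0) => S V V00.
by field.
Unshelve. all: by end_near. Qed.

Lemma erw_var_ln : exists2 c, 0 < c & exists C, \forall n \near \oo,
  c * ln n.+1%:R <= ln (var b n.+1) <= C * ln n.+1%:R.
Proof.
have g0 := g_gt0; have [c c0 [C H]] := erw_scale_ln.
exists (c / 2); first by rewrite divr_gt0.
exists (C + 1); near=> n.
have V0 : 0 < var b n.+1.
  by near: n; have /cvgryPgt := erw_var_cvgy_shift; apply.
have npos : (0 < n)%N by near: n; exact: nbhs_infty_gt.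
have Y1 : 0 < Y n by rewrite -(prednK npos) erw_scale_gt0.
have /andP[H1 H2] : c * ln n.+1%:R <= ln (Y n) <= C * ln n.+1%:R by near: n.
have r1 : g / 2 <= Y n / var b n.+1.
  by near: n; apply: (cvgr_ge _ erw_scale_var_ratio); lra.
have r2 : Y n / var b n.+1 <= 2 * g.
  by near: n; apply: (cvgr_le _ erw_scale_var_ratio); lra.
have l1 : ln (g / 2) <= ln (Y n) - ln (var b n.+1).
  by rewrite -ln_div ?posrE// ler_ln ?posrE// divr_gt0.
have l2 : ln (Y n) - ln (var b n.+1) <= ln (2 * g).
  have q0 : 0 < Y n / var b n.+1 by rewrite divr_gt0.
  have gg0 : 0 < 2 * g by rewrite mulr_gt0.
  by rewrite -ln_div ?posrE// ler_ln ?posrE.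
have h1 : - ln (g / 2) <= ln n.+1%:R.
  by near: n; have /cvgryPge := lnS_cvgy; apply.
have h2 : ln (2 * g) / (c / 2) <= ln n.+1%:R.
  by near: n; have /cvgryPge := lnS_cvgy; apply.
move: h2; rewrite ler_pdivrMr ?divr_gt0//.
move: H1 H2 l1 l2 h1.
move: (ln n.+1%:R) (ln (Y n)) (ln (var _ _)) (ln (2 * g)) (ln (g / 2)) => *; lra.
Unshelve. all: by end_near. Qed.

Lemma erw_lnln_ratio : ln (ln (var b n.+1)) / ln (ln n.+1%:R) @[n --> \oo] --> (1 : R).
Proof.
have [c c0 [C H]] := erw_var_ln.
exact: (ln_ratio_cvg1 c0 lnS_cvgy H).
Qed.

Lemma near_ln_le (e : R) : 0 < e -> \forall n \near \oo, ln (n.+1%:R : R) <= e * n.+1%:R.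
Proof.
move=> e0; near=> n.
have n0 : 0 < n.+1%:R :> R by [].
pose z : R := Num.sqrt n.+1%:R.
have z0 : 0 < z by rewrite sqrtr_gt0.
have zz : n.+1%:R = z ^+ 2 by rewrite sqr_sqrtr// ltW.
have h : (2 / e) ^+ 2 <= n.+1%:R by near: n; exact: near_natr_ge.
have h' : 2 / e <= z by move: h; rewrite zz ler_sqr// nnegrE ?divr_ge0// ltW.
rewrite zz lnXn//; apply: (@le_trans _ _ (2 * z)).
  by rewrite mulr_natl lerMn2r /= ltW// ln_sublinear.
by rewrite expr2 mulrA ler_wpM2r ?(ltW z0)//; move: h'; rewrite ler_pdivrMr// mulrC.
Unshelve. all: by end_near. Qed.

Lemma near_lnln_ge1 : \forall n \near \oo, 1 <= ln (ln (n.+1%:R : R)).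
Proof. by apply: ln_near_ge; exact: lnS_cvgy. Qed.

(** [b n ^ 2] is of order [var b n.+1 / n], and [ln (ln (var b n.+1))] is much smaller
    than [n]. *)
Lemma erw_kolmogorov : kolmogorov_cond b.
Proof.
move=> e e0; have g0 := g_gt0; have [c c0 [C H]] := erw_var_ln.
have C0 : 0 < `|C| + 1 by rewrite ltr_wpDl.
have gC : 0 < 2 * g * (`|C| + 1) by rewrite !mulr_gt0.
near=> n.
have n0 : 0 < n.+1%:R :> R by [].
have V0 : 1 < var b n.+1.
  by near: n; have /cvgryPgt := erw_var_cvgy_shift; apply.
have V00 : 0 < var b n.+1 by rewrite (lt_trans ltr01).
have r2 : Y n / var b n.+1 <= 2 * g.
  by near: n; apply: (cvgr_le _ erw_scale_var_ratio); lra.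
have /andP[H1 H2] : c * ln n.+1%:R <= ln (var b n.+1) <= C * ln n.+1%:R by near: n.
have hl : ln n.+1%:R <= e / (2 * g * (`|C| + 1)) * n.+1%:R.
  by near: n; apply: near_ln_le; rewrite divr_gt0.
have ln0 : 0 <= ln n.+1%:R :> R by rewrite ln_ge0// ler1n.
have lV : ln (ln (var b n.+1)) <= (`|C| + 1) * ln n.+1%:R.
  apply: (@le_trans _ _ (ln (var b n.+1))).
    by rewrite ltW// ln_sublinear// ln_gt0.
  apply: (le_trans H2); rewrite ler_wpM2r// (le_trans (ler_norm _))// lerDl//.
have lV2 : ln (ln (var b n.+1)) <= e / (2 * g) * n.+1%:R.
  apply: (le_trans lV); move: hl => /(ler_wpM2l (ltW C0)) /le_trans; apply.
  rewrite le_eqVlt; apply/orP; left; apply/eqP; field.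
  by rewrite !gt_eqF.
apply: (@le_trans _ _ (b n ^+ 2 * (e / (2 * g) * n.+1%:R))).
  by rewrite ler_wpM2l ?sqr_ge0.
have -> : b n ^+ 2 * (e / (2 * g) * n.+1%:R) = e * (Y n / (2 * g)).
  by rewrite /Y; field; rewrite gt_eqF.
rewrite ler_pM2l// ler_pdivrMr ?mulr_gt0// mulrC.
by move: r2; rewrite ler_pdivrMr.
Unshelve. all: by end_near. Qed.

Lemma erw_norm_ratio :
  lil_norm (var b n.+1) / (b n * lil_norm n.+1%:R) @[n --> \oo] --> Num.sqrt g^-1.
Proof.
have g0 := g_gt0.
have : Num.sqrt ((Y n / var b n.+1)^-1 * (ln (ln (var b n.+1)) / ln (ln n.+1%:R)))
    @[n --> \oo] --> Num.sqrt (g^-1 * 1).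
  apply: continuous_cvg; first exact: sqrt_continuous.
  apply: cvgM; last exact: erw_lnln_ratio.
  by apply: cvgV; [rewrite gt_eqF|exact: erw_scale_var_ratio].
rewrite mulr1; apply: cvg_trans; apply: near_eq_cvg.
have [c c0 [C H]] := erw_var_ln.
near=> n.
have npos : (0 < n)%N by near: n; exact: nbhs_infty_gt.
have Y1 : 0 < Y n by rewrite -(prednK npos) erw_scale_gt0.
have b0 : 0 < b n by rewrite -(prednK npos) erw_weight_gt0.
have V1 : expR (expR 1) <= var b n.+1.
  by near: n; have /cvgryPge := erw_var_cvgy_shift; apply.
have V0 : 0 < var b n.+1 by rewrite (lt_le_trans _ V1)// expR_gt0.
have llV : 0 <= ln (ln (var b n.+1)).
  apply: ln_ge0; apply: ln_ge1; apply: le_trans V1.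
  by rewrite ler_expR -expR0 ler_expR.
have lln : 1 <= ln (ln n.+1%:R) :> R by near: n; exact: near_lnln_ge1.
have lln0 : 0 < ln (ln n.+1%:R) :> R by rewrite (lt_le_trans ltr01).
have n0 : 0 < n.+1%:R :> R by [].
rewrite /lil_norm -[X in X * Num.sqrt _](ger0_norm (ltW b0)) -sqrtr_sqr -sqrtrM ?sqr_ge0//.
have B0 : 0 <= b n ^+ 2 * (2 * n.+1%:R * ln (ln n.+1%:R)).
  by rewrite !mulr_ge0 ?sqr_ge0 ?ltW.
rewrite -(sqrtrV B0) -sqrtrM; last first.
  by rewrite !mulr_ge0// ltW.
congr (Num.sqrt _); rewrite /Y.
move: (lt0r_neq0 n0) (lt0r_neq0 V0) (lt0r_neq0 lln0) (lt0r_neq0 b0).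
move: (ln (ln (var b n.+1))) => z.
move: (ln (ln n.+1%:R)) (var b n.+1) (b n) => *.
by field; apply/and4P.
Unshelve. all: by end_near. Qed.

Lemma erw_offset : (b n * lil_norm n.+1%:R)^-1 @[n --> \oo] --> 0.
Proof.
apply: invr_cvg0; apply/cvgryPge => A; near=> n.
have lln : 1 <= ln (ln n.+1%:R) :> R by near: n; exact: near_lnln_ge1.
have b0 := erw_weight_ge0 n.
rewrite -[X in X * _](ger0_norm b0) -sqrtr_sqr -sqrtrM ?sqr_ge0//.
rewrite (le_trans (ler_norm A))// -sqrtr_sqr ler_wsqrtr//.
have YA : A ^+ 2 <= Y n by near: n; have /cvgryPge := erw_scale_cvgy; apply.
apply: (le_trans YA); rewrite /Y mulrC ler_wpM2l ?sqr_ge0//.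
rewrite -mulrA mulrCA ler_peMr//; lra.
Unshelve. all: by end_near. Qed.

Lemma lil_norm_nat_small : lil_norm n.+1%:R / n.+1%:R @[n --> \oo] --> (0 : R).
Proof.
apply/cvgr0Pnorm_le => e e0; near=> n.
have n0 : 0 < n.+1%:R :> R by [].
have lln : 1 <= ln (ln n.+1%:R) :> R by near: n; exact: near_lnln_ge1.
rewrite ger0_norm ?divr_ge0 ?sqrtr_ge0// ler_pdivrMr//.
rewrite -[leRHS]ger0_norm ?mulr_ge0 ?(ltW e0)// -sqrtr_sqr ler_wsqrtr//.
have h : ln n.+1%:R <= e ^+ 2 / 2 * n.+1%:R.
  by near: n; apply: near_ln_le; rewrite divr_gt0// exprn_gt0.
have l0 : ln (ln n.+1%:R) <= ln n.+1%:R :> R.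
  have l1 : 1 <= ln n.+1%:R :> R by near: n; have /cvgryPge := lnS_cvgy; apply.
  by rewrite ltW// ln_sublinear// (lt_le_trans ltr01).
have := le_trans l0 h => /(ler_wpM2l (ltW n0)).
rewrite exprMn; move: (n.+1%:R : R) (ln _) => *; lra.
Unshelve. all: by end_near. Qed.

End erw_weights.

(** * Law of the iterated logarithm for the elephant random walk *)

Section erw_lil.
Context (d : measure_display) (T : measurableType d) (R : realType)
  (P : probability T R).
Variables (a s : R).
Hypotheses (a_ge : -1 <= a) (a_lt : 2 * a < 1) (s01 : 0 <= s <= 1).
Local Notation b := (erw_weight a).
Local Notation mu := (erw_kernel a s).
Local Notation g := (1 - 2 * a).

Lemma erw_weight_near : \forall n \near \oo, 0 < b n.
Proof. by exists 1%N => // -[|n] // _; exact: erw_weight_gt0. Qed.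

Lemma mart_hist (x : nat -> T -> bool) n w :
  mart b mu (hist x n.+1 w) = b n * walk (hist x n.+1 w) - b 0%N * (2 * s - 1).
Proof. by rewrite [hist x n.+1 w]/= mart_erw// size_hist. Qed.

(** A martingale within its iterated logarithm scale makes the walk of order
    $\sqrt{n \log\log n}$, hence sublinear. *)
Lemma erw_kernel_cvg0 (x : nat -> T -> bool) w :
  (\forall n \near \oo, `|mart b mu (hist x n w)| <= 2 * lil_norm (var b n)) ->
  mu (hist x n w) @[n --> \oo] --> 0.
Proof.
move=> [N _ HN]; rewrite -cvg_shiftS.
pose d0 := b 0%N * (2 * s - 1).
pose z n := `|a| * (2 * (lil_norm (var b n.+1) / (b n * lil_norm n.+1%:R)) +
  `|d0| * (b n * lil_norm n.+1%:R)^-1) * (lil_norm n.+1%:R / n.+1%:R).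
have z0 : z n @[n --> \oo] --> `|a| * (2 * Num.sqrt g^-1 + `|d0| * 0) * 0.
  apply: cvgM; last exact: lil_norm_nat_small.
  apply: cvgM; first exact: cvg_cst.
  apply: cvgD; apply: cvgM; try exact: cvg_cst.
    exact: erw_norm_ratio.
  exact: erw_offset.
rewrite mulr0 in z0.
apply/cvgr0Pnorm_le => e e0; near=> n.
have ze : `|z n| <= e by near: n; move/cvgr0Pnorm_le : z0; apply.
apply: le_trans ze; rewrite (le_trans _ (ler_norm _))//.
have b0 : 0 < b n by near: n; exact: erw_weight_near.
have lpos : 0 < lil_norm n.+1%:R :> R.
  by near: n; apply: lil_norm_near_gt0; exact: natS_cvgy.
have n0 : 0 < n.+1%:R :> R by [].
have Hn : `|mart b mu (hist x n.+1 w)| <= 2 * lil_norm (var b n.+1).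
  apply: HN => /=.
  by near: n; exists N => // n /= /leqW.
rewrite /erw_kernel /= -/(hist x n.+1 w) size_hist.
have wE : walk (hist x n.+1 w) = (mart b mu (hist x n.+1 w) + d0) / b n.
  by rewrite mart_hist subrK mulrAC divff ?mul1r// gt_eqF.
rewrite wE normrM normfV normr_nat normrM /z -!mulrA ler_wpM2l//.
rewrite normrM normfV (gtr0_norm b0).
have -> : (2 * (lil_norm (var b n.+1) / (b n * lil_norm n.+1%:R)) +
    `|d0| / (b n * lil_norm n.+1%:R)) * (lil_norm n.+1%:R / n.+1%:R) =
   (2 * lil_norm (var b n.+1) + `|d0|) / b n / n.+1%:R.
  move: (lt0r_neq0 lpos) (lt0r_neq0 b0) (lt0r_neq0 n0).
  move: (lil_norm (n.+1%:R : R)) (b n) (n.+1%:R : R) => *; field.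
  by apply/and3P.
rewrite ler_wpM2r// ler_wpM2r ?invr_ge0 ?(ltW b0)//.
by rewrite (le_trans (ler_normD _ _))// lerD2r.
Unshelve. all: by end_near. Qed.

Lemma erw_path_limsup (x : nat -> T -> bool) w (sg : R) :
  is_limsup (fun n => sg * mart b mu (hist x n w) / lil_norm (var b n)) 1 ->
  is_limsup (fun n => sg * walk (hist x n w) / lil_norm n%:R) (Num.sqrt g^-1).
Proof.
move=> H; apply: is_limsup_shiftS.
pose d0 := b 0%N * (2 * s - 1).
have H' : is_limsup (fun n => sg * mart b mu (hist x n.+1 w) / lil_norm (var b n.+1)) 1.
  have [up lo] := H; split => e e0.
    by have [N _ HN] := up e e0; exists N => // n Nn; exact: (HN n.+1 (leqW Nn)).
  by move=> N; have [[|n]// Nn] := lo e e0 N.+1; exists n.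
rewrite -[Num.sqrt _]mul1r.
have rho0 n : 0 <= lil_norm (var b n.+1) / (b n * lil_norm n.+1%:R).
  by rewrite divr_ge0 ?sqrtr_ge0// mulr_ge0 ?sqrtr_ge0// erw_weight_ge0.
have off0 : sg * d0 * (b n * lil_norm n.+1%:R)^-1 @[n --> \oo] --> 0.
  rewrite -(mulr0 (sg * d0)); apply: cvgM; first exact: cvg_cst.
  exact: erw_offset.
apply: is_limsup_near (is_limsupD (is_limsupM H' (erw_norm_ratio a_ge a_lt) rho0) off0).
near=> n.
have b0 : 0 < b n by near: n; exact: erw_weight_near.
have lpos : 0 < lil_norm n.+1%:R :> R.
  by near: n; apply: lil_norm_near_gt0; exact: natS_cvgy.
have Vpos : 0 < lil_norm (var b n.+1).
  by near: n; apply: lil_norm_near_gt0; exact: erw_var_cvgy_shift.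
rewrite mart_hist -/d0; move: (walk _) => z.
move: (lt0r_neq0 lpos) (lt0r_neq0 b0) (lt0r_neq0 Vpos).
move: (lil_norm (n.+1%:R : R)) (b n) (lil_norm (var _ _)) => *; field.
by apply/and3P.
Unshelve. all: by end_near. Qed.

Theorem erw_lil (x : nat -> T -> bool) : has_kernel P x mu ->
  {ae P, forall w,
    is_limsup (fun n => walk (hist x n w) / lil_norm n%:R) (Num.sqrt g^-1) /\
    is_limsup (fun n => - (walk (hist x n w) / lil_norm n%:R)) (Num.sqrt g^-1)}.
Proof.
move=> kx.
have mu1 : is_kernel mu by exact: erw_is_kernel.
have Voo := erw_var_cvgy a_ge a_lt.
pose b' n := - b n.
have vE : var b' = var b by apply/funext => n; exact: varN.
have Voo' : var b' n @[n --> \oo] --> +oo by rewrite vE.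
have Kol := erw_kolmogorov a_ge a_lt.
have Kol' : kolmogorov_cond b'.
  by move=> e e0; rewrite vE; apply: filterS (Kol e e0) => n; rewrite /b' sqrrN.
have up := lil_upper kx mu1 Voo.
have up' := lil_upper kx mu1 Voo'.
have mu0 : {ae P, forall w, mu (hist x n w) @[n --> \oo] --> 0}.
  move: up up'; apply: filterS2 => w /(_ _ ltr01) h /(_ _ ltr01) h'.
  apply: erw_kernel_cvg0; move: h h'; apply: filterS2 => n.
  by rewrite martN vE ler_norml; lra.
have lo := lil_lower kx mu1 Voo Kol mu0.
have lo' := lil_lower kx mu1 Voo' Kol' mu0.
have Vpos := lil_norm_near_gt0 Voo.
have pos : {ae P, forall w, is_limsup (fun n => walk (hist x n w) / lil_norm n%:R) (Num.sqrt g^-1)}.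
  move: up lo; apply: filterS2 => w h h'.
  under eq_fun do rewrite -[walk _]mul1r.
  apply: erw_path_limsup; under eq_fun do rewrite mul1r.
  exact: is_limsup_ratio.
have neg : {ae P, forall w, is_limsup (fun n => - (walk (hist x n w) / lil_norm n%:R)) (Num.sqrt g^-1)}.
  move: up' lo'; apply: filterS2 => w h h'.
  under eq_fun do rewrite -mulNr -mulN1r.
  apply: erw_path_limsup; under eq_fun do rewrite mulN1r -martN.
  apply: is_limsup_ratio => //; by rewrite -vE.
by move: pos neg; apply: filterS2.
Qed.

End erw_lil.

(** * Finite sums of probabilities *)

Section probability_lists.
Context (d : measure_display) (T : measurableType d) (R : realType)
  (P : probability T R).

Definition Pr (A : set T) : R := fine (P A).

Lemma prE A : measurable A -> P A = (Pr A)%:E.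
Proof. by move=> mA; rewrite fineK// fin_num_measure. Qed.

Lemma pr_ge0 A : 0 <= Pr A.
Proof. by rewrite fine_ge0. Qed.

Lemma pr_le A B : measurable A -> measurable B -> A `<=` B -> Pr A <= Pr B.
Proof.
move=> mA mB AB; rewrite -lee_fin -!prE//.
by apply: le_measure; rewrite ?inE.
Qed.

Lemma pr_le1 A : measurable A -> Pr A <= 1.
Proof. by move=> mA; rewrite -lee_fin -prE// probability_le1. Qed.

Lemma prD A B : measurable A -> measurable B -> B `<=` A -> Pr (A `\` B) = Pr A - Pr B.
Proof.
move=> mA mB BA; apply/EFin_inj; rewrite EFinB -!prE//; last exact: measurableD.
by rewrite measureD// ?(setIidr BA)// ltey_eq fin_num_measure.
Qed.

Lemma prU A B : measurable A -> measurable B -> A `&` B = set0 ->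
  Pr (A `|` B) = Pr A + Pr B.
Proof.
move=> mA mB AB; apply/EFin_inj; rewrite EFinD -!prE//; last exact: measurableU.
by rewrite measureU.
Qed.

Lemma sum_pr_disjoint_le (I : eqType) (l : seq I) (D : I -> set T) (B : set T) :
  uniq l -> (forall i, i \in l -> measurable (D i)) -> measurable B ->
  (forall i, i \in l -> D i `<=` B) ->
  (forall i j w, i \in l -> j \in l -> D i w -> D j w -> i = j) ->
  \sum_(i <- l) Pr (D i) <= Pr B.
Proof.
elim: l B => [|i l IH] B; first by rewrite big_nil pr_ge0.
move=> /= /andP[il ul] mD mB DB Ddisj; rewrite big_cons.
have il' : i \in i :: l by rewrite mem_head.
have sub j : j \in l -> j \in i :: l by rewrite inE => ->; rewrite orbT.
have := IH (B `\` D i) ul (fun j jl => mD j (sub _ jl)) (measurableD mB (mD i il')).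
rewrite (prD mB (mD i il') (DB i il')) lerBrDl; apply.
- move=> j jl w Dw; split; first exact: (DB _ (sub _ jl) _ Dw).
  by move=> Diw; move: il; rewrite (Ddisj _ _ _ il' (sub _ jl) Diw Dw) jl.
- by move=> j k w jl kl; apply: Ddisj; exact: sub.
Qed.

Lemma pr_finite_sum (I : eqType) (l : seq I) (y : T -> I) (A : pred I) :
  uniq l -> (forall i, measurable [set w | y w = i]) ->
  measurable [set w | y w \in l /\ A (y w)] /\
  Pr [set w | y w \in l /\ A (y w)] = \sum_(i <- l | A i) Pr [set w | y w = i].
Proof.
move=> + my; elim: l => [|i l IH] /=.
  move=> _; rewrite big_nil (_ : [set w | _] = set0); last by apply/seteqP; split => w [].
  by split; [exact: measurable0|rewrite /Pr measure0].
move=> /andP[il /IH[mS SE]]; rewrite big_cons -SE.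
have [Ai|Ai] := boolP (A i).
  have -> : [set w | y w \in i :: l /\ A (y w)] =
      [set w | y w = i] `|` [set w | y w \in l /\ A (y w)].
    apply/seteqP; split => w /=; rewrite inE.
      by case=> /orP[/eqP|]; [left|right].
    by case=> [->|[-> ->]]; rewrite ?eqxx ?orbT.
  split; first exact: measurableU.
  apply/EFin_inj; rewrite EFinD -!prE//; last exact: measurableU.
  rewrite measureU//; apply/seteqP; split => w //= [-> [il' _]].
  by rewrite il' in il.
have -> : [set w | y w \in i :: l /\ A (y w)] = [set w | y w \in l /\ A (y w)].
  apply/seteqP; split => w /=; rewrite inE; last by case=> -> ->; rewrite orbT.
  by case=> /orP[/eqP ->|//]; rewrite (negbTE Ai).
by [].
Qed.

End probability_lists.

(** * Joint law of the steps *)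

Section codes.
Context (d : measure_display) (T : measurableType d) (R : realType)
  (P : probability T R) (p q r s : R).
Hypotheses (hp : 0 <= p <= 1) (hq : 0 <= q <= 1) (hr : 0 < r < 1)
  (hpqr : p + q + r = 1) (hs : 0 <= s <= 1).
Variable W : erws P p q r s.
Local Notation X := (erws_step W).
Local Notation pr := (Pr P).

(** Values other than 1 and -1 are coded by [None]; a step takes values other than
    1, -1 and 0 only on a null set, see [ae_steps_decode]. *)
Definition code (v : R) : option bool :=
  if v == 1 then Some true else if v == -1 then Some false else None.

Definition decode (o : option bool) : R := if o is Some e then sgb e else 0.

Lemma step_neqE :
  (((1 == -1 :> R) = false) * ((-1 == 1 :> R) = false)) *
  ((((0 == 1 :> R) = false) * ((1 == 0 :> R) = false)) *
   (((0 == -1 :> R) = false) * ((-1 == 0 :> R) = false))).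
Proof. by do !split; apply/eqP; lra. Qed.

Lemma decodeK : cancel decode code.
Proof. by case=> [[]|]; rewrite /code /= ?step_neqE ?eqxx ?step_neqE ?eqxx. Qed.

Fixpoint codes n w : seq (option bool) :=
  if n is n'.+1 then code (X n w) :: codes n' w else [::].

Lemma size_codes n w : size (codes n w) = n.
Proof. by elim: n => //= n ->. Qed.

(** Events on the exact values of the steps, for which the joint law is given,
    whereas [codes] also returns [None] at values that are not steps. *)
Fixpoint steps_are (c : seq (option bool)) : set T :=
  if c is o :: c' then
    steps_are c' `&` [set w | X (size c').+1 w = decode o]
  else setT.

Lemma measurable_step_eq n v : measurable [set w | X n w = v].
Proof.
rewrite (_ : [set w | _] = X n @^-1` [set v]); last by apply/seteqP; split.
by rewrite -[X in measurable X]setTI; exact: measurable_funP.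
Qed.

Lemma measurable_steps_are c : measurable (steps_are c).
Proof.
elim: c => [|o c IH] /=; first exact: measurableT.
by apply: measurableI => //; exact: measurable_step_eq.
Qed.

Lemma steps_are_codes c w : steps_are c w -> codes (size c) w = c.
Proof. by elim: c => //= o c IH [/IH -> ->]; rewrite decodeK. Qed.

Lemma steps_areE c : steps_are c =
  [set w | forall j, (1 <= j <= size c)%N -> X j w = decode (nth None c (size c - j))].
Proof.
elim: c => [|o c IH].
  by apply/seteqP; split => w //= _ [|j].
rewrite /= IH; apply/seteqP; split => w /=.
  move=> [H H1] j /andP[j1]; rewrite leq_eqVlt ltnS => /orP[/eqP ->|jc].
    by rewrite subnn.
  by rewrite subSn//=; apply: H; rewrite j1.
move=> H; split; last by have := H (size c).+1; rewrite subnn; apply; rewrite leqnn.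
move=> j /andP[j1 jc]; have := H j; rewrite subSn//=; apply.
by rewrite j1 leqW.
Qed.

(** The total probability of the signs that turn a remembered step [o'] into
    [o]; every sign turns a stop into a stop. *)
Definition transition (o' o : option bool) : R :=
  match o', o with
  | None, None => 1
  | None, Some _ => 0
  | Some _, None => r
  | Some e', Some e => if e == e' then p else q
  end.

Definition next_mass (c : seq (option bool)) (o : option bool) : R :=
  \sum_(o' <- c) transition o' o.

Lemma next_mass_total c :
  next_mass c (Some true) + next_mass c (Some false) + next_mass c None = (size c)%:R.
Proof.
rewrite /next_mass -!big_split /=.
rewrite (eq_bigr (fun=> 1)); last first.
  by case=> [[]|] _ /=; have := hpqr; lra.
by rewrite big_const_seq count_predT -Monoid.iteropE.
Qed.

Lemma choices_total o' o :
  \sum_(ab <- [:: (1, p); (-1, q); (0, r)] | ab.1 * decode o' == decode o) ab.2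
  = transition o' o.
Proof.
have h := hpqr.
by case: o' => [[]|]; case: o => [[]|]; rewrite !big_cons big_nil /= /sgb
  ?mulr1 ?mul1r ?mulr0 ?mul0r ?mulN1r ?opprK ?eqxx ?step_neqE ?eqxx; lra.
Qed.

(** The choices of a remembered time and a sign that produce [o] are disjoint events
    of known probability. *)
Lemma pr_next_ge c o : (0 < size c)%N ->
  pr (steps_are c) * next_mass c o / (size c)%:R <= pr (steps_are (o :: c)).
Proof.
move=> c0; set n := size c.
pose x j := decode (nth None c (n - j)).
pose l := [seq (k, ab) | k <- iota 1 n, ab <- [:: (1 : R, p); (-1, q); (0, r)]].
pose good (i : nat * (R * R)) := i.2.1 * x i.1 == decode o.
pose D (i : nat * (R * R)) := steps_are c `&` [set w | erws_memory W n w = i.1] `&`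
  [set w | erws_sign W n w = i.2.1].
have mD i : measurable (D i).
  apply: measurableI; first apply: measurableI; first exact: measurable_steps_are.
    rewrite -[X in measurable X]setTI.
    exact: (measurable_funP (erws_memory W n) measurableT [set i.1]).
  rewrite -[X in measurable X]setTI.
  exact: (measurable_funP (erws_sign W n) measurableT [set i.2.1]).
have ul : uniq (seq.filter good l).
  rewrite filter_uniq// allpairs_uniq ?iota_uniq//; last by move=> [? ?] [? ?] _ _ /= [-> ->].
  by rewrite /= !inE !xpair_eqE !step_neqE.
have lP i : i \in seq.filter good l ->
    [/\ (1 <= i.1 <= n)%N, i.2 \in [:: (1, p); (-1, q); (0, r)] & good i].
  rewrite mem_filter => /andP[gi /allpairsP[[k ab] /= [kn abl iE]]].
  by split => //; rewrite iE//=; move: kn; rewrite mem_iota add1n ltnS.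
have DB i : i \in seq.filter good l -> D i `<=` steps_are (o :: c).
  move=> /lP[kn _ /eqP gi] w [[Ec mk] sa]; split => //=.
  rewrite -/n (erws_next W _ c0) mk sa -gi; congr (_ * _).
  by move: Ec; rewrite steps_areE => /(_ _ kn).
have Ddisj i j w : i \in seq.filter good l -> j \in seq.filter good l -> D i w -> D j w -> i = j.
  case: i => k [a b]; case: j => k' [a' b'] /lP[_ /= il _] /lP[_ /= jl _].
  move=> [[_ /= kw] aw] [[_ /= kw'] aw']; move: kw' aw'; rewrite kw aw => <- aa'.
  move: il jl; rewrite -aa' !inE !xpair_eqE.
  by case/or3P => /andP[/eqP -> /eqP ->]; rewrite ?eqxx ?step_neqE /= ?orbF => /eqP ->.
have prDE i : i \in seq.filter good l -> pr (D i) = pr (steps_are c) / n%:R * i.2.2.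
  case: i => k [a b] /lP[/= kn abl _].
  have := erws_choice W x kn abl.
  rewrite -/n /x -steps_areE -/(D (k, (a, b))).
  rewrite (prE P (measurable_steps_are c)) -!EFinM => DE.
  by apply/EFin_inj; rewrite -prE// DE.
apply: le_trans (sum_pr_disjoint_le P ul (fun i _ => mD i) (measurable_steps_are _) DB Ddisj).
rewrite (eq_big_seq _ prDE) big_filter -mulr_sumr mulrAC.
rewrite ler_wpM2l ?divr_ge0 ?pr_ge0// big_mkcond big_allpairs /=.
rewrite /next_mass (big_nth None) big_nat_rev -/n /= add0n.
rewrite -[1%N]/(0 + 1)%N [leRHS](_ : _ = \sum_(1 <= k < n.+1) transition (nth None c (n - k)) o).
  by rewrite big_add1.
rewrite /index_iota subn1; apply: eq_bigr => k _.
by rewrite -choices_total -big_mkcond.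
Qed.

(** The three lower bounds of [pr_next_ge] add up to the probability of the past,
    and the three events are disjoint, so none of the bounds is strict. *)
Lemma pr_next c o : (0 < size c)%N ->
  pr (steps_are (o :: c)) = pr (steps_are c) * next_mass c o / (size c)%:R.
Proof.
move=> c0.
have tot : \sum_(o <- [:: Some true; Some false; None]) pr (steps_are (o :: c)) <=
    pr (steps_are c).
  apply: sum_pr_disjoint_le => //.
  - by move=> o' _; exact: measurable_steps_are.
  - exact: measurable_steps_are.
  - by move=> o' _ w [].
  - move=> o1 o2 w _ _ /steps_are_codes H1 /steps_are_codes H2.
    by move: H1; rewrite -[size (o1 :: c)]/(size (o2 :: c)) H2 => -[].
have g1 := pr_next_ge (Some true) c0; have g2 := pr_next_ge (Some false) c0.
have g3 := pr_next_ge None c0; have g := pr_next_ge o c0.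
have S : pr (steps_are c) * next_mass c (Some true) / (size c)%:R +
   pr (steps_are c) * next_mass c (Some false) / (size c)%:R +
   pr (steps_are c) * next_mass c None / (size c)%:R = pr (steps_are c).
  by rewrite -!mulrDl -!mulrDr next_mass_total mulfK// pnatr_eq0 -lt0n.
rewrite !big_cons big_nil in tot.
by apply/eqP; rewrite eq_le g andbT; case: o {g} => [[]|]; lra.
Qed.

Fixpoint all_codes n : seq (seq (option bool)) :=
  if n is n'.+1 then
    [seq o :: c | c <- all_codes n', o <- [:: Some true; Some false; None]]
  else [:: [::]].

Lemma all_codesS n : all_codes n.+1 =
  [seq o :: c | c <- all_codes n, o <- [:: Some true; Some false; None]].
Proof. by []. Qed.

Lemma all_codes_uniq n : uniq (all_codes n).
Proof.
elim: n => // n IH; apply: allpairs_uniq => //.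
by move=> [c1 o1] [c2 o2] _ _ /= [-> ->].
Qed.

Lemma mem_all_codes n c : (c \in all_codes n) = (size c == n).
Proof.
elim: n c => [|n IH] c; first by rewrite inE; case: c.
rewrite all_codesS.
apply/allpairsP/idP => [[[c' o] /= [c'n _ ->]]|].
  by rewrite /= eqSS -IH.
case: c => // o c; rewrite /= eqSS -IH => cn; exists (c, o); split => //=.
by case: o => [[]|].
Qed.

Lemma sum_steps_are_ge1 n : 1 <= \sum_(c <- all_codes n.+1) pr (steps_are c).
Proof.
elim: n => [|n IH].
  rewrite /= !big_cons big_nil /= !setTI.
  have -> : pr [set w | X 1 w = 1] = s by rewrite /Pr (erws_first_pos W).
  have -> : pr [set w | X 1 w = -1] = 1 - s by rewrite /Pr (erws_first_neg W).
  by have := pr_ge0 P [set w | X 1 w = 0]; lra.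
apply: (le_trans IH); rewrite (all_codesS n.+1).
have l0 c : c \in all_codes n.+1 -> (0 < size c)%N by rewrite mem_all_codes => /eqP ->.
move: (all_codes n.+1) l0 => l l0; rewrite big_allpairs_dep.
rewrite le_eqVlt; apply/orP; left; apply/eqP; apply: eq_big_seq => c /l0 c0.
transitivity (\sum_(o <- [:: Some true; Some false; None]) pr (steps_are (o :: c))); last by [].
rewrite !big_cons big_nil addr0 !pr_next// addrA -!mulrDl -!mulrDr next_mass_total.
by rewrite mulfK// pnatr_eq0 -lt0n.
Qed.

(** By [pr_next] the probabilities of all the sequences of proper steps of a given
    length add up to 1. *)
Lemma ae_steps_decode :
  {ae P, forall w, forall j, (1 <= j)%N -> X j w = decode (code (X j w))}.
Proof.
have mG (n : nat) : measurable [set w | X n w = decode (code (X n w))].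
  rewrite (_ : [set w | _] = [set w | X n w = 1] `|` [set w | X n w = -1] `|` [set w | X n w = 0]).
    by do 2?apply: measurableU; exact: measurable_step_eq.
  apply/seteqP; split => w /=.
    by move=> ->; case: (code _) => [[]|]; [left; left|left; right|right].
  rewrite -[1]/(decode (Some true)) -[-1]/(decode (Some false)) -[0]/(decode None).
  by case=> [[]|] ->; rewrite decodeK.
apply: ae_foralln => j; case: j => [|n]; first exact: aeW.
have le1 : 1 <= pr [set w | X n.+1 w = decode (code (X n.+1 w))].
  apply: (le_trans (sum_steps_are_ge1 n)).
  apply: sum_pr_disjoint_le; first exact: all_codes_uniq.
  - by move=> c _; exact: measurable_steps_are.
  - exact: mG.
  - move=> c; rewrite mem_all_codes => /eqP cn w.
    case: c cn => // o c [cn] [_]; rewrite /= cn => ->.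
    by rewrite decodeK.
  move=> c1 c2 w; rewrite !mem_all_codes => /eqP cn1 /eqP cn2.
  by move=> /steps_are_codes <- /steps_are_codes <-; rewrite cn1 cn2.
exists (~` [set w | X n.+1 w = decode (code (X n.+1 w))]); split.
- exact: measurableC.
- apply: (eq_trans (probability_setC P (mG n.+1))).
  rewrite (prE P (mG n.+1)) -EFinB; congr (_%:E).
  by have := pr_le1 P (mG n.+1); lra.
- by move=> w /= /not_implyP[].
Qed.

Lemma pr_ae_eq (A B : set T) : measurable A -> measurable B ->
  {ae P, forall w, A w <-> B w} -> P A = P B.
Proof.
move=> mA mB [N [mN N0 HN]].
have sub (C D : set T) : measurable C -> measurable D -> (forall w, C w -> D w \/ N w) ->
    (P C <= P D)%E.
  move=> mC mD CDN.
  apply: (@le_trans _ _ (P (D `|` N))).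
    by apply: le_measure; rewrite ?inE//; exact: measurableU.
  apply: (le_trans (measureU2 _ mD mN)); rewrite -[leRHS]adde0; apply: leeD => //.
  by rewrite le_eqVlt; apply/orP; left; apply/eqP; exact: N0.
have AB w : ~ (A w <-> B w) -> N w by move=> nAB; exact: HN.
apply/eqP; rewrite eq_le; apply/andP; split; apply: sub => // w h;
  have [iff|/AB] := pselect (A w <-> B w); by [left; apply/iff|right].
Qed.

Lemma measurable_codes (A : pred (seq (option bool))) n :
  measurable [set w | A (codes n w)].
Proof.
elim: n A => [|n IH] A /=.
  have [->|->] : [set _ : T | A [::]] = setT \/ [set _ : T | A [::]] = set0.
  - by case: (A [::]); [left|right]; apply/seteqP; split.
  - exact: measurableT.
  - exact: measurable0.
have mc o : measurable [set w | code (X n.+1 w) = o].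
  have m1 := measurable_step_eq n.+1 1; have m2 := measurable_step_eq n.+1 (-1).
  case: o => [[]|].
  - rewrite (_ : [set w | _] = [set w | X n.+1 w = 1])//.
    apply/seteqP; split => w /=; rewrite /code; last by move=> ->; rewrite eqxx.
    by case: eqP => //; case: eqP.
  - rewrite (_ : [set w | _] = [set w | X n.+1 w = -1])//.
    apply/seteqP; split => w /=; rewrite /code; last by move=> ->; rewrite step_neqE eqxx.
    by case: eqP => //; case: eqP.
  - rewrite (_ : [set w | _] = ~` [set w | X n.+1 w = 1] `&` ~` [set w | X n.+1 w = -1]).
      by apply: measurableI; exact: measurableC.
    apply/seteqP; split => w /=; rewrite /code.
      by case: eqP => //; case: eqP.
    by move=> [/eqP/negbTE -> /eqP/negbTE ->].
have -> : [set w | A (code (X n.+1 w) :: codes n w)] =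
  ([set w | code (X n.+1 w) = Some true] `&` [set w | A (Some true :: codes n w)]) `|`
  ([set w | code (X n.+1 w) = Some false] `&` [set w | A (Some false :: codes n w)]) `|`
  ([set w | code (X n.+1 w) = None] `&` [set w | A (None :: codes n w)]).
  apply/seteqP; split => w /=; last by case=> [[]|] [-> ?].
  by case: (code _) => [[]|]; [left; left|left; right|right].
by do 2?apply: measurableU; apply: measurableI; try exact: mc;
  [exact: (IH (fun c => A (Some true :: c)))|exact: (IH (fun c => A (Some false :: c)))|
   exact: (IH (fun c => A (None :: c)))].
Qed.

Lemma measurable_codes_eq n c : measurable [set w | codes n w = c].
Proof.
rewrite (_ : [set _ | _] = [set w | codes n w == c]).
  exact: (measurable_codes (pred1 c)).
by apply/seteqP; split => w /= /eqP.
Qed.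

Lemma pr_codes c : pr [set w | codes (size c) w = c] = pr (steps_are c).
Proof.
congr fine; apply: pr_ae_eq.
- exact: measurable_codes_eq.
- exact: measurable_steps_are.
apply: filterS ae_steps_decode => w Hw; split; last exact: steps_are_codes.
elim: c => //= o c IH [Xo cc]; split; first exact: IH.
by rewrite Hw// Xo.
Qed.

End codes.

(** * The walk of the moves *)

Section embedding.
Context (d : measure_display) (T : measurableType d) (R : realType)
  (P : probability T R) (p q r s : R).
Hypotheses (hp : 0 <= p <= 1) (hq : 0 <= q <= 1) (hr : 0 < r < 1)
  (hpqr : p + q + r = 1) (hs : 0 <= s <= 1).
Variable W : erws P p q r s.
Local Notation X := (erws_step W).
Local Notation pr := (Pr P).
Local Notation codes := (codes W).
Local Notation a := ((p - q) / (p + q)).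

Definition moves n w : seq bool := pmap id (codes n w).

Lemma moves_measurable (A : pred (seq bool)) n : measurable [set w | A (moves n w)].
Proof. exact: (measurable_codes W (fun c => A (pmap id c))). Qed.

Lemma pq_gt0 : 0 < p + q.
Proof. have h := hpqr; have h' := hr; lra. Qed.

(** A move is drawn from the moves and signed sum of the past alone: remembered
    stops produce no move. *)
Lemma next_mass_sign c e : next_mass p q r c (Some e) =
  ((p + q) * (size (pmap id c))%:R + (p - q) * sgb e * walk (pmap id c)) / 2.
Proof.
elim: c => [|o c IH]; first by rewrite /next_mass /walk !big_nil /= !mulr0 addr0 mul0r.
rewrite /next_mass big_cons -/(next_mass p q r c (Some e)) IH.
case: o => [e'|] /=; last by rewrite add0r.
rewrite walk_cons -[(size _).+1%:R]natr1 {IH}.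
move: ((size _)%:R : R) (walk _) => u v; case: e; case: e'; rewrite /sgb /=; lra.
Qed.

(** The moves extend [h] for good at time [n.+1], with the sign [e]; for a given [h]
    this happens at most once, so these events are disjoint. *)
Definition leave n h e := [set w | moves n w = h /\ code (X n.+1 w) = Some e].

Lemma moves_set n h : [set w | moves n w = h] =
  [set w | codes n w \in all_codes n /\ pmap id (codes n w) == h].
Proof.
apply/seteqP; split => w /=; last by case=> _ /eqP.
by move=> <-; rewrite mem_all_codes size_codes !eqxx.
Qed.

Lemma leave_set n h e : leave n h e =
  [set w | codes n.+1 w \in [seq Some e :: c | c <- all_codes n] /\
           pmap id (behead (codes n.+1 w)) == h].
Proof.
apply/seteqP; split => w /=.
  move=> [<- ->]; split => //; rewrite map_f// mem_all_codes size_codes//.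
by move=> [/mapP[c cn [Xe _]] /eqP mh]; split.
Qed.

Lemma measurable_moves_eq n h : measurable [set w | moves n w = h].
Proof.
rewrite moves_set; exact: (pr_finite_sum P (fun c => pmap id c == h) (all_codes_uniq n) (measurable_codes_eq W n)).1.
Qed.

Lemma map_all_codes_uniq n e : uniq [seq Some e :: c | c <- all_codes n].
Proof. by rewrite map_inj_uniq ?all_codes_uniq// => c1 c2 []. Qed.

Lemma measurable_leave n h e : measurable (leave n h e).
Proof.
rewrite leave_set.
exact: (pr_finite_sum P (fun c => pmap id (behead c) == h) (map_all_codes_uniq n e)
  (measurable_codes_eq W n.+1)).1.
Qed.

(** Given the moves [h] by time [n], [(p + q) * size h / n] is the probability of moving,
    and the last factor, the conditional law of the sign, does not depend on [n]. *)
Lemma pr_leave n h e : (0 < n)%N -> (0 < size h)%N ->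
  pr (leave n h e) = pr [set w | moves n w = h] * ((p + q) * (size h)%:R / n%:R) *
    ((1 + sgb e * (a * walk h / (size h)%:R)) / 2).
Proof.
move=> n0 h0.
rewrite leave_set (pr_finite_sum P (fun c => pmap id (behead c) == h)
  (map_all_codes_uniq n e) (measurable_codes_eq W n.+1)).2.
rewrite moves_set (pr_finite_sum P (fun c => pmap id c == h) (all_codes_uniq n) (measurable_codes_eq W n)).2.
rewrite big_map /= !mulr_suml big_seq_cond [RHS]big_seq_cond.
apply: eq_bigr => c /andP[]; rewrite mem_all_codes => /eqP cn /eqP hE.
have c0 : (0 < size c)%N by rewrite cn.
have -> : pr [set w | code (X n.+1 w) :: codes n w = Some e :: c] =
    pr (steps_are W (Some e :: c)).
  by rewrite -(pr_codes hpqr W (Some e :: c)) /= cn.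
rewrite (pr_next hpqr W _ c0) next_mass_sign hE -(pr_codes hpqr W) cn.
have m0 : (size h)%:R != 0 :> R by rewrite pnatr_eq0 -lt0n.
have nn0 : n%:R != 0 :> R by rewrite pnatr_eq0 -lt0n.
have pq0 := lt0r_neq0 pq_gt0.
move: (Pr P _) (walk h) m0 nn0 pq0; move: ((size h)%:R : R) (n%:R : R) (sgb e : R) => *.
by field; apply/and3P.
Qed.

Lemma moves_step n w : moves n.+1 w =
  if code (X n.+1 w) is Some e then e :: moves n w else moves n w.
Proof. by rewrite /moves /=; case: (code _) => [e|]. Qed.

Lemma moves_suffix n n' w : (n <= n')%N ->
  exists s, moves n' w = s ++ moves n w.
Proof.
elim: n' => [|n' IH]; first by rewrite leqn0 => /eqP ->; exists [::].
rewrite leq_eqVlt => /orP[/eqP <-|]; first by exists [::].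
rewrite ltnS => /IH[u uE]; rewrite moves_step uE.
by case: (code _) => [e|]; [exists (e :: u)|exists u].
Qed.

Lemma moves_size_homo w : {homo (fun n => size (moves n w)) : m n / (m <= n)%N}.
Proof. by move=> m n /(moves_suffix w)[u ->]; rewrite size_cat leq_addl. Qed.

Lemma moves_size_inj n n' w : size (moves n w) = size (moves n' w) ->
  moves n w = moves n' w.
Proof.
wlog nn' : n n' / (n <= n')%N.
  by move=> H E; have [/H|/ltnW/H] := leqP n n'; [apply|move=> ->].
have [u ->] := moves_suffix w nn'; rewrite size_cat => /eqP.
by rewrite eq_sym -[X in _ == X]add0n eqn_add2r => /nilP ->.
Qed.

Lemma leave_moves n n' h e w : leave n h e w -> (n < n')%N -> moves n' w <> h.
Proof.
move=> [mh Xe] nn' mh'; have [u] := moves_suffix w nn'.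
rewrite moves_step Xe mh' mh => /(congr1 size); rewrite size_cat /= => /eqP.
by rewrite -[X in X == _]add0n addnS -addSn eqn_add2r.
Qed.

Lemma leave_disjoint n n' h e e' w : leave n h e w -> leave n' h e' w ->
  (n, e) = (n', e').
Proof.
move=> L L'; have [nn'|nn'|nn'] := ltngtP n n'.
- by have := leave_moves L nn'; case: L' => ->.
- by have := leave_moves L' nn'; case: L => ->.
by case: L L' => [_ X1] [_]; rewrite -nn' X1 => -[->].
Qed.

Lemma pr_leave_total n h : (0 < n)%N -> (0 < size h)%N ->
  pr (leave n h true) + pr (leave n h false) =
  pr [set w | moves n w = h] * ((p + q) * (size h)%:R / n%:R).
Proof.
move=> n0 h0; rewrite !pr_leave// /sgb -mulrDr -[RHS]mulr1; congr (_ * _).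
by move: (a * _ / _) => z; lra.
Qed.

Lemma harmonic_ge_ln N k : ln (N.+1 + k)%:R - ln N.+1%:R <=
  \sum_(n <- iota N.+1 k) n%:R^-1 :> R.
Proof.
elim: k => [|k IH]; first by rewrite big_nil addn0 subrr.
rewrite (_ : iota _ k.+1 = iota N.+1 k ++ [:: (N.+1 + k)%N]); last first.
  by rewrite -[k.+1]addn1 iotaD.
rewrite big_cat /= big_seq1 addnS.
have /andP[_] := @lnS_sub_bounds R (N + k)%N; rewrite -addSn => h.
by move: IH h; move: (\sum_(_ <- _) _) (_^-1) => S z; lra.
Qed.

(** If the moves remained equal to [h] from time [N] on with positive probability,
    the disjoint events of leaving [h] at time [n.+1] would have probabilities at least a
    constant times [1 / n], with a divergent sum. *)
Lemma stuck_negligible N h : (0 < size h)%N ->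
  P.-negligible [set w | forall n, (N <= n)%N -> moves n w = h].
Proof.
move=> h0.
pose S := [set w | forall n, (N <= n)%N -> moves n w = h].
have mS : measurable S.
  rewrite (_ : S = \bigcap_(n in [set n | (N <= n)%N]) [set w | moves n w = h])//.
  by apply: bigcap_measurable => [|n _]; [exists N => /=|exact: measurable_moves_eq].
exists S; split => //; rewrite prE//; congr (_%:E).
have pq0 := pq_gt0.
have bound k : pr S * (p + q) * (ln (N.+1 + k)%:R - ln N.+1%:R) <= 1.
  pose l := [seq (n, e) | n <- iota N.+1 k, e <- [:: true; false]].
  have : \sum_(i <- l) pr (leave i.1 h i.2) <= pr setT.
    apply: sum_pr_disjoint_le => //.
    - by rewrite allpairs_uniq ?iota_uniq// => -[? ?] [? ?] _ _ /= [-> ->].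
    - by move=> i _; exact: measurable_leave.
    - by move=> [n e] [n' e'] w _ _ /= L L'; exact: leave_disjoint L L'.
  rewrite {2}/Pr probability_setT /=; apply: le_trans.
  rewrite big_allpairs_dep /=.
  apply: (@le_trans _ _ (pr S * (p + q) * \sum_(n <- iota N.+1 k) n%:R^-1)).
    by rewrite ler_wpM2l ?harmonic_ge_ln// mulr_ge0 ?pr_ge0// ltW.
  rewrite mulr_sumr big_seq [leRHS]big_seq; apply: ler_sum => n.
  rewrite mem_iota => /andP[Nn _].
  have n0 : (0 < n)%N by rewrite (leq_trans _ Nn).
  rewrite !big_cons big_nil addr0 pr_leave_total//.
  rewrite -mulrA; apply: ler_pM; rewrite ?pr_ge0 ?mulr_ge0 ?invr_ge0// ?(ltW pq0)//.
    apply: pr_le => //; first exact: measurable_moves_eq.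
    by move=> w; apply; exact: ltnW.
  by rewrite -mulrA ler_pM2l// ler_peMl ?invr_ge0// ler1n.
apply/eqP; rewrite eq_le pr_ge0 andbT leNgt; apply/negP => S0.
have Sp : 0 < pr S * (p + q) by rewrite mulr_gt0.
have /cvgryPgt/(_ ((pr S * (p + q))^-1 + ln N.+1%:R)) [M _ HM] := @lnS_cvgy R.
have := bound M; rewrite -ler_pdivlMl// mulr1 lerBlDr leNgt.
by rewrite HM//= leq_addl.
Qed.

Lemma ae_first_move : {ae P, forall w, (0 < size (moves 1 w))%N}.
Proof.
exists (~` ([set w | X 1 w = 1] `|` [set w | X 1 w = -1])); split.
- by apply: measurableC; apply: measurableU; exact: measurable_step_eq.
- have m1 := measurable_step_eq W 1 1; have m2 := measurable_step_eq W 1 (-1).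
  apply: (eq_trans (probability_setC P (measurableU _ _ m1 m2))).
  rewrite (prE P (measurableU _ _ m1 m2)) prU//; last first.
    by apply/seteqP; split => w //= [->]; lra.
  rewrite /Pr (erws_first_pos W) (erws_first_neg W) -EFinB; congr (_%:E).
  by rewrite /=; lra.
- move=> w /= mv; apply: contra_not mv => -[] X1; rewrite moves_step X1.
    by rewrite -[1]/(decode R (Some true)) decodeK.
  by rewrite -[-1]/(decode R (Some false)) decodeK.
Qed.

(** There are countably many pairs [(N, h)] to exclude by [stuck_negligible]. *)
Lemma ae_moves_unbounded :
  {ae P, forall w, forall m, exists n, (m <= size (moves n w))%N}.
Proof.
have nstuck : {ae P, forall w, forall N h, (0 < size h)%N ->
    exists2 n, (N <= n)%N & moves n w <> h}.
  have : {ae P, forall w, forall k, forall N h, unpickle k = Some (N, h) ->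
      (0 < size h)%N -> exists2 n, (N <= n)%N & moves n w <> h}.
    apply: ae_foralln => k; case E : (unpickle k) => [[N h]|]; last exact: aeW.
    have [h0|h0] := boolP (0 < size h)%N; last first.
      by apply: aeW => w N' h' [_ <-]; rewrite (negbTE h0).
    apply: negligibleS (stuck_negligible N h0) => w /= nH n Nn.
    apply: contrapT => mh; apply: nH => N' h' [<- <-] _.
    by exists n.
  by apply: filterS => w H N h; apply: (H (pickle (N, h))); rewrite pickleK.
move: nstuck ae_first_move; apply: filterS2 => w H H1 m.
suff [n] : exists n, (0 < n)%N && (m <= size (moves n w))%N by case/andP; exists n.
elim: m => [|m [n /andP[n0 mn]]]; first by exists 1%N.
have h0 : (0 < size (moves n w))%N.
  by rewrite (leq_trans H1)// moves_size_homo.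
have [n' nn' ne] := H n _ h0; exists n'; rewrite (leq_trans n0)//=.
rewrite (leq_ltn_trans mn)// ltn_neqAle moves_size_homo// andbT.
by apply/eqP => /moves_size_inj E; apply: ne.
Qed.

(** The sign of the move number [m.+1]; where there is no such move the value is
    [false], on a null set. *)
Definition embedded m w : bool :=
  `[< exists n, size (moves n w) = m.+1 /\ head false (moves n w) >].

Lemma measurable_embedded m : measurable [set w | embedded m w].
Proof.
rewrite (_ : [set w | _] = \bigcup_n [set w |
    (fun h => (size h == m.+1) && head false h) (moves n w)]).
  apply: bigcup_measurable => n _.
  exact: (moves_measurable (fun h => (size h == m.+1) && head false h)).
apply/seteqP; split => w /=.
  by move/asboolP => [n [nm hd]]; exists n => //=; rewrite nm eqxx.
by move=> [n _ /= /andP[/eqP nm hd]]; apply/asboolP; exists n.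
Qed.

Lemma hist_embedded n w : hist embedded (size (moves n w)) w = moves n w.
Proof.
elim: n => [|n IH]; first by [].
have mE := moves_step n w; case E : (code _) mE => [e|] mE; last by rewrite mE IH.
have -> : size (moves n.+1 w) = (size (moves n w)).+1 by rewrite mE.
rewrite /= IH mE; congr (_ :: _).
apply/asboolP/idP => [[n' [nS hd]]|e1]; last by exists n.+1; rewrite mE.
suff E' : moves n' w = moves n.+1 w by move: hd; rewrite E' mE.
by apply: moves_size_inj; rewrite nS mE.
Qed.

Lemma pr_bigcup_ratio (F G : (set T)^nat) (c : R) :
  (forall n, measurable (F n)) -> (forall n, measurable (G n)) ->
  trivIset setT F -> trivIset setT G -> 0 <= c ->
  (forall n, pr (F n) = c * pr (G n)) ->
  P (\bigcup_n F n) = (c%:E * P (\bigcup_n G n))%E.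
Proof.
move=> mF mG tF tG c0 FG.
rewrite !measure_bigcup// -nneseriesZl; last by [].
have e n : (P (F n) = c%:E * P (G n))%E by rewrite !prE// FG EFinM.
by apply: eq_eseriesr => n _; exact: e.
Qed.

Hypothesis diffusive : p / (1 - r) < 3 / 4.

Lemma memory_ge : -1 <= a.
Proof.
have := hp; have pq := pq_gt0 => h.
by rewrite ler_pdivlMr//; lra.
Qed.

Lemma memory_lt : 2 * a < 1.
Proof.
have := diffusive; have pq := pq_gt0; have := hpqr => h.
have -> : 1 - r = p + q by lra.
by rewrite mulrA !ltr_pdivrMr//; lra.
Qed.

(** Up to null sets, reaching the history [h] of moves amounts to leaving it at some
    time.  The law of the next sign is the same at all these times by [pr_leave],
    and summing over them preserves it. *)
Lemma embedded_has_kernel : has_kernel P embedded (erw_kernel a s).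
Proof.
split; first exact: measurable_embedded.
have mhist m h := measurable_hist_eq (x := embedded) h m measurable_embedded.
case=> [|e0 h0].
  rewrite (_ : [set w | hist embedded (size [::]) w = [::]] = setT); last by apply/seteqP; split.
  rewrite probability_setT mul1e /=.
  have -> : (1 + (2 * s - 1)) / 2 = s by field.
  rewrite -(erws_first_pos W); apply: pr_ae_eq => //.
  - exact: (mhist 1%N [:: true]).
  - exact: measurable_step_eq.
  apply: filterS ae_first_move => w s1.
  have hE : hist embedded 1 w = moves 1 w.
    have h1 : size (moves 1 w) = 1%N by move: s1; rewrite moves_step; case: (code _).
    by have := hist_embedded 1 w; rewrite h1.
  change (hist embedded 1 w = [:: true] <-> X 1 w = 1).
  rewrite hE moves_step; split; last first.
    by move=> ->; rewrite -[1]/(decode R (Some true)) decodeK.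
  by rewrite /code; case: eqP => //; case: eqP.
set h := e0 :: h0; set m := size h.
have m0 : (0 < size h)%N by [].
pose G := \bigcup_n (leave n h true `|` leave n h false).
have mL n : measurable (leave n h true `|` leave n h false).
  by apply: measurableU; exact: measurable_leave.
have hist_leave w : (forall k, exists n, (k <= size (moves n w))%N) ->
    hist embedded m w = h <-> G w.
  move=> unb; split => [hm|[n _ /= L]]; last first.
    have mn : moves n w = h by case: L => -[].
    by have := hist_embedded n w; rewrite mn.
  have [n] := unb m.+1; elim: n => [//|n IH] mn.
  have [/IH//|] := leqP m.+1 (size (moves n w)).
  rewrite ltnS => nm; move: mn; rewrite moves_step; case E : (code _) => [e|]; last first.
    by move=> /leq_trans/(_ nm); rewrite ltnn.
  rewrite /= ltnS => mn.
  have hn : moves n w = h by rewrite -hm -(hist_embedded n); congr (hist _ _ w); apply/eqP; rewrite eqn_leq nm mn.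
  by exists n => //=; case: e E => E; [left|right].
have hist_leave_true w : (forall k, exists n, (k <= size (moves n w))%N) ->
    hist embedded m.+1 w = true :: h <-> (\bigcup_n leave n h true) w.
  move=> unb; split => [hm|[n _ [mn X1]]]; last first.
    have mS : moves n.+1 w = true :: h by rewrite moves_step X1 mn.
    by rewrite -mS -(hist_embedded n.+1) mS.
  have hm' : hist embedded m w = h by exact: (congr1 behead hm).
  have [n _ [L|L]] := (hist_leave w unb).1 hm'; first by exists n.
  case: L => mn X1.
  have mS : moves n.+1 w = false :: h by rewrite moves_step X1 mn.
  by have := hist_embedded n.+1 w; rewrite mS -[size _]/m.+1 hm.
have PG : P [set w | hist embedded m w = h] = P G.
  apply: pr_ae_eq; first exact: mhist.
    by apply: bigcup_measurable => n _; exact: mL.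
  by apply: filterS ae_moves_unbounded => w /hist_leave.
have -> : P [set w | hist embedded m.+1 w = true :: h] = P (\bigcup_n leave n h true).
  apply: pr_ae_eq; first exact: mhist.
    by apply: bigcup_measurable => n _; exact: measurable_leave.
  by apply: filterS ae_moves_unbounded => w /hist_leave_true.
rewrite PG muleC; apply: pr_bigcup_ratio => //.
- by move=> n; exact: measurable_leave.
- move=> n n' _ _ [w [L L']].
  by case: (leave_disjoint L L').
- move=> n n' _ _ [w [L L']].
  by case: L => L; case: L' => L'; case: (leave_disjoint L L').
- have /andP[] := @erw_is_kernel R a s memory_ge memory_lt hs h; lra.
move=> n.
have disj : leave n h true `&` leave n h false = set0.
  by apply/seteqP; split => w //= [L L']; case: (leave_disjoint L L').
rewrite prU//; try exact: measurable_leave.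
have [n0|n0] := posnP n.
  have z e : leave n h e = set0.
    by apply/seteqP; split => w //=; rewrite n0 => -[].
  by rewrite !z /Pr measure0 /= addr0 mulr0.
rewrite pr_leave_total// pr_leave// /sgb mul1r mulrC.
by rewrite /erw_kernel.
Qed.

End embedding.

(** * From the clock to the deterministic normalisation *)

Section transfer.
Context {R : realType}.

Lemma lnn_cvgy : ln (n%:R : R) @[n --> \oo] --> +oo.
Proof. by apply/cvgryPge => A; apply: ln_near_ge; exact: natr_cvgy. Qed.

(** For [S > 0], [ln (N n)] is comparable to [ln n] and the ratio of iterated
    logarithms tends to 1.  For [S = 0] that ratio may have no limit, but it stays
    between 0 and 1 as [N n <= n]. *)
Lemma clock_ratio_cvg (N : nat -> nat) (L S : R) : 0 < L ->
  (forall n, (N n <= n)%N) -> (N n)%:R @[n --> \oo] --> (+oo : set_system R) ->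
  n%:R `^ (- L) * (N n)%:R @[n --> \oo] --> S ->
  Num.sqrt (n%:R `^ (- L) * (N n)%:R * (ln (ln (N n)%:R) / ln (ln n%:R)))
    @[n --> \oo] --> Num.sqrt S.
Proof.
move=> L0 Nn Noo cS.
apply: continuous_cvg; first exact: sqrt_continuous.
have c0 n : 0 <= n%:R `^ (- L) * (N n)%:R by rewrite mulr_ge0 ?powR_ge0.
have lnN1 : \forall n \near \oo, 1 <= ln (N n)%:R :> R by apply: ln_near_ge.
have lnnoo := lnn_cvgy.
have lnlnn : \forall n \near \oo, 1 <= ln (ln n%:R) :> R by apply: ln_near_ge.
have S0 : 0 <= S.
  rewrite -(cvg_lim _ cS)//; apply: limr_ge; last exact: nearW.
  exact: cvgP cS.
have lnNle : \forall n \near \oo, ln (N n)%:R <= ln n%:R :> R.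
  near=> n.
  have N0 : 0 < (N n)%:R :> R.
    by near: n; have /cvgryPgt := Noo; apply.
  have n0 : 0 < n%:R :> R by rewrite (lt_le_trans N0)// ler_nat.
  by rewrite ler_ln ?posrE// ler_nat.
move: S0; rewrite le_eqVlt => /orP[/eqP S0|S0].
  rewrite -S0 in cS *.
  apply/cvgr0Pnorm_le => e e0; near=> n.
  have ce : `|n%:R `^ (- L) * (N n)%:R| <= e.
    by near: n; move/cvgr0Pnorm_le : cS; apply.
  have l1 : 1 <= ln (N n)%:R :> R by near: n.
  have l2 : 1 <= ln (ln n%:R) :> R by near: n.
  have l3 : ln (N n)%:R <= ln n%:R :> R by near: n.
  apply: le_trans ce; rewrite normrM ler_piMr//.
  have l4 : 0 < ln (ln n%:R) :> R by rewrite (lt_le_trans ltr01).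
  rewrite ger0_norm; last by rewrite divr_ge0 ?ln_ge0// (le_trans l1).
  rewrite ler_pdivrMr// mul1r ler_ln ?posrE//.
    by rewrite (lt_le_trans ltr01).
  by rewrite (lt_le_trans ltr01)// (le_trans l1).
rewrite -[S in X in _ --> X]mulr1; apply: cvgM => //.
have L2 : 0 < L / 2 by rewrite divr_gt0.
apply: (@ln_ratio_cvg1 R _ _ (L / 2) 1 L2 lnnoo).
near=> n.
have l3 : ln (N n)%:R <= ln n%:R :> R by near: n.
rewrite mul1r l3 andbT.
have N0 : 0 < (N n)%:R :> R.
  by near: n; have /cvgryPgt := Noo; apply.
have n0 : 0 < n%:R :> R by rewrite (lt_le_trans N0)// ler_nat.
have c1 : S / 2 <= n%:R `^ (- L) * (N n)%:R.
  by near: n; apply: (cvgr_ge _ cS); rewrite ltr_pdivrMr// ltr_pMr// ltr1n.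
have S2 : 0 < S / 2 by rewrite divr_gt0.
have h : ln (S / 2) <= - L * ln n%:R + ln (N n)%:R.
  rewrite -ln_powR -lnM ?posrE ?powR_gt0// ler_ln ?posrE// (lt_le_trans S2)//.
have h2 : - ln (S / 2) / (L / 2) <= ln n%:R.
  by near: n; have /cvgryPge := lnnoo; apply.
move: h2; rewrite ler_pdivrMr//.
by move: h; move: (ln n%:R) (ln (N n)%:R) (ln (S / 2)) => *; lra.
Unshelve. all: by end_near. Qed.

Lemma lil_clock_limsup (N : nat -> nat) (x : nat -> R) (L S sigma : R) : 0 < L ->
  (forall n, (N n <= n)%N) -> (N n)%:R @[n --> \oo] --> (+oo : set_system R) ->
  n%:R `^ (- L) * (N n)%:R @[n --> \oo] --> S ->
  is_limsup (fun n => x n / lil_norm (N n)%:R) sigma ->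
  is_limsup (fun n => x n / Num.sqrt (2 * n%:R `^ L * ln (ln n%:R))) (sigma * Num.sqrt S).
Proof.
move=> L0 Nn Noo cS H.
have := is_limsupM H (clock_ratio_cvg L0 Nn Noo cS) (fun n => sqrtr_ge0 _).
apply: is_limsup_near; near=> n.
have lN : 0 < lil_norm (N n)%:R :> R.
  by near: n; exact: lil_norm_near_gt0.
have ll : 1 <= ln (ln n%:R) :> R.
  by near: n; apply: ln_near_ge; exact: lnn_cvgy.
have ll0 : 0 < ln (ln n%:R) :> R by rewrite (lt_le_trans ltr01).
have n0 : (0 < n)%N by near: n; exact: nbhs_infty_gt.
have nL : 0 < n%:R `^ L :> R by rewrite powR_gt0// ltr0n.
have A0 : 0 < 2 * (N n)%:R * ln (ln (N n)%:R) :> R by rewrite -sqrtr_gt0.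
have B0 : 0 < 2 * n%:R `^ L * ln (ln n%:R) by rewrite !mulr_gt0.
have -> : n%:R `^ (- L) * (N n)%:R * (ln (ln (N n)%:R) / ln (ln n%:R)) =
    (2 * (N n)%:R * ln (ln (N n)%:R)) / (2 * n%:R `^ L * ln (ln n%:R)).
  rewrite powRN; move: (lt0r_neq0 nL) (lt0r_neq0 ll0).
  move: (n%:R `^ L) (ln (ln n%:R)) (ln (ln (N n)%:R)) => *.
  by field; apply/andP.
rewrite sqrtrM ?(ltW A0)// sqrtrV ?(ltW B0)// -/(lil_norm _).
by rewrite mulrA divfK// gt_eqF.
Unshelve. all: by end_near. Qed.

End transfer.

(** * The walk with stops as a time-changed walk *)

Section assembly.
Context (d : measure_display) (T : measurableType d) (R : realType)
  (P : probability T R) (p q r s : R).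
Variable W : erws P p q r s.

Lemma position_moves w :
  (forall j, (1 <= j)%N -> erws_step W j w = decode R (code (erws_step W j w))) ->
  forall n, position W n w = walk (moves W n w).
Proof.
move=> Hw; elim=> [|n IH]; first by rewrite /position big_geq// /walk /moves /= big_nil.
rewrite /position big_nat_recr//= -/(position W n w) IH moves_step Hw//.
by rewrite decodeK; case: (code _) => [e|] /=; rewrite ?addr0// walk_cons addrC.
Qed.

Lemma num_ones_moves w :
  (forall j, (1 <= j)%N -> erws_step W j w = decode R (code (erws_step W j w))) ->
  forall n, num_ones W n w = (size (moves W n w))%:R.
Proof.
move=> Hw; elim=> [|n IH]; first by rewrite /num_ones big_geq.
rewrite /num_ones big_nat_recr//= -/(num_ones W n w) IH moves_step Hw//.
rewrite decodeK; case: (code _) => [e|] /=; last by rewrite expr0n addr0.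
by rewrite -[(size _).+1%:R]natr1; case: e; rewrite /sgb ?sqrrN expr1n.
Qed.

Lemma moves_size_le n w : (size (moves W n w) <= n)%N.
Proof. by elim: n => // n IH; rewrite moves_step; case: (code _) => [e|] //=; exact: leqW. Qed.

Lemma moves_size_step w n : size (moves W n.+1 w) = size (moves W n w) \/
  size (moves W n.+1 w) = (size (moves W n w)).+1.
Proof. by rewrite moves_step; case: (code _) => [e|]; [right|left]. Qed.

End assembly.

Theorem theorem3p2 (d : measure_display) (T : measurableType d) (R : realType)
    (P : probability T R) (p q r s : R)
    (hp : 0 <= p <= 1) (hq : 0 <= q <= 1) (hr : 0 < r < 1)
    (hpqr : p + q + r = 1) (hs : 0 <= s <= 1)
    (W : erws P p q r s)
    (diffusive : p / (1 - r) < 3 / 4)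
    (sigma : R) (sigma_gt0 : 0 < sigma)
    (sigmaE : sigma ^+ 2 = (1 - r) / (3 * (1 - r) - 4 * p)) :
  [/\ {ae P, forall w,
        let u (n : nat) : \bar R := (position W n w /
          Num.sqrt (2 * num_ones W n w * ln (ln (num_ones W n w))))%:E in
        limn_esup u = sigma%:E /\ (- limn_einf u)%E = sigma%:E},
      {ae P, forall w,
        limn_esup (fun n : nat => (position W n w ^+ 2 /
          (2 * num_ones W n w * ln (ln (num_ones W n w))))%:E)
        = (sigma ^+ 2)%:E}
    & forall Sigma : {RV P >-> R},
      {ae P, forall w,
        n%:R `^ (- (1 - r)) * num_ones W n w @[n --> \oo] --> Sigma w} ->
      {ae P, forall w,
        let v (n : nat) : \bar R := (position W n w /
          Num.sqrt (2 * n%:R `^ (1 - r) * ln (ln n%:R)))%:E in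
        limn_esup v = (sigma * Num.sqrt (Sigma w))%:E /\
        (- limn_einf v)%E = (sigma * Num.sqrt (Sigma w))%:E} /\
      {ae P, forall w,
        limn_esup (fun n : nat => (position W n w ^+ 2 /
          (2 * n%:R `^ (1 - r) * ln (ln n%:R)))%:E)
        = (sigma ^+ 2 * Sigma w)%:E}].
Proof.
have pq0 : 0 < p + q by lra.
pose a := (p - q) / (p + q).
have a_ge : -1 <= a := memory_ge hp hr hpqr.
have a_lt : 2 * a < 1 := memory_lt hr hpqr diffusive.
have sigma_sqrt : Num.sqrt (1 - 2 * a)^-1 = sigma.
  rewrite -[RHS]ger0_norm ?(ltW sigma_gt0)// -sqrtr_sqr sigmaE; congr Num.sqrt.
  rewrite /a (_ : 1 - r = p + q); last by lra.
  have d1 : 3 * (p + q) - 4 * p != 0.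
    apply/eqP => d0; move: a_lt; rewrite /a mulrA ltr_pdivrMr//; lra.
  by field; rewrite d1 gt_eqF.
have lil := erw_lil a_ge a_lt hs (embedded_has_kernel hp hr hpqr hs W diffusive).
pose N w n := size (moves W n w).
have main : {ae P, forall w,
   [/\ forall n, num_ones W n w = (N w n)%:R,
       (N w n)%:R @[n --> \oo] --> (+oo : set_system R),
       is_limsup (fun n => position W n w / lil_norm (N w n)%:R) sigma &
       is_limsup (fun n => (- position W n w) / lil_norm (N w n)%:R) sigma]}.
  move: lil (ae_steps_decode hpqr W) (ae_moves_unbounded hr hpqr W).
  apply: filterS3 => w [pos neg] dec unb.
  rewrite sigma_sqrt in pos neg; have step := moves_size_step W w.
  have wE n : walk (hist (embedded W) (N w n) w) = position W n w.
    by rewrite hist_embedded position_moves.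
  split.
  - exact: num_ones_moves.
  - apply/cvgryPge => A; have [n0 An0] := unb (Num.truncn A).+1.
    have At : A < (Num.truncn A).+1%:R by rewrite -truncn_le_nat.
    exists n0 => // n n0n; apply: (le_trans (ltW At)); rewrite ler_nat.
    by rewrite (leq_trans An0)// moves_size_homo.
  - apply: is_limsup_near (is_limsup_time_change pos step unb).
    by apply: nearW => n /=; rewrite -/(N w n) wE.
  - apply: is_limsup_near (is_limsup_time_change neg step unb).
    by apply: nearW => n /=; rewrite -/(N w n) wE mulNr.
have negE (u v : nat -> R) : (fun n => - u n / v n) = \- (fun n => u n / v n).
  by apply/funext => n; rewrite mulNr.
split.
- move: main; apply: filterS => w [NE Noo pos neg].
  have -> : (fun n => (position W n w /
      Num.sqrt (2 * num_ones W n w * ln (ln (num_ones W n w))))%:E) =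
      (fun n => (position W n w / lil_norm (N w n)%:R)%:E).
    by apply/funext => n; rewrite NE.
  split; first exact: is_limsup_esup.
  by apply: is_limsup_einf; rewrite -negE.
- move: main; apply: filterS => w [NE Noo pos neg].
  apply: is_limsup_esup; rewrite negE in neg.
  have := is_limsup_sqr (ltW sigma_gt0) pos neg; apply: is_limsup_near.
  have := lil_norm_near_gt0 Noo; apply: filterS => n; rewrite sqrtr_gt0 => N0.
  by rewrite expr_div_n sqr_sqrtr ?(ltW N0)// NE.
move=> Sigma HS.
have L0 : 0 < 1 - r by lra.
have sq : {ae P, forall w, [/\ 0 <= Sigma w,
    is_limsup (fun n => position W n w / Num.sqrt (2 * n%:R `^ (1 - r) * ln (ln n%:R)))
      (sigma * Num.sqrt (Sigma w)) &
    is_limsup (fun n => (- position W n w) / Num.sqrt (2 * n%:R `^ (1 - r) * ln (ln n%:R)))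
      (sigma * Num.sqrt (Sigma w))]}.
  move: main HS; apply: filterS2 => w [NE Noo pos neg] cS.
  have Nle n : (N w n <= n)%N by exact: moves_size_le.
  have cS' : n%:R `^ (- (1 - r)) * (N w n)%:R @[n --> \oo] --> Sigma w.
    by move: cS; under eq_fun do rewrite NE.
  split; [|exact: lil_clock_limsup cS' pos|exact: lil_clock_limsup cS' neg].
  rewrite -(cvg_lim _ cS')//; apply: limr_ge; first exact: cvgP cS'.
  by apply: nearW => n; rewrite mulr_ge0 ?powR_ge0.
split; move: sq; apply: filterS => w [S0 pos neg].
  split; first exact: is_limsup_esup.
  by apply: is_limsup_einf; rewrite -negE.
apply: is_limsup_esup; rewrite negE in neg.
have v0 : 0 <= sigma * Num.sqrt (Sigma w) by rewrite mulr_ge0 ?sqrtr_ge0// ltW.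
have := is_limsup_sqr v0 pos neg; rewrite exprMn sqr_sqrtr//; apply: is_limsup_near.
near=> n.
have ll : 1 <= ln (ln n%:R) :> R.
  by near: n; apply: ln_near_ge; exact: lnn_cvgy.
rewrite expr_div_n sqr_sqrtr// !mulr_ge0 ?powR_ge0//.
by rewrite (le_trans ler01).
Unshelve. all: by end_near. Qed.
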